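(* Let $(X,\mathsf d)$ and $\mathsf E:X\to\mathbb R\cup\{+\infty\}$ satisfy the standing assumptions (A1)–(A3). Let $x,y\in X$, with possibly $\mathsf E(x)=+\infty$ or $\mathsf E(y)=+\infty$. Let $(\varepsilon_n)_{n\in\mathbb N}$ be any sequence of positive numbers with $\varepsilon_n\downarrow0$, and let $(\eta_n)_{n\in\mathbb N}$ be a sequence of positive numbers converging to $0$ slowly enough that $$\varepsilon_n\big(\mathsf E(\gamma^n_0)+\mathsf E(\gamma^n_1)\big)\to0,\qquad\text{where }\gamma_0^n:=\mathsf S_{\eta_n}x,\quad\gamma_1^n:=\mathsf S_{\eta_n}y.$$ Then $$\Gamma\text{-}\lim_{n\to\infty}\big\{\mathcal A_{\varepsilon_n}+\iota^n_{01}\big\}=\mathcal A+\iota_{01}$$ for the uniform convergence on $C([0,1],X)$. If moreover Assumption (S) holds, then the $\Gamma$-convergence also takes place with respect to the pointwise-in-time $\sigma$-topology. Here $\iota^n_{01}$ and $\iota_{01}$ are the convex indicators of the endpoint constraints for $\gamma_0^n,\gamma_1^n$ and for $x,y$, respectively.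
   Context: Curves: for a metric space $(X,\mathsf d)$, $C([0,1],X)$ denotes the continuous curves $\gamma=(\gamma_t)_{t\in[0,1]}$, $AC([0,1],X)$ the absolutely continuous ones, and $|\dot\gamma_t|$ the metric speed. Slope: $D(\mathsf E)=\{x\in X:\mathsf E(x)<\infty\}$. The slope $|\partial\mathsf E|(x)$ is $+\infty$ if $x\notin D(\mathsf E)$, $0$ if $x$ is isolated, and $|\partial\mathsf E|(x)=\limsup_{z\to x}\frac{[\mathsf E(x)-\mathsf E(z)]^+}{\mathsf d(x,z)}$ otherwise. $\mathrm{EVI}_\lambda$-gradient flow of $\mathsf E$ ($\lambda\in\mathbb R$) starting from $x$: a curve $(\gamma_t)_{t>0}$ in $AC_{loc}((0,\infty),X)$ with $\gamma_t\to x$ as $t\downarrow0$ and $\frac12\frac{d}{dt}\mathsf d^2(\gamma_t,z)+\frac\lambda2\mathsf d^2(\gamma_t,z)+\mathsf E(\gamma_t)\le\mathsf E(z)$ for all $z\in X$ and a.e. $t>0$. Standing assumptions: (A1) $(X,\mathsf d)$ is a complete separable metric space. (A2) $\mathsf E$ is lower semicontinuous, $\overline{D(\mathsf E)}=X$, and for every $\mathsf d$-bounded $B\subset X$ there is $c_B\in\mathbb R$ with $\mathsf E\ge c_B$ on $B$. (A3) There is $\lambda\in\mathbb R$ such that for every $x\in X$ there exists an $\mathrm{EVI}_\lambda$-gradient flow of $\mathsf E$ starting from $x$. Such flows are unique given the starting point, and $\mathsf S_tx$ denotes the value at time $t$ of the flow starting from $x$ (with $\mathsf S_0x=x$). Assumption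 (S): there is a Hausdorff topology $\sigma$ on $X$ such that every $\mathsf d$-bounded sequence has a $\sigma$-converging subsequence, and $\mathsf d$ (jointly in its two variables) and $|\partial\mathsf E|$ are sequentially $\sigma$-lower semicontinuous. Functionals on $C([0,1],X)$: $\mathcal A(\gamma)=\frac12\int_0^1|\dot\gamma_t|^2dt$ (equal to $+\infty$ if $\gamma$ is not absolutely continuous), $\mathcal I(\gamma)=\frac12\int_0^1|\partial\mathsf E|^2(\gamma_t)dt$, $\mathcal A_\varepsilon=\mathcal A+\varepsilon^2\mathcal I$ for $\varepsilon>0$. The convex indicator of the endpoint constraint for two points $p,q$ is the functional equal to $0$ if $\gamma_0=p$ and $\gamma_1=q$, and $+\infty$ otherwise. $\Gamma$-convergence is meant sequentially: $\Gamma\text{-}\lim_nF_n=F$ for a given notion of convergence of curves means that (liminf) $F(\gamma)\le\liminf_nF_n(\gamma^n)$ whenever $\gamma^n\to\gamma$, and (limsup) for every $\gamma$ there are $\gamma^n\to\gamma$ with $\limsup_nF_n(\gamma^n)\le F(\gamma)$. Convergence in the pointwise-in-time $\sigma$-topology means $\gamma^n_t\to\gamma_t$ in $\sigma$ for every $t\in[0,1]$. *)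

(* Defs.v *)
From mathcomp Require Export all_boot all_order all_algebra.
From mathcomp Require Export all_classical all_reals all_analysis.
Export Order.TTheory GRing.Theory Num.Theory.
Export numFieldNormedType.Exports.

Set Implicit Arguments.
Unset Strict Implicit.
Unset Printing Implicit Defensive.

Local Open Scope classical_set_scope.
Local Open Scope ring_scope.

Definition metric_complete (R : realType) (X : metricType R) : Prop :=
  forall u : nat -> X, cauchy (u @ \oo) -> exists l : X, u @ \oo --> l.

Definition metric_separable (R : realType) (X : metricType R) : Prop :=
  exists2 D : set X, countable D & dense D.

Definition mdist_bounded (R : realType) (X : metricType R) (B : set X) : Prop :=
  exists r : R, forall p q, B p -> B q -> mdist p q <= r.

Section functional.
Context (R : realType) (X : metricType R) (E : X -> \bar R).
Local Open Scope ereal_scope.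

Definition edomain : set X := [set p | E p < +oo].

(* Over the empty punctured neighbourhood filter of an isolated point,
   [limf_esup] would be -oo. *)
Definition slope (p : X) : \bar R :=
  if `[< ~ edomain p >] then +oo
  else if `[< isolated setT p >] then 0
  else limf_esup (fun z => maxe (E p - E z) 0 / (mdist p z)%:E) p^'.

Definition bounded_below_on_bounded : Prop :=
  forall B : set X, mdist_bounded B ->
    exists c : R, forall p, B p -> c%:E <= E p.

End functional.

Section curves.
Context (R : realType) (X : metricType R).
Implicit Types g : R -> X.

(* C([0,1], X): curves are total functions on R of which only the restriction
   to [0,1] matters. *)
Definition C01 : set (R -> X) := [set g : R -> X | {within `[0, 1], continuous g}].

Definition AC_on (a b : R) g : Prop :=
  exists f : R -> R,
    [/\ forall t, 0 <= f t,
        (@lebesgue_measure R).-integrable `[a, b] (EFin \o f) &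
        forall s t, a <= s -> s <= t -> t <= b ->
          ((mdist (g s) (g t))%:E <=
             \int[lebesgue_measure]_(r in `[s, t]) (f r)%:E)%E].

(* AC_loc((0,+oo), X) *)
Definition AC_loc_pos g : Prop :=
  forall a b : R, 0 < a -> a <= b -> AC_on a b g.

(* For an absolutely continuous curve the limit exists at almost every time;
   elsewhere [lim] returns an unspecified real. *)
Definition metric_speed g (t : R) : R :=
  lim (mdist (g (t + h)) (g t) / `|h| @[h --> 0^']).

Definition EVI_gradient_flow (E : X -> \bar R) (lam : R) (p : X) g : Prop :=
  [/\ AC_loc_pos g,
      g t @[t --> 0^'+] --> p &
      forall z : X, {ae (@lebesgue_measure R), forall t : R, 0 < t ->
        derivable (fun s : R => mdist (g s) z ^+ 2) t 1 /\
        ((2^-1 * derive1 (fun s : R => mdist (g s) z ^+ 2) t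
           + lam / 2 * mdist (g t) z ^+ 2)%:E + E (g t) <= E z)%E}].

Local Open Scope ereal_scope.

(* The time integrals are taken over the open interval, which differs from
   [0,1] by a null set, so that they only see g on [0,1]. *)
Definition action g : \bar R :=
  if `[< AC_on 0 1 g >]
  then (2^-1)%:E *
    \int[lebesgue_measure]_(t in `]0%R, 1%R[) ((metric_speed g t) ^+ 2)%:E
  else +oo.

Definition slope_action (E : X -> \bar R) g : \bar R :=
  (2^-1)%:E * \int[lebesgue_measure]_(t in `]0%R, 1%R[) (slope E (g t)) ^+ 2.

Definition perturbed_action (E : X -> \bar R) (eps : R) g : \bar R :=
  action g + (eps ^+ 2)%:E * slope_action E g.

Definition endpoint_indicator (p q : X) g : \bar R :=
  if `[< g 0%R = p /\ g 1%R = q >] then 0 else +oo.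

End curves.

(* A topology on the carrier of X, in addition to the one of the distance, is
   given by a class [sigma : Topological X]. *)
Definition sigma_space (X : Type) (sigma : Topological X) : topologicalType :=
  Topological.Pack sigma.

Definition sigma_cvg (X : Type) (sigma : Topological X)
    (u : nat -> X) (l : X) : Prop :=
  (u : nat -> sigma_space sigma) @ \oo --> (l : sigma_space sigma).

Record assumption_S (R : realType) (X : metricType R) (E : X -> \bar R)
    (sigma : Topological X) : Prop := {
  sigma_hausdorff : hausdorff_space (sigma_space sigma);
  sigma_compact : forall u : nat -> X, mdist_bounded (range u) ->
    exists (phi : nat -> nat) (l : X),
      {homo phi : m n / (m < n)%N} /\ sigma_cvg sigma (u \o phi) l;
  sigma_lsc_mdist : forall (u v : nat -> X) (p q : X),
    sigma_cvg sigma u p -> sigma_cvg sigma v q ->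
    ((mdist p q)%:E <= limn_einf (fun n => (mdist (u n) (v n))%:E))%E;
  sigma_lsc_slope : forall (u : nat -> X) (p : X), sigma_cvg sigma u p ->
    (slope E p <= limn_einf (fun n => slope E (u n)))%E
}.

(* [conv u v] stands for the convergence of the sequence [u] to [v]. *)
Definition seq_Gamma_lim (R : realType) (T : Type) (D : set T)
    (conv : (nat -> T) -> T -> Prop)
    (F : nat -> T -> \bar R) (F0 : T -> \bar R) : Prop :=
  (forall (u : nat -> T) (v : T), (forall n, D (u n)) -> D v -> conv u v ->
     (F0 v <= limn_einf (fun n => F n (u n)))%E) /\
  (forall v : T, D v -> exists u : nat -> T,
     [/\ forall n, D (u n), conv u v &
         (limn_esup (fun n => F n (u n)) <= F0 v)%E]).

Definition uniform_cvg01 (R : realType) (X : metricType R)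
    (u : nat -> R -> X) (v : R -> X) : Prop :=
  {uniform `[0, 1], u @ \oo --> v}.

Definition pointwise_sigma_cvg01 (R : realType) (X : metricType R)
    (sigma : Topological X) (u : nat -> R -> X) (v : R -> X) : Prop :=
  forall t : R, 0 <= t <= 1 -> sigma_cvg sigma (fun n => u n t) (v t).

(* Main.v *)
Require Import Defs.
From HB Require Import structures.
From mathcomp Require Import all_boot all_order all_algebra.
From mathcomp Require Import all_classical all_reals all_analysis.
From mathcomp Require Import measurable_realfun.
From mathcomp Require Import ring lra zify.
Import Order.TTheory GRing.Theory Num.Theory.
Import numFieldNormedType.Exports.

Set Implicit Arguments.
Unset Strict Implicit.
Unset Printing Implicit Defensive.

Local Open Scope classical_set_scope.
Local Open Scope ring_scope.

(** Both halves rest on the energy of a curve [g] along the partition of [0,1]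
    into N equal cells, the sum of N d(g(i/N), g((i+1)/N))^2.

    Lower bound. The slope part of the perturbed action is nonnegative and is
    discarded; what remains is the lower semicontinuity of the action under a
    pointwise convergence for which the distance is sequentially lower
    semicontinuous. Each energy is a finite sum of squared distances, hence is
    lower semicontinuous, and Hoelder's inequality bounds it by twice the
    action ([energy_le_action]). Conversely a continuous curve whose dyadic
    energies are bounded is absolutely continuous ([AC_of_energy]): the step
    functions of its difference quotients are Cauchy in L2, and a summable
    subsequence has an integrable majorant. Twice its action is then at most
    the lower limit of the energies ([action_le_energy]), because almost
    everywhere the difference quotients over shrinking intervals around a time
    are asymptotically at least the metric speed. The constraint passes to the
    limit because the distance separates distinct end points. Only the lower
    semicontinuity of the distance is used, so that [gamma_liminf] serves for
    the uniform convergence and for the pointwise convergence in sigma.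

    Upper bound. For a curve [v] of finite action A from x to y the recovery
    curve is u(t) = S_h(t) v(t) with h(t) = eta + K min(t, 1 - t) and
    K = 2 eps; its end points are S_eta x and S_eta y. All estimates use the
    evolution variational inequality with the constant -k, where
    k = |lambda| + 1, since a negative constant makes it weaker and removes
    the case distinction on the sign of lambda. Integrated over a time step of
    length d it compares S_(a+d) q with S_a p. Splitting the step in two halves
    leaves room for d^2 l^2 / 8, where l bounds the slope at S_(a+d) q
    ([evi_step]); that bound comes from the regularizing effect of the flow
    ([evi_slope_bound]), itself a consequence of contraction
    ([evi_contraction]). On a cell of length 1/N of the partition the height h
    changes by d = K/N, and after multiplication by about N the step inequality
    reads, up to factors tending to 1,

      N/2 d(u(s), u(t))^2 + K^2/8 l^2/N <= N/2 d(v(s), v(t))^2 + K (E - E'),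

    E and E' being the energies of [u] at the lower and at the upper end of the
    cell. Height increases on [0,1/2] and decreases on [1/2,1], so that the sum
    over the cells telescopes to K (E(u(0)) + E(u(1)) - 2 E(u(1/2)))
    ([recovery_sum]). Refining the partition, Fatou's lemma and the
    lower semicontinuity of [E] turn the left-hand side into the action of [u]
    plus K^2/4 = eps^2 times its slope action ([recovery_bound]); the slope
    bounds enter through their pointwise lower limit, since the slope along
    the curve is not known to be measurable. The energies of the end points
    contribute 2 eps (E(S_eta x) + E(S_eta y)), which tends to 0 by the choice
    of eta, and E(u(1/2)) is bounded below because u(1/2) stays close to v(1/2).
    Hence the upper limit is at most A. Finally [u] tends to [v] uniformly, as
    the flow moves the compact image of [v] little in a short time
    ([flow_small_time]), and convergence in distance implies convergence in
    sigma ([sigma_cvg_of_mdist]). *)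

(** * Absolutely continuous functions of a real variable *)

Section density.
Context d (T : measurableType d) (R : realType) (mu : {measure set T -> \bar R}).
Variable f : T -> \bar R.

(** The proofs [mf] and [f0] are arguments so that they can be read off the term
    when its measure structure is inferred. *)
Definition density_measure (mf : measurable_fun setT f)
    (f0 : forall x, (0 <= f x)%E) (A : set T) : \bar R :=
  (\int[mu]_(x in A) f x)%E.

Variables (mf : measurable_fun setT f) (f0 : forall x, (0 <= f x)%E).
Let nu := density_measure mf f0.

Let nu0 : nu set0 = 0%E.
Proof. exact: integral_set0. Qed.

Let nu_ge0 A : (0 <= nu A)%E.
Proof. by apply: integral_ge0 => x _; exact: f0. Qed.

Let nu_sigma_additive : semi_sigma_additive nu.
Proof. exact: semi_sigma_additive_nng_induced. Qed.

HB.instance Definition _ := isMeasure.Build _ _ _ (density_measure mf f0)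
  nu0 nu_ge0 nu_sigma_additive.

End density.

Lemma stieltjes_itv_bndc (R : realType) (g : cumulative R R) (a b : R) :
  a <= b -> lebesgue_stieltjes_measure g `]a, b]%classic = (g b - g a)%:E.
Proof.
move=> ab; rewrite /lebesgue_stieltjes_measure /measure_extension.
by rewrite measurable_mu_extE//= ?wlength_itv_bnd//; exact: is_ocitv.
Qed.

Section lebesgue_primitive.
Context {R : realType}.
Notation mu := (@lebesgue_measure R).
Implicit Types (f u : R -> R).

Lemma primitiveB f (s t : R) : mu.-integrable setT (EFin \o f) -> s <= t ->
  \int[mu]_(x in `]-oo, t]) f x - \int[mu]_(x in `]-oo, s]) f x =
  \int[mu]_(x in `]s, t]) f x.
Proof.
move=> fi st; rewrite -[RHS](@Rintegral_itvB _ _ -oo%O (BRight t) s)//.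
by apply: integrableS fi.
Qed.

(** Absolute continuity of the integral, for intervals of small length. *)
Lemma Rintegral_itv_small f : mu.-integrable setT (EFin \o f) ->
  forall e, 0 < e -> exists2 d, 0 < d &
    forall s t, s <= t -> t - s < d -> \int[mu]_(x in `]s, t]) `|f x| < e.
Proof.
move=> fi e e0; have [d [d0 H]] := integral_normr_continuous fi e0.
exists d => // s t st tsd; apply: H => //.
have muE := @lebesgue_measure_itv R `]s, t].
apply: (le_lt_trans (y := (t - s)%:E)); last by rewrite lte_fin.
rewrite [leLHS]muE /= lte_fin; case: ifP => _; first by rewrite -EFinB.
by rewrite lee_fin subr_ge0.
Qed.

Section increments_controlled.
Variables (f u : R -> R).
Hypothesis f0 : forall t, 0 <= f t.
Hypothesis fi : mu.-integrable setT (EFin \o f).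
Hypothesis uf : forall s t, s <= t ->
  `|u t - u s| <= \int[mu]_(x in `]s, t]) f x.

Let F t := \int[mu]_(x in `]-oo, t]) f x.
Let psi t := F t + u t.
Let chi t := F t - u t.
Let psichi t := psi t + chi t.

Let FB s t : s <= t -> F t - F s = \int[mu]_(x in `]s, t]) f x.
Proof. exact: primitiveB. Qed.

Let nd (g : R -> R) : (forall s t, s <= t -> 0 <= g t - g s) -> nondecreasing g.
Proof. by move=> H s t /H; rewrite subr_ge0. Qed.

Let psi_nd : nondecreasing psi.
Proof.
apply: nd => s t st; have := uf st; rewrite -FB// ler_norml /psi => /andP[? ?].
lra.
Qed.

Let chi_nd : nondecreasing chi.
Proof.
apply: nd => s t st; have := uf st; rewrite -FB// ler_norml /chi => /andP[? ?].
lra.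
Qed.

Let psichi_nd : nondecreasing psichi.
Proof. by move=> s t st; rewrite lerD// ?psi_nd ?chi_nd. Qed.

Let rc (g : R -> R) : (forall s t, s <= t -> `|g t - g s| <= 4 * (F t - F s)) ->
  right_continuous g.
Proof.
move=> H x; apply/cvgrPdist_lt => e e0.
have e4 : 0 < e / 4 by rewrite divr_gt0.
have [d d0 fd] := Rintegral_itv_small fi e4.
near=> y; have xy : x <= y by near: y; exact: nbhs_right_ge.
rewrite distrC; apply: le_lt_trans (H _ _ xy) _.
rewrite mulrC -ltr_pdivlMr// FB//.
under eq_Rintegral do rewrite -[f _]ger0_norm//.
apply: fd => //; rewrite ltrBlDl.
by near: y; apply: nbhs_right_lt; rewrite ltrDl.
Unshelve. all: by end_near. Qed.

Let psi_rc : right_continuous psi.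
Proof.
apply: rc => s t st; have := uf st; rewrite -FB// /psi !ler_norml => /andP[? ?].
lra.
Qed.

Let chi_rc : right_continuous chi.
Proof.
apply: rc => s t st; have := uf st; rewrite -FB// /chi !ler_norml => /andP[? ?].
lra.
Qed.

Let psichi_rc : right_continuous psichi.
Proof.
apply: rc => s t st; have := uf st.
rewrite -FB// /psichi /psi /chi !ler_norml => /andP[? ?].
lra.
Qed.

HB.instance Definition _ := isCumulative.Build R _ R psi psi_nd psi_rc.
HB.instance Definition _ := isCumulative.Build R _ R chi chi_nd chi_rc.
HB.instance Definition _ := isCumulative.Build R _ R psichi psichi_nd psichi_rc.

Let mpsi := lebesgue_stieltjes_measure (psi : cumulative R R).
Let mchi := lebesgue_stieltjes_measure (chi : cumulative R R).
Let mpc := lebesgue_stieltjes_measure (psichi : cumulative R R).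

Let mpcE A : measurable A -> mpc A = measure_add mpsi mchi A.
Proof.
apply: lebesgue_stieltjes_measure_unique => X /ocitvP[->|[[a b] /= ab ->]].
  by rewrite !measure0.
have e g := @stieltjes_itv_bndc R g a b (ltW ab).
rewrite [RHS]measure_addE [LHS]e [X in (X + _)%E]e [X in (_ + X)%E]e.
by rewrite -EFinD /= /psichi opprD addrACA.
Qed.

Let mf : measurable_fun setT (EFin \o f).
Proof. exact: measurable_int fi. Qed.

Let mf2 : measurable_fun setT (fun x => 2%:E * (f x)%:E)%E.
Proof. exact: measurable_funeM. Qed.

Let f20 x : (0 <= 2%:E * (f x)%:E)%E.
Proof. by rewrite -EFinM lee_fin mulr_ge0. Qed.

Let mpcF A : measurable A -> mpc A = density_measure mu mf2 f20 A.
Proof.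
apply: lebesgue_stieltjes_measure_unique => X /ocitvP[->|[[a b] /= ab ->]].
  by rewrite !measure0.
rewrite /density_measure /mpc stieltjes_itv_bndc ?ltW//.
have fiab : mu.-integrable `]a, b] (EFin \o f) by exact: integrableS fi.
rewrite ge0_integralZl//; first last.
- by move=> x _; rewrite lee_fin.
- by case/integrableP: fiab.
rewrite -[X in (_ * X)%E]fineK ?integrable_fin_num// -EFinM; congr EFin.
rewrite -[fine _]/(\int[mu]_(x in `]a, b]) f x) -FB ?ltW//.
change (F b + u b + (F b - u b) - (F a + u a + (F a - u a)) = 2 * (F b - F a)).
by move: (F a) (F b) (u a) (u b) => ? ? ? ?; ring.
Qed.

Let mpsi_le A : measurable A -> (mpsi A <= \int[mu]_(x in A) (2%:E * (f x)%:E))%E.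
Proof.
move=> mA; rewrite -[leRHS]/(density_measure mu mf2 f20 A).
by rewrite -mpcF// mpcE// [leRHS]measure_addE leeDl.
Qed.

Let mpsi_fin : fin_num_fun mpsi.
Proof.
move=> A mA; rewrite ge0_fin_numE//; apply: le_lt_trans (mpsi_le mA) _.
have fiA : mu.-integrable A (EFin \o f) by exact: integrableS fi.
have /integrable_fin_num : mu.-integrable A (fun x => 2%:E * (f x)%:E)%E.
  exact: integrableZl.
by move=> /(_ mA); rewrite fin_numElt => /andP[].
Qed.

HB.instance Definition _ := Measure.on mpsi.
HB.instance Definition _ := Measure_isFinite.Build _ _ _ mpsi mpsi_fin.

Let mpsi_dom : mpsi `<< mu.
Proof.
apply/null_content_dominatesP => A mA A0; apply/eqP; rewrite eq_le measure_ge0 andbT.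
apply: le_trans (mpsi_le mA) _.
rewrite null_set_integral//; apply: measurable_funTS; exact: mf2.
Qed.

(** With [F] the primitive of [f], the functions [psi = F + u] and
    [chi = F - u] are nondecreasing and right-continuous, and their Stieltjes
    measures add up to that of [2 F], which has density [2 f] because measures
    agreeing on half-open intervals are equal. Hence the measure of [psi] is
    dominated by Lebesgue measure, and its Radon-Nikodym density minus [f] is
    the density of [u]. *)
Lemma controlled_increments_primitive : exists2 v,
  mu.-integrable setT (EFin \o v) &
  forall s t, s <= t -> u t - u s = \int[mu]_(x in `]s, t]) v x.
Proof.
have [w [w0 wfin wi wE]] := radon_nikodym_sigma_finite mpsi_dom.
have wfi : mu.-integrable setT (EFin \o (fine \o w)).
  by apply: eq_integrable wi => // x _ /=; rewrite fineK.
exists (fun x => fine (w x) - f x).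
  by apply: eq_integrable (integrableB measurableT wfi fi).
move=> s t st.
rewrite RintegralB//; [|exact: integrableS wfi|exact: integrableS fi].
rewrite -FB//.
have : mpsi `]s, t]%classic = (psi t - psi s)%:E by exact: stieltjes_itv_bndc.
rewrite wE// => /(congr1 fine)/= h.
rewrite [X in _ = X - _](_ : _ = psi t - psi s); first last.
  by rewrite -h /Rintegral; congr fine; apply: eq_integral => x _; rewrite fineK.
change (u t - u s = F t + u t - (F s + u s) - (F t - F s)).
by move: (F t) (F s) => ? ?; ring.
Qed.

End increments_controlled.
End lebesgue_primitive.

Section absolutely_continuous.
Context {R : realType}.
Notation mu := (@lebesgue_measure R).
Implicit Types (f u : R -> R).

Lemma lebesgue_itvoc (s t : R) : s <= t -> mu `]s, t] = (t - s)%:E.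
Proof.
move=> st; have h := @lebesgue_measure_itv R `]s, t]; rewrite [LHS]h /=.
rewrite lte_fin; case: ltP => [_|ts]; first by rewrite -EFinB.
by rewrite (le_anti (introT andP (conj st ts))) subrr.
Qed.

Definition clamp (a b t : R) := Num.max a (Num.min b t).

Lemma clamp_id a b t : a <= t -> t <= b -> clamp a b t = t.
Proof. by move=> at_ tb; rewrite /clamp (min_idPr tb) (max_idPr at_). Qed.

(** Reduction to the whole line: [u] is frozen outside [a,b] by composition
    with [clamp], and [f] is extended by zero. *)
Lemma ac_primitive a b f u : a < b -> (forall t, 0 <= f t) ->
  mu.-integrable `[a, b] (EFin \o f) ->
  (forall s t, a <= s -> s <= t -> t <= b ->
    (`|u t - u s|%:E <= \int[mu]_(r in `[s, t]) (f r)%:E)%E) ->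
  exists2 v, mu.-integrable setT (EFin \o v) &
    (forall s t, a <= s -> s <= t -> t <= b ->
       u t - u s = \int[mu]_(x in `]s, t]) v x).
Proof.
move=> ab f0 fi uf.
pose g := f \_ `[a, b].
have g0 t : 0 <= g t by rewrite /g patchE; case: ifP.
have gi : mu.-integrable setT (EFin \o g).
  by move: fi; rewrite integrable_mkcond//= (restrict_EFin f).
pose c := clamp a b.
have cab t : a <= c t /\ c t <= b.
  by rewrite /c /clamp le_max lexx ge_max ge_min lexx (ltW ab).
have cnd s t : s <= t -> c s <= c t.
  by move=> st; rewrite /c /clamp ge_max !le_max !le_min !ge_min !lexx st !orbT.
have ug s t : s <= t -> `|u (c t) - u (c s)| <= \int[mu]_(x in `]s, t]) g x.
  move=> st; have [cst|cst] := ltP (c s) (c t); last first.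
    have -> : c t = c s by apply/eqP; rewrite eq_le cst cnd.
    by rewrite subrr normr0; apply: Rintegral_ge0.
  have [acs csb] := cab s; have [act ctb] := cab t.
  have gist : mu.-integrable `]s, t] (EFin \o g) by exact: integrableS gi.
  rewrite -lee_fin /Rintegral fineK ?integrable_fin_num//.
  apply: le_trans (uf _ _ acs (ltW cst) ctb) _.
  rewrite -integral_itv_obnd_cbnd; last first.
    apply: measurable_funS (measurable_int _ fi) => //.
    apply: subset_itv; rewrite bnd_simp//.
  rewrite [leLHS](_ : _ = \int[mu]_(x in `]c s, c t]) (g x)%:E)%E; last first.
    apply: eq_integral => x; rewrite inE/= in_itv/= => /andP[csx xct].
    by rewrite /g patchE mem_set//= in_itv/= (le_trans acs (ltW csx)) (le_trans xct).
  apply: ge0_subset_integral => //; first by case/integrableP: gist.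
    by move=> x _; rewrite lee_fin.
  move=> x; rewrite /= !in_itv/= => /andP[csx xct]; apply/andP; split.
    apply: le_lt_trans csx; rewrite leNgt; apply/negP => cs_s.
    have : c s < b by apply: lt_le_trans ctb.
    move: cs_s; rewrite /c /clamp !gt_max !gt_min !ltxx/= orbF.
    by move=> /andP[_ bs] /andP[_ sb]; move: (lt_trans bs sb); rewrite ltxx.
  apply: le_trans xct _; rewrite leNgt; apply/negP => tct.
  have : a < c t by apply: le_lt_trans acs _.
  move: tct; rewrite /c /clamp !lt_max !lt_min !ltxx/= andbF orbF => ta.
  by move=> /andP[_ at_]; move: (lt_trans ta at_); rewrite ltxx.
have [v vi vE] := controlled_increments_primitive g0 gi ug.
exists v => // s t as_ st tb; rewrite -vE// /c !clamp_id//;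
  [exact: le_trans st tb|exact: le_trans as_ st].
Qed.

Lemma primitive_derivable (v : R -> R) : mu.-integrable setT (EFin \o v) ->
  {ae mu, forall t : R,
    is_derive t 1 (fun x : R => \int[mu]_(r in `]-oo, x]) v r) (v t)}.
Proof.
move=> vi; have locv : locally_integrable setT v.
  by apply: open_integrable_locally => //; exact: openT.
have vi' y : mu.-integrable `]-oo, y] (EFin \o v) by exact: integrableS vi.
have := FTC1Ny vi' locv; apply: filterS; first exact: (ae_filter_ringOfSetsType mu).
by move=> t /= [dt <-]; apply: DeriveDef => //; rewrite derive1E.
Qed.

Lemma primitive_is_derive (a b : R) (v u : R -> R) (t : R) :
  mu.-integrable setT (EFin \o v) ->
  (forall s t, a <= s -> s <= t -> t <= b ->
       u t - u s = \int[mu]_(x in `]s, t]) v x) ->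
  is_derive t 1 (fun x : R => \int[mu]_(r in `]-oo, x]) v r) (v t) ->
  a < t < b -> is_derive t 1 u (v t).
Proof.
move=> vi uE dt /andP[at_ tb].
pose G x := \int[mu]_(r in `]-oo, x]) v r.
have : is_derive t 1 (G + cst (u a - G a)) (v t + 0) by exact: is_deriveD.
rewrite addr0; apply: near_eq_is_derive.
near=> x; have ax : a <= x by apply/ltW; near: x; exact: lt_nbhsr.
have xb : x <= b by apply/ltW; near: x; exact: lt_nbhsl.
have := uE _ _ (lexx a) ax xb; rewrite -primitiveB// => h.
change (G x + (u a - G a) = u x); rewrite -[RHS](subrK (u a)) h /G; ring.
Unshelve. all: by end_near. Qed.

(** For an absolutely continuous function the increment is the integral of the
    derivative. *)
Lemma ac_nonincreasing a b f u : a <= b -> (forall t, 0 <= f t) ->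
  mu.-integrable `[a, b] (EFin \o f) ->
  (forall s t, a <= s -> s <= t -> t <= b ->
    (`|u t - u s|%:E <= \int[mu]_(r in `[s, t]) (f r)%:E)%E) ->
  {ae mu, forall t : R, a < t < b -> 'D_1 u t <= 0} ->
  u b <= u a.
Proof.
rewrite le_eqVlt => /predU1P[->//|ab] f0 fi uf du.
have [v vi uE] := ac_primitive ab f0 fi uf.
rewrite -subr_le0 (uE _ _ (lexx a) (ltW ab) (lexx b)).
rewrite -(@Rintegral_itv_bndo_bndc R (BRight a) b v); last exact: integrableS vi.
rewrite -oppr_ge0 -mulN1r -RintegralZl//; last exact: integrableS vi.
have vi' : mu.-integrable `]a, b[ (EFin \o v) by exact: integrableS vi.
(* The derivative being nonpositive almost everywhere, the integrand agrees
   almost everywhere with its positive part, whose integral is nonnegative. *)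
have -> : \int[mu]_(x in `]a, b[) (-1 * v x) =
    fine (\int[mu]_(x in `]a, b[) ((Num.max (-1 * v x) 0)%:E)).
  congr fine; apply: ae_eq_integral => //.
  - by apply/measurable_EFinP/measurable_funM => //; apply/measurable_EFinP;
      case/integrableP: vi'.
  - apply/measurable_EFinP/measurable_maxr => //; apply: measurable_funM => //.
    by apply/measurable_EFinP; case/integrableP: vi'.
  have := primitive_derivable vi; move: du.
  apply: filterS2; first exact: (ae_filter_ringOfSetsType mu).
  move=> t dle dt tab.
  move: tab; rewrite /= in_itv/= => tab; have := primitive_is_derive vi uE dt tab.
  move=> -[_ dv]; congr EFin; apply/esym/max_idPl; rewrite mulN1r oppr_ge0 -dv.
  exact: dle.
by apply: fine_ge0; apply: integral_ge0 => x _; rewrite lee_fin le_max lexx orbT.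
Qed.

End absolutely_continuous.

Section straddle.
Context {R : realType}.
Notation mu := (@lebesgue_measure R).

(** Cells of a partition contain a given time in their interior, so that
    difference quotients are needed over intervals around [t], not only over
    intervals with [t] as an end point. *)
Lemma is_derive_straddle (u : R -> R) (t l : R) : is_derive t 1 u l ->
  forall e, 0 < e -> exists2 d, 0 < d & forall a b, a <= t -> t <= b ->
    t - a < d -> b - t < d -> `|u b - u a - l * (b - a)| <= e * (b - a).
Proof.
move=> [du lE] e e0.
have : h^-1 *: (u (h + t) - u t) @[h --> 0^'] --> l.
  have -> : (fun h : R => h^-1 *: (u (h + t) - u t)) =
      (fun h : R => h^-1 *: ((u \o shift t) (h *: (1 : R)) - u t)).
    by apply/funext => h /=; rewrite [h *: 1]mulr1.
  by rewrite -lE; exact: du.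
move=> /cvgrPdist_le /(_ _ e0) [d /= d0 dP].
exists d => // a b at_ tb tad btd.
have H x : `|x - t| < d -> `|u x - u t - l * (x - t)| <= e * `|x - t|.
  move=> xd; have [->|xt] := eqVneq x t.
    by rewrite !subrr normr0 mulr0 subrr normr0 mulr0.
  have xt0 : x - t != 0 by rewrite subr_eq0.
  have := dP (x - t); rewrite /= sub0r normrN => /(_ xd xt0).
  rewrite subrK -(ler_pM2r (x := `|x - t|)) ?normr_gt0// -normrM.
  by rewrite mulrBl distrC /GRing.scale/= mulrAC mulVf// mul1r.
have ea : `|a - t| = t - a by rewrite distrC ger0_norm ?subr_ge0.
have eb : `|b - t| = b - t by rewrite ger0_norm ?subr_ge0.
have := H a; rewrite ea => /(_ tad) Ha; have := H b; rewrite eb => /(_ btd) Hb.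
rewrite (_ : _ - _ = (u b - u t - l * (b - t)) - (u a - u t - l * (a - t)));
  last by ring.
apply: le_trans (ler_normB _ _) _; have := lerD Hb Ha.
by rewrite -mulrDr (_ : b - t + (t - a) = b - a); last by ring.
Qed.

Lemma EFin_Rintegral_itv (f : R -> R) (a b s t : R) :
  mu.-integrable `[a, b] (EFin \o f) -> a <= s -> t <= b ->
  (\int[mu]_(x in `[s, t]) (f x)%:E = (\int[mu]_(x in `]s, t]) f x)%:E)%E.
Proof.
move=> fi as_ tb.
have fi' : mu.-integrable `]s, t] (EFin \o f).
  apply: integrableS fi => //; apply: subset_itv; rewrite bnd_simp//.
rewrite -integral_itv_obnd_cbnd; last exact: measurable_int fi'.
by rewrite /Rintegral fineK// integrable_fin_num.
Qed.

End straddle.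

(** * The metric speed *)

Section metric_speed.
Context {R : realType} {X : metricType R}.
Notation mu := (@lebesgue_measure R).
Implicit Types (g : R -> X).

Lemma mdist_lip (p q r : X) : `|mdist p r - mdist q r| <= mdist p q.
Proof.
rewrite ler_norml; apply/andP; split.
  by have := metric_triangle q p r; rewrite (metric_sym q p); lra.
by have := metric_triangle p q r; lra.
Qed.

Lemma integral_itv_fin_num (i : interval R) (f : R -> \bar R) :
  mu.-integrable [set` i] f -> (\int[mu]_(x in [set` i]) f x)%E \is a fin_num.
Proof. by move=> fi; apply: integrable_fin_num. Qed.

Lemma AC_on_integrableT (a b : R) g : AC_on a b g -> exists f : R -> R,
  [/\ forall t, 0 <= f t, mu.-integrable setT (EFin \o f) &
    forall s t, a <= s -> s <= t -> t <= b ->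
      mdist (g s) (g t) <= \int[mu]_(r in `]s, t]) f r].
Proof.
move=> [f [f0 fi gf]]; exists (f \_ `[a, b]); split.
- by move=> t; rewrite patchE; case: ifP.
- by move: fi; rewrite integrable_mkcond//= (restrict_EFin f).
move=> s t as_ st tb; rewrite -lee_fin; apply: le_trans (gf _ _ as_ st tb) _.
rewrite (EFin_Rintegral_itv fi as_ tb) lee_fin.
rewrite le_eqVlt; apply/orP; left; apply/eqP; apply: eq_Rintegral => x.
rewrite inE/= in_itv/= => /andP[sx xt]; rewrite patchE mem_set//= in_itv/=.
by rewrite (le_trans as_ (ltW sx)) (le_trans xt).
Qed.

Lemma AC_on_unif (a b : R) g : AC_on a b g -> forall e, 0 < e ->
  exists2 d, 0 < d & forall s t, a <= s -> s <= b -> a <= t -> t <= b ->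
    `|s - t| < d -> mdist (g s) (g t) < e.
Proof.
move=> /AC_on_integrableT[f [f0 fi gf]] e e0.
have [d d0 dP] := Rintegral_itv_small fi e0; exists d => // s t as_ sb at_ tb.
wlog st : s t as_ sb at_ tb / s <= t => [H|].
  have [st|/ltW ts] := leP s t; first exact: H.
  by rewrite distrC metric_sym; exact: H.
rewrite distrC ger0_norm ?subr_ge0// => std.
apply: le_lt_trans (gf _ _ as_ st tb) _.
by under eq_Rintegral do rewrite -[f _]ger0_norm//; exact: dP.
Qed.

(** Supplies a countable dense set of times inside [0,1], reached by clamping
    all rationals. *)
Lemma clamped_rat_dense (s d : R) : 0 <= s -> s <= 1 -> 0 < d ->
  exists q : rat, `|clamp 0 1 (ratr q) - s| < d.
Proof.
move=> s0 s1 d0.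
have [q] : exists q : rat, ratr q \in `]s - d, s + d[.
  by have [|q] := @rat_in_itvoo R (s - d) (s + d); [lra|exists q].
rewrite in_itv/= => /andP[q1 q2]; exists q; rewrite ltr_norml.
rewrite /clamp maxEle minEle; case: ifP; case: ifP; lra.
Qed.

(** The lower half of the statement that [g] has speed [l] at [t], for
    intervals around [t]; it is what the Fatou argument on the energies uses. *)
Definition straddle_lower g (t l : R) := forall e, 0 < e -> exists2 d, 0 < d &
  forall a b, a <= t -> t <= b -> t - a < d -> b - t < d ->
    (l - e) * (b - a) <= mdist (g a) (g b).

(** The functions [phi q = d(g(.), g(q))], for rational times q, are absolutely
    continuous, and the supremum [m] of the absolute values of their
    derivatives is the speed. The bound of the distance by the integral of [m]
    follows by letting q tend to the initial time, and bounds the speed from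
      above at Lebesgue points of
    [m]. The other half holds since each [phi q] is
    1-Lipschitz in the distance, so that the distance over an interval is at
    least the increment of any single [phi q]. *)
Lemma metric_speed_AC g : AC_on 0 1 g -> exists m : R -> R,
  [/\ forall t, 0 <= m t,
      mu.-integrable setT (EFin \o m),
      forall s t, 0 <= s -> s <= t -> t <= 1 ->
        mdist (g s) (g t) <= \int[mu]_(r in `]s, t]) m r &
      {ae mu, forall t : R, 0 < t < 1 ->
        straddle_lower g t (m t) /\ metric_speed g t = m t}].
Proof.
move=> gAC; have [f [f0 fi gf]] := AC_on_integrableT gAC.
have gU := AC_on_unif gAC.
pose pt n : X := g (clamp 0 1 (ratr (odflt 0 (unpickle n)))).
pose phi n t := mdist (g t) (pt n).
have phif n s t : 0 <= s -> s <= t -> t <= 1 ->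
    `|phi n t - phi n s| <= \int[mu]_(r in `]s, t]) f r.
  move=> s0 st t1; apply: le_trans (gf _ _ s0 st t1).
  by rewrite (metric_sym (g s)); exact: mdist_lip.
have fi01 : mu.-integrable `[0, 1] (EFin \o f) by exact: integrableS fi.
have vex n : exists v, mu.-integrable setT (EFin \o v) /\
    forall s t, 0 <= s -> s <= t -> t <= 1 ->
      phi n t - phi n s = \int[mu]_(r in `]s, t]) v r.
  have [|v vi vE] := @ac_primitive R 0 1 f (phi n) ltr01 f0 fi01.
    by move=> s t s0 st t1; rewrite (EFin_Rintegral_itv fi01)// lee_fin phif.
  by exists v.
have {vex}[v vP] := choice vex.
have vi n := (vP n).1; have vE n := (vP n).2.
pose M t := ereal_sup (range (fun n => (`|v n t|)%:E)).
have mvn n : measurable_fun setT (v n).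
  by apply/measurable_EFinP; case/integrableP: (vi n).
have mf : measurable_fun setT f by apply/measurable_EFinP; case/integrableP: fi.
have mM : measurable_fun setT M.
  have : measurable_fun setT (fun t => esups (fun n => (`|v n t|)%:E) 0).
    by apply: measurable_fun_esups => n; apply/measurable_EFinP;
      exact: measurableT_comp.
  congr (measurable_fun _ _); apply/funext => t; congr ereal_sup.
  by apply/seteqP; split=> _ [n _ <-]; exists n.
(* Almost everywhere [M <= f]; the minimum makes [m] finite and integrable
   on the exceptional null set too. *)
pose m t := Num.min (fine (M t)) (f t).
have M0 t : (0 <= M t)%E.
  by apply: (@le_trans _ _ (`|v 0%N t|)%:E) => //; apply: ereal_sup_ubound;
    exists 0%N.
have m0 t : 0 <= m t by rewrite le_min f0 fine_ge0.
have mm : measurable_fun setT m.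
  by apply: measurable_minr => //; exact: measurableT_comp.
have mi : mu.-integrable setT (EFin \o m).
  apply: le_integrable fi => //; first exact/measurable_EFinP.
  by move=> t _ /=; rewrite lee_fin !ger0_norm// ge_min lexx orbT.
have f'P := primitive_derivable fi.
have m'P := primitive_derivable mi.
have v'P : {ae mu, forall (t : R) n,
    is_derive t 1 (fun x : R => \int[mu]_(r in `]-oo, x]) v n r) (v n t)}.
  by apply: ae_foralln => n; exact: primitive_derivable.
have good : {ae mu, forall t : R, 0 < t < 1 ->
    [/\ is_derive t 1 (fun x : R => \int[mu]_(r in `]-oo, x]) m r) (m t),
        forall n, is_derive t 1 (phi n) (v n t),
        forall n, `|v n t| <= m t &
        forall e, 0 < e -> exists n, m t - e < `|v n t|]}.
  move: f'P m'P v'P; apply: filterS3; first exact: (ae_filter_ringOfSetsType mu).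
  move=> t df dm dv t01; have /andP[t0 t1] := t01.
  have dphi n : is_derive t 1 (phi n) (v n t).
    exact: primitive_is_derive (vi n) (vE n) (dv n) t01.
  have vf n : `|v n t| <= f t.
    apply/ler_addgt0Pl => e e0.
    have e2 : 0 < e / 2 by rewrite divr_gt0.
    have [d1 d10 D1] := is_derive_straddle df e2.
    have [d2 d20 D2] := is_derive_straddle (dphi n) e2.
    pose h := Num.min (Num.min (d1 / 2) (d2 / 2)) ((1 - t) / 2).
    have h0 : 0 < h by rewrite !lt_min !divr_gt0// subr_gt0.
    have hd1 : h <= d1 / 2 by rewrite !ge_min lexx.
    have hd2 : h <= d2 / 2 by rewrite !ge_min lexx orbT.
    have hd3 : h <= (1 - t) / 2 by rewrite !ge_min lexx orbT.
    have tth : t <= t + h by lra.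
    have th1 : t + h <= 1 by lra.
    have := D1 t (t + h) (lexx t) tth; have := D2 t (t + h) (lexx t) tth.
    have -> : t + h - t = h by ring.
    rewrite subrr => /(_ d20) {}D2 /(_ d10) {}D1.
    have {}D1 := D1 ltac:(lra); have {}D2 := D2 ltac:(lra).
    rewrite primitiveB// in D1.
    have D3 := phif n t (t + h) (ltW t0) tth th1.
    rewrite -(ler_pM2r h0) -{1}(gtr0_norm h0) -normrM.
    move: D1 D2 D3; rewrite !ler_norml => /andP[? ?] /andP[? ?] /andP[? ?].
    by apply/andP; split; lra.
  have Mf : (M t <= (f t)%:E)%E.
    by apply: ge_ereal_sup => _ [n _ <-]; rewrite lee_fin.
  have Mfin : M t \is a fin_num by rewrite ge0_fin_numE//;
    apply: le_lt_trans Mf (ltry _).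
  have mE : m t = fine (M t) by apply/min_idPl; rewrite -lee_fin fineK.
  split=> //.
    move=> n; rewrite mE -lee_fin fineK//; apply: ereal_sup_ubound.
    by exists n.
  move=> e e0; have [_ [n _ <-]] := ub_ereal_sup_adherent e0 Mfin.
  by rewrite -/(M t) -[M t]fineK// -mE -EFinB lte_fin => ?; exists n.
have gm s t : 0 <= s -> s <= t -> t <= 1 ->
    mdist (g s) (g t) <= \int[mu]_(r in `]s, t]) m r.
  move=> s0 st t1; apply/ler_addgt0Pl => e e0.
  have e2 : 0 < e / 2 by rewrite divr_gt0.
  have [d d0 dP] := gU _ e2.
  have s1 : s <= 1 by exact: le_trans t1.
  have [q qs] := clamped_rat_dense s0 s1 d0.
  pose n := pickle q.
  have pq : pt n = g (clamp 0 1 (ratr q)) by rewrite /pt /n pickleK.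
  have sp : mdist (g s) (pt n) < e / 2.
    rewrite pq; apply: dP => //; last by rewrite distrC.
      by rewrite /clamp le_max lexx.
    by rewrite /clamp ge_max ler01 ge_min lexx.
  have I1 : mdist (g s) (g t) <= e + `|phi n t - phi n s|.
    have := metric_triangle (g s) (pt n) (g t); rewrite (metric_sym (pt n)).
    have := ler_norm (phi n t - phi n s); rewrite /phi; lra.
  apply: le_trans I1 _; rewrite lerD2l vE//.
  have vist : mu.-integrable `]s, t] (EFin \o v n) by exact: integrableS (vi n).
  have mist : mu.-integrable `]s, t] (EFin \o m) by exact: integrableS mi.
  apply: le_trans (le_normr_Rintegral _ vist) _ => //.
  have nist : mu.-integrable `]s, t] (EFin \o (fun x => `|v n x|))
    by exact: integrable_norm vist.
  have vist' : mu.-integrable `]s, t[ (EFin \o v n) by exact: integrableS (vi n).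
  have mist' : mu.-integrable `]s, t[ (EFin \o m) by exact: integrableS mi.
  have nist' : mu.-integrable `]s,
    t[ (EFin \o (fun x => `|v n x|)) by exact: integrable_norm vist'.
  have E1 := @Rintegral_itv_bndo_bndc R (BRight s) t _ nist'.
  have E2 := @Rintegral_itv_bndo_bndc R (BRight s) t _ mist'.
  rewrite -E1 -E2.
  have finv := integral_itv_fin_num nist'.
  have finm := integral_itv_fin_num mist'.
  rewrite -lee_fin /Rintegral !fineK//.
  apply: ae_ge0_le_integral => //;
    [exact: measurable_int nist'| |exact: measurable_int mist'|].
    by move=> x _; rewrite lee_fin.
  move: good; apply: filterS; first exact: (ae_filter_ringOfSetsType mu).
  move=> x xP; rewrite /= in_itv/= => /andP[sx xt]; rewrite lee_fin.
  by have [|_ _ /(_ n)//] := xP; rewrite (le_lt_trans s0 sx) (lt_le_trans xt t1).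
exists m; split; [exact: m0|exact: mi|exact: gm|].
move: good; apply: filterS; first exact: (ae_filter_ringOfSetsType mu).
move=> t tP t01; have [dm dphi vm mv] := tP t01; have /andP[t0 t1] := t01.
have low : straddle_lower g t (m t).
  move=> e e0; have e2 : 0 < e / 2 by rewrite divr_gt0.
  have [n nP] := mv _ e2.
  have [d d0 D] := is_derive_straddle (dphi n) e2.
  exists d => // a b at_ tb tad btd; have {}D := D a b at_ tb tad btd.
  have ab : 0 <= b - a by lra.
  have E1 : `|phi n b - phi n a| <= mdist (g a) (g b).
    by rewrite (metric_sym (g a)); exact: mdist_lip.
  have E2 : `|v n t| * (b - a) <= `|phi n b - phi n a| + e / 2 * (b - a).
    rewrite -[X in _ * X]ger0_norm// -normrM.
    have -> : v n t * (b - a) = (phi n b - phi n a) -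
      (phi n b - phi n a - v n t * (b - a)) by ring.
    by apply: le_trans (ler_normB _ _) _; rewrite lerD2l.
  have : (m t - e / 2) * (b - a) <= `|v n t| * (b - a) by rewrite ler_wpM2r// ltW.
  by move=> ?; nra.
split=> //; apply/cvg_lim; first exact: Rhausdorff.
apply/cvgrPdist_le => e e0.
have [d1 d10 D1] := low _ e0.
have [d2 d20 D2] := is_derive_straddle dm e0.
near=> h.
have hn0 : h != 0 by near: h; exact: nbhs_dnbhs_neq.
have hn : 0 < `|h| by rewrite normr_gt0.
have hd1 : `|h| < d1 by near: h; exact: dnbhs0_lt.
have hd2 : `|h| < d2 by near: h; exact: dnbhs0_lt.
have hd3 : `|h| < t by near: h; exact: dnbhs0_lt.
have hd4 : `|h| < 1 - t by near: h; apply: dnbhs0_lt; rewrite subr_gt0.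
pose a := Num.min t (t + h); pose b := Num.max t (t + h).
have [abt ab gab] : [/\ [/\ a <= t, t <= b, t - a <= `|h| & b - t <= `|h|],
    b - a = `|h| & mdist (g (t + h)) (g t) = mdist (g a) (g b)].
  rewrite /a /b; have [h0|h0] := leP 0 h.
    rewrite minEle maxEle lerDl h0 ger0_norm//; split;
      [split; lra|lra|exact: metric_sym].
  rewrite minEle maxEle lerDl (lt_geF h0) ltr0_norm//; split; [split; lra|lra|by []].
have [at_ tb tah bth] := abt.
have L := D1 _ _ at_ tb (le_lt_trans tah hd1) (le_lt_trans bth hd1).
have := D2 _ _ at_ tb (le_lt_trans tah hd2) (le_lt_trans bth hd2).
have aleb : a <= b by exact: le_trans tb.
rewrite primitiveB// ab => U.
have := gm a b ltac:(lra) aleb ltac:(lra) => U'.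
rewrite gab ab in L *.
rewrite -(ler_pM2r hn) -[X in `|_ - _| * X](gtr0_norm hn) -normrM mulrBl divfK
  ?gt_eqF//.
move: U; rewrite !ler_norml => /andP[? ?]; apply/andP; split; lra.
Unshelve. all: by end_near. Qed.

End metric_speed.

(** * Lower limits, and integrals of functions not known to be measurable *)

Section liminf.
Context {R : realType}.
Implicit Types (u : nat -> \bar R) (x : \bar R).

Lemma lte_real_between (x y : \bar R) : (x < y)%E ->
  exists2 c : R, (x < c%:E)%E & (c%:E < y)%E.
Proof.
move: x y => [x| |] [y| |]//=.
- by rewrite lte_fin => xy; exists ((x + y) / 2); rewrite lte_fin; lra.
- by move=> _; exists (x + 1); rewrite ?ltry// lte_fin; lra.
- by move=> _; exists (y - 1); rewrite ?ltNyr// lte_fin; lra.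
- by move=> _; exists 0; rewrite ?ltNyr ?ltry.
Qed.

Lemma limn_einfE u : limn_einf u = ereal_sup (range (einfs u)).
Proof. by rewrite limn_einf_lim; apply/cvg_lim => //; exact: cvg_einfs_sup. Qed.

Lemma limn_einf_near u x : (x < limn_einf u)%E ->
  \forall n \near \oo, (x < u n)%E.
Proof.
rewrite limn_einfE => /ereal_sup_gt[_ [N _ <-]] xN; exists N => // n /= Nn.
by apply: lt_le_trans xN _; apply: ereal_inf_lbound; exists n.
Qed.

(** Lower limits are estimated from below through real numbers only, so that
    the infinite values need no separate treatment. *)
Lemma limn_einf_ge u x :
  (forall c : R, (c%:E < x)%E -> \forall n \near \oo, (c%:E <= u n)%E) ->
  (x <= limn_einf u)%E.
Proof.
move=> H; rewrite leNgt; apply/negP => /lte_real_between[c lc cx].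
have [N _ NP] := H c cx; move: lc; apply/negP; rewrite -leNgt limn_einfE.
apply: (@le_trans _ _ (einfs u N)); last by apply: ereal_sup_ubound; exists N.
by apply: le_ereal_inf_tmp => _ [n /= Nn <-]; exact: NP.
Qed.

Lemma limn_einf_lt_frequently u x : (limn_einf u < x)%E ->
  forall N, exists2 n, (N <= n)%N & (u n < x)%E.
Proof.
move=> ux N; apply: contrapT => H.
have : (x <= limn_einf u)%E.
  rewrite limn_einfE; apply: (@le_trans _ _ (einfs u N)); last first.
    by apply: ereal_sup_ubound; exists N.
  apply: le_ereal_inf_tmp => _ [n /= Nn <-]; rewrite leNgt; apply/negP => unx.
  by apply: H; exists n.
by rewrite leNgt ux.
Qed.

Lemma limn_esup_le u x :
  (forall c : R, (x < c%:E)%E -> \forall n \near \oo, (u n <= c%:E)%E) ->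
  (limn_esup u <= x)%E.
Proof.
move=> H; rewrite -leeN2 -limn_einfN; apply: limn_einf_ge => c cx.
have := H (- c); rewrite EFinN lteNr => /(_ cx); apply: filterS => n un.
by rewrite /= leeNr.
Qed.

(** Superadditivity of the lower limit in the form needed to pass to the limit
    in a sum bounded by a real number: both limits come out finite. *)
Lemma ge0_limn_einf_add_le (u v : nat -> \bar R) (x y : \bar R) (C : R) :
  (0 <= x)%E -> (0 <= y)%E ->
  (x <= limn_einf u)%E -> (y <= limn_einf v)%E ->
  (forall n, (0 <= u n)%E) -> (forall n, (0 <= v n)%E) ->
  (\forall n \near \oo, (u n + v n <= C%:E)%E) -> (x + y <= C%:E)%E.
Proof.
move=> x0 y0 xu yv u0 v0 uvC.
have low (w : nat -> \bar R) (z : \bar R) : (0 <= z)%E -> (z <= limn_einf w)%E ->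
    (forall n, (0 <= w n)%E) ->
    forall c : R, (c%:E < z)%E -> \forall n \near \oo, (c%:E <= w n)%E.
  move=> _ zw _ c cz; have := limn_einf_near (lt_le_trans cz zw).
  by apply: filterS => n /ltW.
have key c d : (c%:E < x)%E -> (d%:E < y)%E -> c + d <= C.
  move=> cx dy; have F1 := low _ _ x0 xu u0 _ cx.
  have F2 := low _ _ y0 yv v0 _ dy.
  have [N _ /(_ N (leqnn N))[uvN [cN dN]]] := filterI uvC (filterI F1 F2).
  by rewrite -lee_fin EFinD; apply: le_trans uvN; exact: leeD.
have xle d : (d%:E < y)%E -> (x <= (C - d)%:E)%E.
  move=> dy; rewrite leNgt; apply/negP => /lte_real_between[c c1 c2].
  by have := key _ _ c2 dy; move: c1; rewrite lte_fin; lra.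
have xfin : x \is a fin_num.
  rewrite ge0_fin_numE//; apply: le_lt_trans (xle (- 1) _) (ltry _).
  by apply: lt_le_trans y0; rewrite lte_fin; lra.
rewrite -(fineK xfin) in xle *.
have : (y <= (C - fine x)%:E)%E.
  rewrite leNgt; apply/negP => /lte_real_between[d d1 d2].
  by have := xle _ d2; move: d1; rewrite lte_fin lee_fin; lra.
move=> yle; apply: (@le_trans _ _ ((fine x)%:E + (C - fine x)%:E)%E).
  exact: leeD.
by rewrite -EFinD lee_fin; lra.
Qed.

End liminf.

Section integral_without_measurability.
Import HBNNSimple.
Context d (T : measurableType d) (R : realType) (mu : {measure set T -> \bar R}).
Local Open Scope ereal_scope.
Variables (D : set T) (mD : measurable D).

(** The integral of a nonnegative function is the supremum of the integrals of
    the simple functions below it, which makes sense and is monotone without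
    measurability. Neither the slope along a curve nor [metric_speed] is known
    to be measurable. *)
Lemma ge0_le_integralW (f h : T -> \bar R) :
  (forall x, D x -> 0 <= f x) -> (forall x, D x -> f x <= h x) ->
  \int[mu]_(x in D) f x <= \int[mu]_(x in D) h x.
Proof.
move=> f0 fh; have h0 x : D x -> 0 <= h x.
  by move=> Dx; apply: le_trans (f0 _ Dx) (fh _ Dx).
rewrite !ge0_integralE//; apply: ereal_sup_le => _ [k kf <-]; exists k => // x.
apply: le_trans (kf x) _; rewrite !patchE; case: ifPn => //; rewrite inE.
exact: fh.
Qed.

(** Only the larger function has to be measurable: every simple function below
    [f] is almost everywhere below [h]. *)
Lemma ge0_le_integral_off_null (f h : T -> \bar R) :
  (forall x, D x -> 0 <= f x) -> measurable_fun D h ->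
  (forall x, D x -> 0 <= h x) -> {ae mu, forall x, D x -> f x <= h x} ->
  \int[mu]_(x in D) f x <= \int[mu]_(x in D) h x.
Proof.
move=> f0 mh h0 [N [mN N0 NP]].
rewrite [leLHS]ge0_integralE//; apply: ge_ereal_sup => _ [k kf <-].
rewrite -integralT_nnsfun [leRHS]integral_mkcond.
apply: ae_ge0_le_integral => //.
- by move=> x _; rewrite lee_fin fun_ge0.
- by apply/measurable_EFinP; exact: measurable_funPT.
- by move=> x _; rewrite patchE; case: ifPn => //; rewrite inE => /h0.
- by apply/(measurable_restrictT _ _).1.
exists N; split=> // x /= /not_implyP[_] kh; apply: NP => /= Dx.
apply: kh; apply: le_trans (kf x) _; rewrite !patchE; case: ifPn => //.
by rewrite inE.
Qed.

(** The inequality from [h] to [f] cannot be obtained by symmetry; the null set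
    is removed from the integral of the measurable [h] instead. *)
Lemma ge0_integral_ae_eqW (f h : T -> \bar R) :
  (forall x, D x -> 0 <= f x) -> measurable_fun D h ->
  (forall x, D x -> 0 <= h x) -> {ae mu, forall x, D x -> f x = h x} ->
  \int[mu]_(x in D) f x = \int[mu]_(x in D) h x.
Proof.
move=> f0 mh h0 fh; apply/eqP; rewrite eq_le; apply/andP; split.
  apply: ge0_le_integral_off_null => //; move: fh.
  by apply: filterS => x + Dx => ->.
have [N [mN N0 NP]] := fh.
rewrite (ge0_negligible_integral mN)//.
rewrite setDE integral_mkcondr.
apply: ge0_le_integralW => x Dx; rewrite patchE; case: ifPn => //; last first.
- by move=> _; exact: f0.
- rewrite inE => nNx; suff -> : f x = h x by [].
  by apply: contrapT => fhx; apply: nNx; apply: NP => /(_ Dx).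
- by rewrite inE => _; exact: h0.
Qed.

End integral_without_measurability.

(** * Energies along uniform partitions *)

Section steps.
Context {R : realType}.
Notation mu := (@lebesgue_measure R).

Definition knot (N i : nat) : R := i%:R / N%:R.

Lemma knot0 N : knot N 0 = 0. Proof. by rewrite /knot mul0r. Qed.

Lemma knotN N : (0 < N)%N -> knot N N = 1.
Proof. by move=> N0; rewrite /knot divff// pnatr_eq0 -lt0n. Qed.

Lemma knot_le N i j : (i <= j)%N -> knot N i <= knot N j.
Proof. by move=> ij; rewrite ler_wpM2r ?invr_ge0// ler_nat. Qed.

Lemma knot_ge0 N i : 0 <= knot N i.
Proof. by rewrite divr_ge0. Qed.

Lemma knot_le1 N i : (i <= N)%N -> knot N i <= 1.
Proof.
case: N => [|N] iN; first by rewrite /knot invr0 mulr0.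
by rewrite -(@knotN N.+1)// knot_le.
Qed.

Lemma knotB N i : knot N i.+1 - knot N i = N%:R^-1.
Proof. by rewrite /knot -mulrBl -natr1 addrAC subrr add0r mul1r. Qed.

Lemma knot_index N (t : R) : (0 < N)%N -> 0 < t -> t <= 1 ->
  exists i : 'I_N, knot N i < t /\ t <= knot N i.+1.
Proof.
move=> N0 t0 t1; have ex : exists k, t <= knot N k by exists N; rewrite knotN.
case: (ex_minnP ex) => -[|k]; first by rewrite knot0 leNgt t0.
move=> tk kmin; have kN : (k < N)%N by apply: kmin; rewrite knotN.
exists (Ordinal kN); split=> //=; rewrite ltNge; apply/negP => /kmin.
by rewrite ltnn.
Qed.

Lemma integral_knots (F : R -> \bar R) N k : measurable_fun setT F ->
  (forall t, (0 <= F t)%E) ->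
  (\int[mu]_(t in `]0%R, knot N k]) F t =
    \sum_(i < k) \int[mu]_(t in `]knot N i, knot N i.+1]) F t)%E.
Proof.
move=> mF F0; elim: k => [|k IH].
  by rewrite knot0 set_itvoc0 integral_set0 big_ord0.
rewrite big_ord_recr/= -IH (@itv_bndbnd_setU _ _ _ (BRight (knot N k)))//=.
- rewrite ge0_integral_setU//.
    exact: measurable_funTS.
  apply/disj_setPRL => t/=; rewrite !in_itv/= => /andP[kt _].
  by apply/negP; rewrite negb_and -ltNge kt orbT.
- by rewrite bnd_simp knot_ge0.
- by rewrite bnd_simp knot_le.
Qed.

Definition step N (c : nat -> R) (t : R) : R :=
  \sum_(i < N) c i * \1_(`]knot N i, knot N i.+1]) t.

Lemma measurable_step N c : measurable_fun setT (step N c).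
Proof.
apply: measurable_sum => i; apply: measurable_funM => //.
Qed.

Lemma step_ge0 N c t : (forall i, 0 <= c i) -> 0 <= step N c t.
Proof. by move=> c0; apply: sumr_ge0 => i _; rewrite mulr_ge0. Qed.

Lemma stepE N c (i : 'I_N) t : knot N i < t -> t <= knot N i.+1 ->
  step N c t = c i.
Proof.
move=> it ti; rewrite /step (bigD1 i)//= big1 ?addr0.
  by rewrite indicE mem_set ?mulr1//= in_itv/= it.
move=> j ji; rewrite indicE memNset ?mulr0//= in_itv/= => /andP[jt tj].
move: ji; rewrite -val_eqE neq_ltn => /orP[ji|ij].
  by have := lt_le_trans it (le_trans tj (knot_le N ji)); rewrite ltxx.
by have := lt_le_trans jt (le_trans ti (knot_le N ij)); rewrite ltxx.
Qed.

Lemma integral_step N c : (0 < N)%N -> (forall i, 0 <= c i) ->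
  (\int[mu]_(t in `]0%R, 1%R]) (step N c t)%:E =
     (\sum_(i < N) N%:R^-1 * c i)%:E)%E.
Proof.
move=> N0 c0.
have mS : measurable_fun setT (fun t => (step N c t)%:E).
  by apply/measurable_EFinP; exact: measurable_step.
have S0 t : (0 <= (step N c t)%:E)%E by rewrite lee_fin step_ge0.
have := integral_knots N N mS S0; rewrite knotN// => ->.
rewrite -sumEFin; apply: eq_bigr => i _.
rewrite (eq_integral (cst (c i)%:E)); last first.
  by move=> t; rewrite inE/= in_itv/= => /andP[it ti]; rewrite (stepE _ it ti).
by rewrite integral_cst//= lebesgue_itvoc ?knot_le// knotB -EFinM mulrC.
Qed.

End steps.

Lemma measurable_fun_limn_einf d (T : measurableType d) (R : realType)
    (D : set T) (f : (T -> \bar R)^nat) :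
  (forall n, measurable_fun D (f n)) ->
  measurable_fun D (fun x => limn_einf (f ^~ x)).
Proof.
move=> mf; rewrite (_ : (fun x => _) =
    (fun x => - limn_esup (fun n => - f n x))%E); last first.
  by apply/funext => x; rewrite -[RHS]limn_einfN; congr limn_einf;
    apply/funext => n /=; rewrite oppeK.
apply: measurableT_comp => //; apply: measurable_fun_limn_esup => n.
exact: measurableT_comp.
Qed.

Section energy.
Context {R : realType} {X : metricType R}.
Notation mu := (@lebesgue_measure R).
Implicit Types (g : R -> X).

(** Twice the action of a curve that would run through the points [g (i / N)]
    along geodesics at constant speed on each cell. *)
Definition energy g (N : nat) : R :=
  \sum_(i < N) N%:R * mdist (g (knot N i)) (g (knot N i.+1)) ^+ 2.

(** The Cauchy-Schwarz inequality, obtained by integrating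
    [m^2 >= 2 a m - a^2] with [a] the distance divided by [t - s]. *)
Lemma sq_mdist_le g (m : R -> R) (s t : R) : (forall r, 0 <= m r) ->
  mu.-integrable setT (EFin \o m) ->
  mdist (g s) (g t) <= \int[mu]_(r in `]s, t]) m r -> s < t ->
  ((mdist (g s) (g t) ^+ 2 / (t - s))%:E <=
     \int[mu]_(r in `]s, t]) (m r ^+ 2)%:E)%E.
Proof.
move=> m0 mi gm st; set dd := mdist _ _ in gm *; set a := dd / (t - s).
have ts0 : 0 < t - s by rewrite subr_gt0.
have a0 : 0 <= a by rewrite divr_ge0 ?mdist_ge0// ltW.
have mm : measurable_fun setT m by apply/measurable_EFinP; case/integrableP: mi.
have mist : mu.-integrable `]s, t] (EFin \o m) by exact: integrableS mi.
have mm2 : measurable_fun `]s, t] (fun r => (m r ^+ 2)%:E).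
  by apply/measurable_EFinP; apply: measurable_funTS; exact: measurable_funX.
have : (\int[mu]_(r in `]s, t]) ((2 * a)%:E * (m r)%:E) <=
    \int[mu]_(r in `]s, t]) ((m r ^+ 2)%:E + (a ^+ 2)%:E))%E.
  apply: ge0_le_integralW => // r _; first by rewrite -EFinM lee_fin;
    apply: mulr_ge0 => //; exact: mulr_ge0.
  by rewrite -EFinM -EFinD lee_fin; have := sqr_ge0 (m r - a); nra.
rewrite integralZl// -(fineK (integral_itv_fin_num mist)) -EFinM.
rewrite ge0_integralD//; first last.
- by move=> r _; rewrite lee_fin sqr_ge0.
- by move=> r _; rewrite lee_fin sqr_ge0.
have muE := lebesgue_itvoc (ltW st).
rewrite integral_cst//= [X in (_ + _ * X)%E]muE -EFinM -leeBlDr// -EFinB.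
apply: le_trans; rewrite lee_fin -/(\int[mu]_(r in `]s, t]) m r).
have -> : dd ^+ 2 / (t - s) = 2 * a * dd - a ^+ 2 * (t - s).
  by rewrite /a; field; rewrite gt_eqF.
by rewrite lerD2r ler_wpM2l// mulr_ge0.
Qed.

(** Replaces [metric_speed] in the action by a measurable representative. *)
Lemma action_AC g : AC_on 0 1 g -> exists m : R -> R,
  [/\ forall t, 0 <= m t, mu.-integrable setT (EFin \o m),
      forall s t, 0 <= s -> s <= t -> t <= 1 ->
        mdist (g s) (g t) <= \int[mu]_(r in `]s, t]) m r,
      {ae mu, forall t : R, 0 < t < 1 -> straddle_lower g t (m t)} &
      (action g = (2^-1)%:E * \int[mu]_(t in `]0%R, 1%R]) (m t ^+ 2)%:E)%E].
Proof.
move=> gAC; have [m [m0 mi gm gs]] := metric_speed_AC gAC.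
exists m; split => //.
  move: gs; apply: filterS; first exact: (ae_filter_ringOfSetsType mu).
  by move=> t H /H[].
have mm : measurable_fun setT m by apply/measurable_EFinP; case/integrableP: mi.
have mm2 : measurable_fun setT (fun r => (m r ^+ 2)%:E).
  by apply/measurable_EFinP; exact: measurable_funX.
rewrite /action asboolT//; congr (_ * _)%E.
rewrite -integral_itv_bndo_bndc; last exact: measurable_funTS.
apply: ge0_integral_ae_eqW => //.
- by move=> t _; rewrite lee_fin sqr_ge0.
- exact: measurable_funTS.
- by move=> t _; rewrite lee_fin sqr_ge0.
move: gs; apply: filterS; first exact: (ae_filter_ringOfSetsType mu).
by move=> t H; rewrite /= in_itv/= => /H[_ ->].
Qed.

Lemma action_ge0 g : (0 <= action g)%E.
Proof.
rewrite /action; case: asboolP => // _; apply: mule_ge0; first by rewrite lee_fin.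
by apply: integral_ge0 => t _; rewrite lee_fin sqr_ge0.
Qed.

Lemma half_double (x : \bar R) : (2%:E * ((2^-1)%:E * x) = x)%E.
Proof. by rewrite muleA -EFinM divff// mul1e. Qed.

Lemma energy_le_action g N : (0 < N)%N ->
  ((energy g N)%:E <= 2%:E * action g)%E.
Proof.
move=> N0; have [gAC|gAC] := pselect (AC_on 0 1 g); last first.
  by rewrite /action asboolF// gt0_muley ?leey// lte_fin.
have [m [m0 mi gm _ ->]] := action_AC gAC; rewrite half_double.
have mm : measurable_fun setT m by apply/measurable_EFinP; case/integrableP: mi.
have mm2 : measurable_fun setT (fun r => (m r ^+ 2)%:E).
  by apply/measurable_EFinP; exact: measurable_funX.
have m20 t : (0 <= (m t ^+ 2)%:E)%E by rewrite lee_fin sqr_ge0.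
have := integral_knots N N mm2 m20; rewrite knotN// => ->.
rewrite /energy -sumEFin; apply: lee_sum => i _.
have kk : knot N i < knot N i.+1 :> R.
  by rewrite -subr_gt0 knotB invr_gt0 ltr0n.
have gd : mdist (g (knot N i)) (g (knot N i.+1)) <=
    \int[mu]_(r in `]knot N i, knot N i.+1]) m r.
  by apply: gm; [exact: knot_ge0|exact: ltW|apply: knot_le1; exact: ltn_ord].
have := sq_mdist_le m0 mi gd kk.
by rewrite knotB invrK mulrC.
Qed.

(** Curves of finite action are Hoelder continuous with exponent 1/2. *)
Lemma sq_mdist_le_action g s t : 0 <= s -> s <= t -> t <= 1 ->
  ((mdist (g s) (g t) ^+ 2)%:E <= (t - s)%:E * (2%:E * action g))%E.
Proof.
move=> s0; rewrite le_eqVlt => /predU1P[->|st] t1.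
  by rewrite subrr mul0e mdistxx expr0n.
have [gAC|gAC] := pselect (AC_on 0 1 g); last first.
  rewrite /action asboolF// gt0_muley ?lte_fin//.
  by rewrite gt0_muley ?leey// lte_fin subr_gt0.
have [m [m0 mi gm _ ->]] := action_AC gAC; rewrite half_double.
have mm : measurable_fun setT m by apply/measurable_EFinP; case/integrableP: mi.
have mm2 : measurable_fun setT (fun r => (m r ^+ 2)%:E).
  by apply/measurable_EFinP; exact: measurable_funX.
have := sq_mdist_le m0 mi (gm _ _ s0 (ltW st) t1) st.
rewrite -(@lee_pmul2l _ (t - s)%:E) ?lte_fin ?subr_gt0// -EFinM mulrC divfK;
  last first.
  by rewrite gt_eqF// subr_gt0.
move=> /le_trans; apply; apply: lee_wpmul2l; first by rewrite lee_fin subr_ge0 ltW.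
apply: ge0_subset_integral => //; first exact: measurable_funTS.
  by move=> r _; rewrite lee_fin sqr_ge0.
by apply: subset_itv; rewrite bnd_simp.
Qed.

End energy.

(** * The action as limit of the dyadic energies *)

Section energy_limit.
Context {R : realType} {X : metricType R}.
Notation mu := (@lebesgue_measure R).
Implicit Types (g : R -> X).

Lemma dyadic_small (d : R) : 0 < d ->
  \forall n \near \oo, ((2 ^ n)%N%:R^-1 : R) < d.
Proof.
move=> d0; have [k kd] := ltr_add_invr d0.
exists k => // n /= kn; apply: le_lt_trans kd;
  rewrite add0r lef_pV2 ?posrE ?ltr0n ?expn_gt0//.
by rewrite ler_nat; apply: leq_ltn_trans kn (ltn_expl n _).
Qed.

(** The energy is the integral of the square of a step function of difference
    quotients, whose lower limit is almost everywhere at least the squared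
    speed by [straddle_lower]; Fatou's lemma concludes. *)
Lemma action_le_energy g : AC_on 0 1 g ->
  (2%:E * action g <= limn_einf (fun n => (energy g (2 ^ n))%:E))%E.
Proof.
move=> gAC; have [m [m0 mi gm gs ->]] := action_AC gAC; rewrite half_double.
pose c n i := ((2 ^ n)%N%:R * mdist (g (knot (2 ^ n) i))
  (g (knot (2 ^ n) i.+1))) ^+ 2.
have c0 n i : 0 <= c n i by exact: sqr_ge0.
have mst n : measurable_fun (`]0%R, 1%R] : set R)
  (fun t => (step (2 ^ n) (c n) t)%:E).
  by apply/measurable_EFinP; apply: measurable_funTS; exact: measurable_step.
have st0 n t : (0 <= (step (2 ^ n) (c n) t)%:E)%E by rewrite lee_fin step_ge0.
have -> : (fun n => (energy g (2 ^ n))%:E) =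
    (fun n => \int[mu]_(t in `]0%R, 1%R]) (step (2 ^ n) (c n) t)%:E)%E.
  apply/funext => n; rewrite integral_step ?expn_gt0//; congr (_%:E).
  apply: eq_bigr => i _; rewrite /c; field.
  by rewrite pnatr_eq0 -lt0n expn_gt0.
have := fatou mu (measurable_itv `]0, 1]) mst (fun n t _ => st0 n t).
apply: le_trans.
rewrite -(@integral_itv_bndo_bndc R (BRight 0) 1 (fun t => (m t ^+ 2)%:E));
  last first.
  apply: measurable_funTS; apply/measurable_EFinP; apply: measurable_funX.
  by apply/measurable_EFinP; case/integrableP: mi.
have mli : measurable_fun (`]0%R, 1%R] : set R)
    (fun t => limn_einf (fun n => (step (2 ^ n) (c n) t)%:E)).
  exact: measurable_fun_limn_einf.
rewrite -(@integral_itv_bndo_bndc R (BRight 0) 1); last first.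
  by apply: measurable_funS mli => //; apply: subset_itv; rewrite bnd_simp.
have li0 t : (0 <= limn_einf (fun n => (step (2 ^ n) (c n) t)%:E))%E.
  apply: limn_einf_ge => x; rewrite lte_fin => x0; exists 0%N => // n _ /=.
  by apply: le_trans (st0 n t); rewrite lee_fin ltW.
apply: ge0_le_integral_off_null => //.
- by move=> t _; rewrite lee_fin sqr_ge0.
- by apply: measurable_funS mli => //; apply: subset_itv; rewrite bnd_simp.
move: gs; apply: filterS; first exact: (ae_filter_ringOfSetsType mu).
move=> t H; rewrite /= in_itv/= => t01; have {}H := H t01.
have /andP[t0 t1] := t01; apply: limn_einf_ge => x; rewrite lte_fin => xm.
have [x0|x0] := ltP x 0.
  by exists 0%N => // n _ /=; apply: le_trans (st0 n t); rewrite lee_fin ltW.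
pose r := Num.sqrt x; have r0 : 0 <= r := sqrtr_ge0 _.
have rx : r ^+ 2 = x by rewrite sqr_sqrtr.
have rm : 0 < m t - r by have := m0 t; nra.
have [d d0 D] := H _ rm; have := dyadic_small d0; apply: filterS => n nd.
have N0 : (0 < 2 ^ n)%N by rewrite expn_gt0.
have [i [it ti]] := knot_index N0 t0 (ltW t1).
rewrite (stepE _ it ti) lee_fin /c -rx ler_pXn2r ?nnegrE ?mulr_ge0 ?mdist_ge0//.
have kB := knotB (R := R) (2 ^ n) i.
have := D _ _ (ltW it) ti; rewrite kB (_ : m t - (m t - r) = r); last by ring.
move=> /(_ ltac:(lra) ltac:(lra)).
by rewrite ler_pdivrMr ?ltr0n// mulrC.
Qed.

End energy_limit.

Section quotient_steps.
Context {R : realType} {X : metricType R}.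
Notation mu := (@lebesgue_measure R).
Implicit Types (g : R -> X).

Lemma C01_near g (s : R) : C01 g -> 0 <= s -> s <= 1 -> forall e, 0 < e ->
  exists2 d, 0 < d & forall x, 0 <= x -> x <= 1 -> `|x - s| < d ->
    mdist (g s) (g x) < e.
Proof.
move=> /subspace_continuousP gc s0 s1 e e0.
have s01 : `[0, 1]%classic s by rewrite /= in_itv/= s0.
have /(_ _ (nbhsx_ballx (g s) e e0)) := gc _ s01.
rewrite /within => -[d /= d0 dP]; exists d => // x x0 x1 xs.
have := dP x; rewrite /= distrC => /(_ xs); rewrite in_itv/= x0 x1 => /(_ isT).
by rewrite ballEmdist.
Qed.

Lemma knot_mul N k i : (0 < k)%N -> knot (N * k) (i * k) = knot N i :> R.
Proof.
move=> k0; rewrite /knot !natrM; have k1 : k%:R != 0 :> R by rewrite pnatr_eq0 -lt0n.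
by rewrite invfM mulrACA divff// mulr1.
Qed.

(** The speed [g] would have if it were a geodesic on every cell. *)
Definition quotient_step g N := step N
  (fun i => N%:R * mdist (g (knot N i)) (g (knot N i.+1))).

Lemma quotient_step_ge0 g N t : 0 <= quotient_step g N t.
Proof. by apply: step_ge0 => i; rewrite mulr_ge0 ?mdist_ge0. Qed.

Lemma measurable_quotient_step g N : measurable_fun setT (EFin \o quotient_step g N).
Proof. by apply/measurable_EFinP; exact: measurable_step. Qed.

Lemma integral_quotient_step_cell g N i : (i < N)%N ->
  (\int[mu]_(t in `]knot N i, knot N i.+1]) (quotient_step g N t)%:E =
   (mdist (g (knot N i)) (g (knot N i.+1)))%:E)%E.
Proof.
move=> iN; have N0 : (0 < N)%N by exact: leq_ltn_trans iN.
rewrite (eq_integral (cst (N%:R * mdist (g (knot N i)) (g (knot N i.+1)))%:E));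
  last first.
  move=> t; rewrite inE/= in_itv/= => /andP[it ti].
  by rewrite /quotient_step (stepE (i := Ordinal iN) _ it ti).
have muE := lebesgue_itvoc (knot_le (R := R) N (leqnSn i)).
rewrite integral_cst//= [X in (_ * X)%E]muE knotB -EFinM; congr (_%:E).
by field; rewrite pnatr_eq0 -lt0n.
Qed.

Lemma mdist_le_quotient_step g N i k : (i + k <= N)%N ->
  ((mdist (g (knot N i)) (g (knot N (i + k))))%:E <=
   \int[mu]_(t in `]knot N i, knot N (i + k)]) (quotient_step g N t)%:E)%E.
Proof.
elim: k => [|k IH] ikN.
  by rewrite addn0 mdistxx; apply: integral_ge0 => t _;
    rewrite lee_fin quotient_step_ge0.
rewrite (@itv_bndbnd_setU _ _ _ (BRight (knot N (i + k))))//=; last 2 first.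
- by rewrite bnd_simp knot_le ?leq_addr.
- by rewrite bnd_simp knot_le// addnS.
rewrite ge0_integral_setU//; first last.
- apply/disj_setPRL => t/=; rewrite !in_itv/= => /andP[kt _].
  by apply/negP; rewrite negb_and -ltNge kt orbT.
- by move=> t _; rewrite lee_fin quotient_step_ge0.
- apply: measurable_funTS; exact: measurable_quotient_step.
rewrite addnS integral_quotient_step_cell -?addnS//.
apply: (@le_trans _ _ ((mdist (g (knot N i)) (g (knot N (i + k))))%:E +
   (mdist (g (knot N (i + k))) (g (knot N (i + k.+1))))%:E)%E).
  by rewrite -EFinD lee_fin metric_triangle.
by rewrite addnS leeD2r// IH// ltnW// -addnS.
Qed.

Lemma integral_quotient_step_sqr g N : (0 < N)%N ->
  (\int[mu]_(t in `]0%R, 1%R]) (quotient_step g N t ^+ 2)%:E = (energy g N)%:E)%E.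
Proof.
move=> N0; transitivity (\int[mu]_(t in `]0%R, 1%R]) (step N
  (fun i => (N%:R * mdist (g (knot N i)) (g (knot N i.+1))) ^+ 2) t)%:E)%E.
  apply: eq_integral => t; rewrite inE/= in_itv/= => /andP[t0 t1].
  have [i [it ti]] := knot_index N0 t0 t1.
  by rewrite /quotient_step !(stepE _ it ti).
rewrite integral_step//; last by move=> i; exact: sqr_ge0.
congr (_%:E); apply: eq_bigr => i _; field.
by rewrite pnatr_eq0 -lt0n.
Qed.

(** On a coarse cell the coarse step function is constant, and the mean of the
    fine one is at least this constant by the triangle inequality: along
    refinements the step functions form a nonnegative submartingale. *)
Lemma integral_quotient_stepM g N k : (0 < N)%N -> (0 < k)%N ->
  ((energy g N)%:E <= \int[mu]_(t in `]0%R, 1%R])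
     (quotient_step g N t * quotient_step g (N * k) t)%:E)%E.
Proof.
move=> N0 k0.
have mF : measurable_fun setT (fun t =>
  (quotient_step g N t * quotient_step g (N * k) t)%:E).
  by apply/measurable_EFinP; apply: measurable_funM; exact: measurable_step.
have F0 t : (0 <= (quotient_step g N t * quotient_step g (N * k) t)%:E)%E.
  by rewrite lee_fin mulr_ge0// quotient_step_ge0.
have := integral_knots N N mF F0; rewrite knotN// => ->.
rewrite /energy -sumEFin; apply: lee_sum => i _.
set d := mdist _ _.
have d0 : 0 <= N%:R * d by rewrite mulr_ge0 ?mdist_ge0.
rewrite [leRHS](_ : _ = \int[mu]_(t in `]knot N i, knot N i.+1])
    ((N%:R * d)%:E * (quotient_step g (N * k) t)%:E))%E; last first.
  apply: eq_integral => t; rewrite inE/= in_itv/= => /andP[it ti].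
  by rewrite {1}/quotient_step (stepE _ it ti) EFinM.
rewrite ge0_integralZl ?lee_fin//; first last.
- by move=> t _; rewrite lee_fin quotient_step_ge0.
- apply: measurable_funTS; exact: measurable_quotient_step.
rewrite expr2 mulrA [leLHS]EFinM; apply: lee_wpmul2l; first by rewrite lee_fin.
have := @mdist_le_quotient_step g (N * k) (i * k) k.
rewrite -mulSnr !knot_mul//; apply.
by rewrite leq_mul2r ltn_ord orbT.
Qed.

(** Expanding the square, the mixed term is at least the coarse energy. As the
    energies increase under refinement, a bound on them makes the step
    functions a Cauchy sequence in L2. *)
Lemma quotient_step_cauchy g N k : (0 < N)%N -> (0 < k)%N ->
  (\int[mu]_(t in `]0%R, 1%R])
     ((quotient_step g (N * k) t - quotient_step g N t) ^+ 2)%:E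
   <= (energy g (N * k) - energy g N)%:E)%E.
Proof.
move=> N0 k0; set f := quotient_step g N; set h := quotient_step g (N * k).
have Nk0 : (0 < N * k)%N by rewrite muln_gt0 N0.
have mf : measurable_fun setT f by exact: measurable_step.
have mh : measurable_fun setT h by exact: measurable_step.
have mfh : measurable_fun (`]0, 1] : set R) (fun t => (f t * h t)%:E).
  by apply/measurable_EFinP; apply: measurable_funTS; exact: measurable_funM.
have fh0 t : (0 <= (f t * h t)%:E)%E by rewrite lee_fin mulr_ge0// quotient_step_ge0.
have : (\int[mu]_(t in `]0%R, 1%R]) ((h t - f t) ^+ 2)%:E +
    2%:E * \int[mu]_(t in `]0%R, 1%R]) (f t * h t)%:E =
    (energy g (N * k))%:E + (energy g N)%:E)%E.
  rewrite -!integral_quotient_step_sqr// -ge0_integralZl//.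
  rewrite -!ge0_integralD//.
  - by apply: eq_integral => t _; rewrite -EFinM -!EFinD; congr (_%:E);
      rewrite -/f -/h; ring.
  - by move=> t _; rewrite lee_fin sqr_ge0.
  - by apply/measurable_EFinP; apply: measurable_funTS; exact: measurable_funX.
  - by move=> t _; rewrite lee_fin sqr_ge0.
  - by apply/measurable_EFinP; apply: measurable_funTS; exact: measurable_funX.
  - by move=> t _; rewrite lee_fin sqr_ge0.
  - apply/measurable_EFinP; apply: measurable_funTS; apply: measurable_funX.
    exact: measurable_funB.
  - by move=> t _; rewrite mule_ge0.
  - exact: measurable_funeM.
have := integral_quotient_stepM g N0 k0; rewrite -/f -/h.
set A := (\int[mu]_(t in _) ((h t - f t) ^+ 2)%:E)%E.
set B := (\int[mu]_(t in _) (f t * h t)%:E)%E => EB.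
have A0 : (0 <= A)%E by apply: integral_ge0 => t _; rewrite lee_fin sqr_ge0.
move=> E.
have Afin : A \is a fin_num.
  rewrite ge0_fin_numE//; apply: (@le_lt_trans _ _ (A + 2%:E * B)%E);
    last by rewrite E -EFinD ltry.
  rewrite leeDl// mule_ge0//; apply: le_trans EB; rewrite lee_fin.
  by apply: sumr_ge0 => i _; rewrite mulr_ge0// sqr_ge0.
have Bfin : B \is a fin_num.
  rewrite ge0_fin_numE; last exact: integral_ge0.
  apply: (@le_lt_trans _ _ (A + 2%:E * B)%E); last by rewrite E -EFinD ltry.
  apply: (@le_trans _ _ (2%:E * B)%E); last by rewrite leeDr.
  by rewrite lee_pemull ?integral_ge0// lee_fin; lra.
move: E EB; rewrite -(fineK Afin) -(fineK Bfin) -EFinM -!EFinD => -[E].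
by rewrite !lee_fin; lra.
Qed.

End quotient_steps.

Section ac_of_energy.
Context {R : realType} {X : metricType R}.
Notation mu := (@lebesgue_measure R).
Implicit Types (g : R -> X).

Lemma energy_ge0 g N : 0 <= energy g N.
Proof. by apply: sumr_ge0 => i _; rewrite mulr_ge0// sqr_ge0. Qed.

Lemma energy_le_mul g N k : (0 < N)%N -> (0 < k)%N -> energy g N <= energy g (N * k).
Proof.
move=> N0 k0; rewrite -subr_ge0 -lee_fin.
apply: le_trans (quotient_step_cauchy g N0 k0).
by apply: integral_ge0 => t _; rewrite lee_fin sqr_ge0.
Qed.

(** The dyadic energies are nondecreasing and bounded, hence converge; the
    subsequence makes the L2 distances of [quotient_step_cauchy] summable. *)
Lemma energy_dyadic_subseq g K : (forall n, energy g (2 ^ n) <= K) ->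
  exists m : nat -> nat, [/\ forall k, (k <= m k)%N, forall k, (m k <= m k.+1)%N &
    forall k, energy g (2 ^ m k.+1) - energy g (2 ^ m k) <= (2 ^- k) ^+ 2].
Proof.
move=> gK; pose A := range (fun n => energy g (2 ^ n)).
have Asup : has_sup A.
  by split; [exists (energy g (2 ^ 0)); exists 0%N|exists K => _ [n _ <-]].
have nex k : exists n, sup A - (2 ^- k) ^+ 2 < energy g (2 ^ n).
  have e0 : 0 < (2 ^- k) ^+ 2 :> R by rewrite exprn_gt0// invr_gt0 exprn_gt0.
  by have [_ [n _ <-] nP] := sup_adherent e0 Asup; exists n.
have {nex}[n nP] := choice nex.
have mono i j : (i <= j)%N -> energy g (2 ^ i) <= energy g (2 ^ j).
  move=> ij; rewrite -(subnKC ij) expnD; apply: energy_le_mul; by rewrite expn_gt0.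
exists (fun k => \sum_(0 <= i < k.+1) (n i).+1)%N; split => k.
- elim: k => [|k IH]; first by rewrite big_nat1.
  rewrite big_nat_recr//=; set S := (\sum_(_ <= _ < _) _)%N in IH *; lia.
- by rewrite [leqRHS]big_nat_recr//= leq_addr.
set S := (fun k => \sum_(0 <= i < k.+1) (n i).+1)%N.
have : energy g (2 ^ S k.+1) <= sup A.
  by apply: ub_le_sup; [exact: Asup.2|exists (S k.+1)].
have : energy g (2 ^ n k) <= energy g (2 ^ S k).
  by apply: mono; rewrite /S big_nat_recr//=; lia.
by have := nP k; rewrite -/(S k) -/(S k.+1); lra.
Qed.

(** Along the fast subsequence [m] the step functions [f k] are all below
    [F = f 0 + sum |f (k+1) - f k|], which is integrable since the summands
    have L1 norm at most 2^-k. As [f k] bounds the distances between its knots,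
    so does [F], and continuity of [g] extends this bound to all times. *)
Lemma AC_of_energy g K : C01 g -> (forall n, energy g (2 ^ n) <= K) ->
  AC_on 0 1 g.
Proof.
move=> gC gK; have [m [mk mS mE]] := energy_dyadic_subseq gK.
pose f k := quotient_step g (2 ^ m k).
have f0 k t : 0 <= f k t by exact: quotient_step_ge0.
have mf k : measurable_fun setT (f k) by exact: measurable_step.
pose h k t := `|f k.+1 t - f k t|.
have h0 k t : 0 <= h k t by exact: normr_ge0.
have mh k : measurable_fun setT (h k).
  by apply: measurableT_comp => //; exact: measurable_funB.
pose F t : \bar R := ((f 0%N t)%:E + \sum_(k <oo) (h k t)%:E)%E.
have mF : measurable_fun setT F.
  apply: emeasurable_funD; first exact/measurable_EFinP.
  apply: ge0_emeasurable_sum; first by move=> *; rewrite lee_fin; exact: h0.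
  by move=> k _; apply/measurable_EFinP.
have S0 t : (0 <= \sum_(k <oo) (h k t)%:E)%E.
  by apply: nneseries_ge0 => k _ _; rewrite lee_fin.
have F0 t : (0 <= F t)%E by rewrite adde_ge0// lee_fin.
have fF k t : ((f k t)%:E <= F t)%E.
  have : f k t <= f 0%N t + \sum_(0 <= j < k) h j t.
    elim: k => [|k IH]; first by rewrite big_geq// addr0.
    rewrite big_nat_recr//= addrA.
    by have := ler_norm (f k.+1 t - f k t); rewrite -/(h k t); lra.
  rewrite -lee_fin => /le_trans; apply; rewrite EFinD leeD2l// -sumEFin.
  by apply: nneseries_lim_ge => j _ _; rewrite lee_fin.
have ih k : (\int[mu]_(t in `]0%R, 1%R]) (h k t)%:E <= (2 ^- k)%:E)%E.
  set e : R := 2 ^- k.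
  have e0 : 0 < e by rewrite invr_gt0 exprn_gt0.
  pose q t : R := (f k.+1 t - f k t) ^+ 2.
  have mq : measurable_fun setT q by apply: measurable_funX; exact: measurable_funB.
  have iq : (\int[mu]_(t in `]0%R, 1%R]) (q t)%:E <= (e ^+ 2)%:E)%E.
    have dv : (2 ^ m k.+1 = 2 ^ m k * 2 ^ (m k.+1 - m k))%N by rewrite -expnD subnKC.
    apply: (@le_trans _ _ (energy g (2 ^ m k.+1) - energy g (2 ^ m k))%:E);
      last first.
      by rewrite lee_fin.
    by rewrite /q /f dv; apply: quotient_step_cauchy; rewrite expn_gt0.
  (* Young's inequality |h| <= e/2 + h^2/(2e) passes from L2 to L1. *)
  apply: (@le_trans _ _ (\int[mu]_(t in `]0%R, 1%R])
    ((e / 2)%:E + (e^-1 / 2)%:E * (q t)%:E))%E).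
    apply: ge0_le_integralW => // t _; first by rewrite lee_fin; exact: h0.
    rewrite -EFinM -EFinD lee_fin.
    have -> : q t = h k t ^+ 2 by rewrite /q /h real_normK// num_real.
    have := sqr_ge0 (h k t - e); rewrite -(ler_pM2l (x := e)) => //.
    have -> : e * (e / 2 + e^-1 / 2 * h k t ^+ 2) = e ^+ 2 / 2 + h k t ^+ 2 / 2.
      by field; rewrite gt_eqF.
    by nra.
  have H1 t : `]0, 1]%classic t -> (0 <= (e / 2)%:E)%E.
    by move=> _; rewrite lee_fin divr_ge0// ltW.
  have e20 : (0 <= (e^-1 / 2)%:E)%E by rewrite lee_fin divr_ge0// invr_ge0 ltW.
  have q0 t : `]0, 1]%classic t -> (0 <= (q t)%:E)%E.
    by move=> _; rewrite lee_fin sqr_ge0.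
  have H2 t : `]0, 1]%classic t -> (0 <= (e^-1 / 2)%:E * (q t)%:E)%E.
    by move=> /q0 ?; rewrite mule_ge0.
  have M1 : measurable_fun (`]0, 1] : set R) (fun t => (q t)%:E).
    by apply/measurable_EFinP; exact: measurable_funTS.
  have M2 : measurable_fun (`]0, 1] : set R) (fun t => (e^-1 / 2)%:E * (q t)%:E)%E.
    exact: measurable_funeM.
  rewrite ge0_integralD//; last exact: H1.
  have muE := lebesgue_itvoc (@ler01 R).
  rewrite integral_cst//= [X in (_ * X)%E]muE subr0 mule1 ge0_integralZl//.
  apply: (@le_trans _ _ ((e / 2)%:E + (e^-1 / 2)%:E * (e ^+ 2)%:E)%E).
    by rewrite leeD2l// lee_wpmul2l// lee_fin divr_ge0// invr_ge0 ltW.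
  rewrite -EFinM -EFinD lee_fin le_eqVlt; apply/orP; left; apply/eqP.
  by field; rewrite gt_eqF.
have IF : (\int[mu]_(t in `]0%R, 1%R]) F t < +oo)%E.
  have M1 : measurable_fun (`]0, 1] : set R) (fun t => (f 0%N t)%:E).
    by apply: measurable_funTS; apply/measurable_EFinP.
  have M2 : measurable_fun (`]0, 1] : set R) (fun t => \sum_(k <oo) (h k t)%:E)%E.
    apply: measurable_funTS; apply: ge0_emeasurable_sum.
      by move=> *; rewrite lee_fin; exact: h0.
    by move=> *; apply/measurable_EFinP.
  have H1 t : `]0, 1]%classic t -> (0 <= (f 0%N t)%:E)%E by rewrite lee_fin.
  rewrite ge0_integralD//.
  rewrite integral_step ?expn_gt0//; last by move=> i; rewrite mulr_ge0 ?mdist_ge0.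
  rewrite lte_add_pinfty ?ltry//.
  have H3 k t : `]0, 1]%classic t -> (0 <= (h k t)%:E)%E.
    by move=> _; rewrite lee_fin; exact: h0.
  have M3 k : measurable_fun (`]0, 1] : set R) (fun t => (h k t)%:E).
    by apply/measurable_EFinP; exact: measurable_funTS.
  rewrite integral_nneseries//.
  apply: (@le_lt_trans _ _ 2%:E); last exact: ltry.
  apply: lime_le.
    by apply: is_cvg_nneseries => k _ _; apply: integral_ge0 => t _;
      rewrite lee_fin; exact: h0.
  apply: nearW => n.
  apply: (@le_trans _ _ (2 - 2 * 2 ^- n)%:E);
    last by rewrite lee_fin lerBlDr lerDl mulr_ge0.
  elim: n => [|n IH]; first by rewrite big_geq// lee_fin; lra.
  rewrite big_nat_recr//=; apply: le_trans (leeD IH (ih n)) _.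
  rewrite -EFinD lee_fin; set w : R := 2 ^- n.
  by have -> : 2 ^- n.+1 = w / 2 :> R; [rewrite exprS invfM mulrC|lra].
have iF : mu.-integrable `]0, 1] F.
  apply/integrableP; split; first exact: measurable_funTS.
  apply: le_lt_trans IF; apply: ge0_le_integralW => // t _.
  by rewrite gee0_abs.
pose G := fine \o F.
have G0 t : 0 <= G t by exact: fine_ge0.
have mG : measurable_fun setT G by exact: measurableT_comp.
have mEG : measurable_fun setT (EFin \o G) by exact/measurable_EFinP.
have iG : mu.-integrable `]0, 1] (EFin \o G).
  apply: le_integrable iF => //; first exact: measurable_funTS.
  move=> t _ /=; rewrite (gee0_abs (F0 t)) (ger0_norm (G0 t)).
  by have := F0 t; rewrite /G /=; case: (F t) => [r| |]//= _; rewrite leey.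
have iGc : mu.-integrable `[0, 1] (EFin \o G).
  apply/integrableP; split; first exact: measurable_funTS.
  case/integrableP: iG => _; rewrite -integral_itv_obnd_cbnd//.
  by apply: measurable_funTS; exact: measurableT_comp.
have Ffin : {ae mu, forall t, `]0, 1]%classic t -> F t \is a fin_num}.
  exact: integrable_ae iF.
have fG k i j : (i <= j)%N -> (j <= 2 ^ m k)%N ->
   ((mdist (g (knot (2 ^ m k) i)) (g (knot (2 ^ m k) j)))%:E <=
   \int[mu]_(t in `]knot (2 ^ m k) i, knot (2 ^ m k) j]) (G t)%:E)%E.
  move=> ij jN; have := @mdist_le_quotient_step _ _ g (2 ^ m k) i (j - i).
  rewrite subnKC// => /(_ jN) /le_trans; apply.
  have M : measurable_fun (`]knot (2 ^ m k) i, knot (2 ^ m k) j] : set R)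
    (fun t => (G t)%:E) by exact: measurable_funTS.
  have H1 t : `]knot (2 ^ m k) i, knot (2 ^ m k) j]%classic t ->
    (0 <= (quotient_step g (2 ^ m k) t)%:E)%E by rewrite lee_fin quotient_step_ge0.
  have H2 t : `]knot (2 ^ m k) i, knot (2 ^ m k) j]%classic t -> (0 <= (G t)%:E)%E.
    by rewrite lee_fin.
  apply: ge0_le_integral_off_null;
    [exact: measurable_itv|exact: H1|exact: M|exact: H2|].
  move: Ffin; apply: filterS; first exact: (ae_filter_ringOfSetsType mu).
  move=> t tF; rewrite /= in_itv/= => /andP[it tj].
  rewrite /G /= fineK; first exact: fF.
  by apply: tF; rewrite /= in_itv/= (le_lt_trans (knot_ge0 _ _) it)
    (le_trans tj)// knot_le1.
exists G; split=> // s t s0; rewrite le_eqVlt => /predU1P[->|st] t1.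
  by rewrite mdistxx; apply: integral_ge0 => r _; rewrite lee_fin.
apply/lee_addgt0Pr => e e0; have e2 : 0 < e / 2 by rewrite divr_gt0.
have t0 : 0 < t by exact: le_lt_trans st.
have [d1 d10 D1] := C01_near gC s0 (le_trans (ltW st) t1) e2.
have [d2 d20 D2] := C01_near gC (ltW t0) t1 e2.
have d0 : 0 < Num.min (Num.min d1 d2) ((t - s) / 2).
  by rewrite !lt_min d10 d20 divr_gt0// subr_gt0.
have [k _ kP] := dyadic_small d0.
have := kP (m k) (mk k); rewrite !lt_min => /andP[/andP[]].
set N := (2 ^ m k)%N => N1 N2 N3.
have N0 : (0 < N)%N by rewrite expn_gt0.
have [i [iN si is_]] : exists i,
  [/\ (i <= N)%N, s <= knot N i & knot N i < s + N%:R^-1].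
  move: s0; rewrite le_eqVlt => /predU1P[<-|s0].
    by exists 0%N; rewrite knot0 add0r invr_gt0 ltr0n.
  have [i [i1 i2]] := knot_index N0 s0 (le_trans (ltW st) t1).
  by exists i.+1; split=> //; have := knotB (R := R) N i; lra.
have [j [jt tj]] := knot_index N0 t0 t1.
have jB := knotB (R := R) N j.
have ij : (i <= j)%N.
  rewrite leqNgt; apply/negP => /ltnW/(knot_le (R := R) N); lra.
have jN : (j <= N)%N by exact/ltnW.
have := fG k i j ij jN; rewrite -/N => fij.
have A1 : mdist (g s) (g (knot N i)) < e / 2.
  by apply: D1; rewrite ?knot_ge0 ?knot_le1// ger0_norm; lra.
have A2 : mdist (g (knot N j)) (g t) < e / 2.
  by rewrite metric_sym; apply: D2;
    rewrite ?knot_ge0 ?knot_le1// distrC ger0_norm; lra.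
apply: (@le_trans _ _ ((mdist (g (knot N i)) (g (knot N j)))%:E + e%:E)%E).
  rewrite -EFinD lee_fin; have := metric_triangle (g s) (g (knot N i)) (g t).
  by have := metric_triangle (g (knot N i)) (g (knot N j)) (g t); lra.
apply: leeD => //; apply: le_trans fij _; apply: ge0_subset_integral => //.
- exact: measurable_funTS.
- by move=> r _; rewrite lee_fin.
- by apply: subset_itv; rewrite bnd_simp// ltW.
Qed.

End ac_of_energy.

(** * The lower bound *)

Section gamma_liminf.
Context {R : realType} {X : metricType R}.
Implicit Types (u : nat -> R -> X) (v : R -> X).

(** The lower semicontinuity of the distance carried over to its square, with
    an explicit error in place of lower limits so that finite sums can be
    taken. *)
Lemma near_sq_mdist_ge u v (s t N : R) :
  0 <= N ->
  ((mdist (v s) (v t))%:E <= limn_einf (fun n => (mdist (u n s) (u n t))%:E))%E ->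
  forall d, 0 < d -> \forall n \near \oo,
    N * mdist (v s) (v t) ^+ 2 - d <= N * mdist (u n s) (u n t) ^+ 2.
Proof.
move=> N0 H d d0; set D := mdist _ _ in H *.
have D0 : 0 <= D by exact: mdist_ge0.
(* Lowering [D] by [e] lowers [N D^2] by at most [2 N D e <= d]. *)
pose e := d / (2 * N * D + 1).
have den : 0 < 2 * N * D + 1 by rewrite ltr_pwDr// !mulr_ge0.
have e0 : 0 < e by rewrite divr_gt0.
have ed : 2 * N * D * e <= d.
  by rewrite /e mulrCA ger_pMr// ler_pdivrMr// mul1r lerDl.
have : ((D - e)%:E < limn_einf (fun n => (mdist (u n s) (u n t))%:E))%E.
  by apply: lt_le_trans H; rewrite lte_fin; lra.
move=> /limn_einf_near; apply: filterS => n; rewrite lte_fin.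
set M := mdist _ _ => DM.
have M0 : 0 <= M by exact: mdist_ge0.
have [eD|De] := leP e D.
  have h : D ^+ 2 - 2 * D * e <= M ^+ 2 by nra.
  by have := ler_wpM2l N0 h; nra.
have h : D ^+ 2 <= D * e by rewrite expr2 ler_wpM2l// ltW.
have := ler_wpM2l N0 h; have : 0 <= N * M ^+ 2 by rewrite mulr_ge0// sqr_ge0.
nra.
Qed.

Lemma near_energy_ge u v :
  (forall s t, 0 <= s <= 1 -> 0 <= t <= 1 -> ((mdist (v s) (v t))%:E <=
     limn_einf (fun n => (mdist (u n s) (u n t))%:E))%E) ->
  forall (N : nat) d, 0 < d -> \forall n \near \oo,
    energy v N - N%:R * d <= energy (u n) N.
Proof.
move=> H N d d0; rewrite /energy.
have : forall k, (k <= N)%N -> \forall n \near \oo,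
    \sum_(0 <= i < k) N%:R * mdist (v (knot N i)) (v (knot N i.+1)) ^+ 2 - k%:R * d
    <= \sum_(0 <= i < k) N%:R * mdist (u n (knot N i)) (u n (knot N i.+1)) ^+ 2.
  elim=> [_|k IH kN].
    by apply: nearW => n; rewrite !big_geq// mul0r subr0.
  have k1 : 0 <= (knot N k : R) <= 1 by rewrite knot_ge0 knot_le1// ltnW.
  have k2 : 0 <= (knot N k.+1 : R) <= 1 by rewrite knot_ge0 knot_le1.
  have := near_sq_mdist_ge (ler0n R N) (H _ _ k1 k2) d0.
  move: (IH (ltnW kN)); apply: filterS2 => n; rewrite !big_nat_recr//= -natr1.
  move=> h1 h2; lra.
by move=> /(_ N (leqnn N)); apply: filterS => n; rewrite !big_mkord.
Qed.

(** Below a value [c] exceeding the lower limit of the actions, infinitely many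
    curves have energies at most [2 c], hence so does the limit curve. *)
Lemma action_lsc u v : C01 v ->
  (forall s t, 0 <= s <= 1 -> 0 <= t <= 1 -> ((mdist (v s) (v t))%:E <=
     limn_einf (fun n => (mdist (u n s) (u n t))%:E))%E) ->
  (action v <= limn_einf (fun n => action (u n)))%E.
Proof.
move=> vC H; rewrite leNgt; apply/negP => /lte_real_between[c lc cv].
have vc n : energy v (2 ^ n) <= 2 * c.
  set N := (2 ^ n)%N; apply/ler_addgt0Pl => e e0.
  have N0 : 0 < N%:R :> R by rewrite ltr0n expn_gt0.
  have d0 : 0 < e / N%:R by rewrite divr_gt0.
  have [k _ kP] := near_energy_ge H N d0.
  have [j kj jc] := limn_einf_lt_frequently lc k.
  have := kP j kj; rewrite mulrC divfK ?gt_eqF// => h1.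
  have := @energy_le_action _ _ (u j) N; rewrite /N expn_gt0 => /(_ isT);
    rewrite -/N => h2.
  have : (2%:E * action (u j) <= 2%:E * c%:E)%E by rewrite lee_wpmul2l// ltW.
  by move=> h3; have := le_trans h2 h3; rewrite -EFinM lee_fin; lra.
have vAC := AC_of_energy vC vc.
have : (2%:E * action v <= 2%:E * c%:E)%E.
  apply: le_trans (action_le_energy vAC) _; rewrite leNgt; apply/negP => h.
  have [n _ /(_ n (leqnn n))] := limn_einf_near h.
  by rewrite /= -EFinM lte_fin ltNge vc.
by rewrite lee_pmul2l ?lte_fin// leNgt cv.
Qed.

Lemma slope_ge0 (E : X -> \bar R) p : (0 <= slope E p)%E.
Proof.
rewrite /slope; case: asboolP => // _; case: asboolP => [//|ip].
apply: limf_esup_ge0 => [p0|z].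
  apply: ip; split; first exact: mem_set.
  exists [set z | z = p]; last by rewrite setIT.
  have {}p0 : \forall z \near p, z != p -> (set0 : set X) z := p0.
  apply: filterS p0 => z /= zp; apply: contrapT => nzp.
  by apply: zp; apply/eqP.
by apply: mule_ge0; [rewrite le_max lexx orbT|rewrite inve_ge0 lee_fin mdist_ge0].
Qed.

Lemma sq_slope_ge0 (E : X -> \bar R) p : (0 <= slope E p ^+ 2)%E.
Proof. by rewrite expe2 mule_ge0// slope_ge0. Qed.

Lemma slope_action_ge0 (E : X -> \bar R) v : (0 <= slope_action E v)%E.
Proof.
by apply: mule_ge0; [rewrite lee_fin|apply: integral_ge0 => t _; exact: sq_slope_ge0].
Qed.

Lemma perturbed_action_ge (E : X -> \bar R) eps v :
  (action v <= perturbed_action E eps v)%E.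
Proof.
by rewrite leeDl// mule_ge0 ?slope_action_ge0// lee_fin sqr_ge0.
Qed.

Lemma endpoint_indicator_ge0 (p q : X) v : (0 <= endpoint_indicator p q v)%E.
Proof. by rewrite /endpoint_indicator; case: asboolP. Qed.

(** The predicate [pc] stands for a notion of convergence of points, of which
    only the lower semicontinuity of the distance is required. It also settles
    the constraint: points converging to distinct limits are eventually
    distinct. *)
Lemma gamma_liminf (E : X -> \bar R) (eps : nat -> R)
    (pc : (nat -> X) -> X -> Prop) (p_ q_ : nat -> X) (p q : X) u v :
  (forall a b x y, pc a x -> pc b y ->
     ((mdist x y)%:E <= limn_einf (fun n => (mdist (a n) (b n))%:E))%E) ->
  pc p_ p -> pc q_ q -> C01 v ->
  (forall t, 0 <= t <= 1 -> pc (u ^~ t) (v t)) ->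
  (action v + endpoint_indicator p q v <= limn_einf (fun n =>
    perturbed_action E (eps n) (u n) + endpoint_indicator (p_ n) (q_ n) (u n)))%E.
Proof.
move=> pclsc pp qq vC uv.
have far a b (x y : X) : pc a x -> pc b y -> x <> y ->
    \forall n \near \oo, a n <> b n.
  move=> ax by_ /eqP; rewrite -mdist_gt0 => xy.
  have : (0%:E < limn_einf (fun n => (mdist (a n) (b n))%:E))%E.
    by apply: lt_le_trans (pclsc _ _ _ _ ax by_); rewrite lte_fin.
  move=> /limn_einf_near; apply: filterS => n; rewrite lte_fin mdist_gt0.
  by move/eqP.
have I01 : 0 <= (0 : R) <= 1 by rewrite lexx ler01.
have I11 : 0 <= (1 : R) <= 1 by rewrite lexx ler01.
have [[v0 v1]|nv] := pselect (v 0 = p /\ v 1 = q).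
  rewrite /endpoint_indicator asboolT// adde0.
  have := action_lsc vC (fun s t s01 t01 => pclsc _ _ _ _ (uv _ s01) (uv _ t01)).
  move=> H; apply: limn_einf_ge => c ca.
  have := limn_einf_near (lt_le_trans ca H); apply: filterS => n cn.
  apply: le_trans (ltW cn) _; apply: le_trans (perturbed_action_ge E (eps n) _) _.
  by rewrite leeDl// endpoint_indicator_ge0.
apply: limn_einf_ge => c _.
have : \forall n \near \oo, ~ (u n 0 = p_ n /\ u n 1 = q_ n).
  have [v0|v0] := pselect (v 0 = p).
    have v1 : v 1 <> q by move=> v1; apply: nv.
    by have := far _ _ _ _ (uv _ I11) qq v1; apply: filterS => n H [_ /H].
  by have := far _ _ _ _ (uv _ I01) pp v0; apply: filterS => n H [/H].
apply: filterS => n H; rewrite /endpoint_indicator [in leRHS]asboolF//.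
rewrite addey ?leey// gt_eqF//; apply: lt_le_trans (perturbed_action_ge E (eps n) _).
by apply: lt_le_trans (action_ge0 _); rewrite ltNyr.
Qed.

End gamma_liminf.

(** * The evolution variational inequality integrated in time *)

Section exp_primitive.
Context {R : realType}.
Variables (k : R) (k0 : 0 < k).

(** The integral of exp (- k r) for [r] from 0 to [t]. *)
Definition expint (t : R) : R := (1 - expR (- k * t)) / k.

Lemma expint0 : expint 0 = 0.
Proof. by rewrite /expint mulr0 expR0 subrr mul0r. Qed.

Lemma expR_lip (x y : R) : x <= y -> y <= 0 -> expR y - expR x <= y - x.
Proof.
move=> xy y0; have := expR_ge1Dx (x - y) => h.
have -> : expR x = expR y * expR (x - y) by rewrite -expRD; congr expR; ring.
have e1 : expR y <= 1 by rewrite -expR0 ler_expR.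
have := expR_gt0 y; nra.
Qed.

Lemma expintB (s t : R) : 0 <= s -> s <= t ->
  0 <= expint t - expint s /\ expint t - expint s <= t - s.
Proof.
move=> s0 st; rewrite /expint -mulrBl.
have -> : 1 - expR (- k * t) - (1 - expR (- k * s)) = expR (- k * s) -
  expR (- k * t) by ring.
have kst : - k * t <= - k * s by rewrite !mulNr lerN2 ler_pM2l.
have ks : - k * s <= 0 by rewrite mulNr oppr_le0 mulr_ge0// ltW.
split; first by apply: divr_ge0; [rewrite subr_ge0 ler_expR|exact: ltW].
by rewrite ler_pdivrMr//; have := expR_lip kst ks; lra.
Qed.

Lemma expint_ge0 t : 0 <= t -> 0 <= expint t.
Proof. by move=> t0; have [+ _] := expintB (lexx 0) t0; rewrite expint0 subr0. Qed.

Lemma expint_le t : 0 <= t -> expint t <= t.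
Proof. by move=> t0; have [_] := expintB (lexx 0) t0; rewrite expint0 !subr0. Qed.

Lemma expint_ge t : 0 <= t -> t * expR (- k * t) <= expint t.
Proof.
move=> t0; rewrite /expint ler_pdivlMr//.
have := expR_ge1Dx (k * t); have := expR_gt0 (- k * t).
have e1 : expR (- k * t) * expR (k * t) = 1.
  by rewrite -expRD mulNr addNr expR0.
set x := expR (- k * t) in e1 *; set y := expR (k * t) in e1 *; nra.
Qed.

Lemma expint_gt0 t : 0 < t -> 0 < expint t.
Proof.
by move=> t0; apply: lt_le_trans (expint_ge (ltW t0)); rewrite mulr_gt0// expR_gt0.
Qed.

Lemma expintD s t : expint (s + t) = expint s + expR (- k * s) * expint t.
Proof. by rewrite /expint mulrDr expRD; field; rewrite gt_eqF. Qed.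

Lemma is_derive_expR_shift (s r : R) :
  is_derive r 1 (fun x : R => expR (- k * (x - s))) (- k * expR (- k * (r - s))).
Proof.
apply: is_derive_eq.
rewrite /GRing.scale/= ; ring.
Qed.

Lemma is_derive_expint (s r : R) :
  is_derive r 1 (fun x : R => expint (x - s)) (expR (- k * (r - s))).
Proof.
rewrite /expint; apply: is_derive_eq.
rewrite /GRing.scale/=; field; by rewrite gt_eqF.
Qed.

End exp_primitive.

Section evi_integrated.
Context {R : realType} {X : metricType R}.
Notation mu := (@lebesgue_measure R).
Variables (E : X -> \bar R) (lam : R).
Let k := `|lam| + 1.

(** Put U(r) = exp(-k (r - s)) d(g(r), z)^2 / 2 - expint (r - s) (E z - c). The
    inequality, with [E (g r)] bounded below by [c] and the constant weakened
    to [- k], says that U has a nonpositive derivative almost everywhere. The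
    number [c] is kept apart from the energy of the end point because the
    monotonicity of the energy is deduced from this lemma. *)
Lemma evi_time_integrated (g : R -> X) (z : X) (s t c : R) :
  (E z < +oo)%E -> (-oo < E z)%E ->
  AC_on s t g -> s <= t -> 0 < s ->
  {ae mu, forall r : R, 0 < r -> derivable (fun x : R => mdist (g x) z ^+ 2) r 1 /\
        ((2^-1 * derive1 (fun x : R => mdist (g x) z ^+ 2) r
           + lam / 2 * mdist (g r) z ^+ 2)%:E + E (g r) <= E z)%E} ->
  (forall r, s < r -> r < t -> (c%:E <= E (g r))%E) ->
  expR (- k * (t - s)) / 2 * mdist (g t) z ^+ 2 - mdist (g s) z ^+ 2 / 2 <=
    expint k (t - s) * (fine (E z) - c).
Proof.
move=> Ez Ez' gAC st s0 evi cE.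
have k0 : 0 < k by rewrite /k ltr_wpDl.
set M := fine (E z) - c.
have zE : E z = (fine (E z))%:E by rewrite fineK// fin_numElt Ez' Ez.
have [f [f0 fi gf]] := gAC.
pose b r := mdist (g r) z ^+ 2.
pose I := (\int[mu]_(x in `[s, t]) (f x)%:E)%E.
have Ifin : I \is a fin_num by exact: integral_itv_fin_num.
pose D := mdist (g s) z + fine I.
have I0 : (0 <= I)%E by apply: integral_ge0 => x _; rewrite lee_fin.
have D0 : 0 <= D by rewrite addr_ge0 ?mdist_ge0 ?fine_ge0.
have bD r : s <= r -> r <= t -> mdist (g r) z <= D.
  move=> sr rt; have : mdist (g s) (g r) <= fine I.
    rewrite -lee_fin fineK//; apply: le_trans (gf _ _ (lexx s) sr rt) _.
    apply: ge0_subset_integral => //; first by case/integrableP: fi.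
      by move=> x _; rewrite lee_fin.
    by apply: subset_itv; rewrite bnd_simp.
  have := metric_triangle (g r) (g s) z; rewrite (metric_sym (g r) (g s)) /D; lra.
pose U r := expR (- k * (r - s)) * (2^-1 * b r) - expint k (r - s) * M.
(* [D] bounds the distance to [z] along the curve, so that the increments of
   [U] are controlled by the integral of [D f + C]. *)
pose C := k * D ^+ 2 + `|M|.
have C0 : 0 <= C by rewrite addr_ge0// mulr_ge0 ?sqr_ge0// ltW.
suff : U t <= U s by rewrite /U subrr mulr0 expR0 expint0 /b; lra.
apply: (@ac_nonincreasing R s t (fun x => D * f x + C)) => //.
- by move=> x; rewrite addr_ge0// mulr_ge0.
- have -> : EFin \o (fun x => D * f x + C) =
    (fun x => (D%:E * (f x)%:E) + (cst C%:E x))%E.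
    by apply/funext => x /=; rewrite EFinD EFinM.
  apply: integrableD => //; first exact: integrableZl.
  have : mu.-integrable `[s, t] (EFin \o (cst C : R -> R)).
    apply: continuous_compact_integrable; first exact: segment_compact.
    exact/continuous_subspaceT/cst_continuous.
  by [].
- move=> r r' sr rr' r't.
  have st' : `[r, r'] `<=` `[s, t] by apply: subset_itv; rewrite bnd_simp.
  have fir : mu.-integrable `[r, r'] (EFin \o f) by exact: integrableS fi.
  have cir : mu.-integrable `[r, r'] (EFin \o (cst C : R -> R)).
    apply: continuous_compact_integrable; first exact: segment_compact.
    exact/continuous_subspaceT/cst_continuous.
  have -> : (\int[mu]_(x in `[r, r']) (D * f x + C)%:E =
      D%:E * \int[mu]_(x in `[r, r']) (f x)%:E + (C * (r' - r))%:E)%E.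
    under eq_integral do rewrite EFinD EFinM.
    rewrite integralD//; last exact: integrableZl.
    rewrite integralZl//; congr (_ + _)%E.
    have muE := @lebesgue_measure_itv R `[r, r'].
    rewrite integral_cst//= [X in (_ * X)%E]muE /= lte_fin.
    case: ltP => [_|]; first by rewrite -EFinB -EFinM.
    by move=> r'r; rewrite mule0 (le_anti (introT andP (conj rr' r'r))) subrr mulr0.
  have dIf := gf _ _ sr rr' r't.
  rewrite -(fineK (integral_itv_fin_num fir)) in dIf *.
  set F := fine _ in dIf *; rewrite lee_fin in dIf.
  rewrite -EFinM -EFinD lee_fin.
  have rt : r <= t by exact: le_trans r't.
  have sr' : s <= r' by exact: le_trans rr'.
  have x1 := bD r sr rt; have x2 := bD r' sr' r't.
  have xx := mdist_lip (g r') (g r) z; rewrite (metric_sym (g r') (g r)) in xx.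
  have [j1 j2] := expintB k0 (ltac:(lra) : 0 <= r - s) (ltac:(lra) : r - s <= r' - s).
  have kst : - k * (r' - s) <= - k * (r - s) by rewrite !mulNr lerN2 ler_pM2l// lerB.
  have ks : - k * (r - s) <= 0 by rewrite mulNr oppr_le0 mulr_ge0 ?subr_ge0// ltW.
  have e1 := expR_lip kst ks.
  have e2 : expR (- k * (r - s)) <= 1 by rewrite -expR0 ler_expR.
  have e3 := expR_gt0 (- k * (r' - s)).
  have e4 : expR (- k * (r' - s)) <= expR (- k * (r - s)) by rewrite ler_expR.
  rewrite /U /b.
  set a := expR (- k * (r - s)) in e1 e2 e4 *.
  set a' := expR (- k * (r' - s)) in e1 e3 e4 *.
  set j := expint k (r - s) in j1 j2 *; set j' := expint k (r' - s) in j1 j2 *.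
  set x := mdist (g r) z in x1 xx *; set x' := mdist (g r') z in x2 xx *.
  have y1 : 0 <= x by exact: mdist_ge0.
  have y2 : 0 <= x' by exact: mdist_ge0.
  have h1 : `|x' ^+ 2 - x ^+ 2| <= 2 * D * F.
    rewrite subr_sqr normrM mulrC; apply: ler_pM => //; last exact: le_trans xx dIf.
    by rewrite ger0_norm; lra.
  have h2 : `|a' - a| <= k * (r' - r) by rewrite distrC ger0_norm ?subr_ge0//; lra.
  have h3 : `|j' - j| <= r' - r by rewrite ger0_norm//; lra.
  have -> : a' * (2^-1 * x' ^+ 2) - j' * M - (a * (2^-1 * x ^+ 2) - j * M) =
    a' * (2^-1 * (x' ^+ 2 - x ^+ 2)) + (a' - a) * (2^-1 * x ^+ 2) - (j' - j) *
      M by ring.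
  apply: le_trans (ler_normB _ _) _.
  have -> : D * F + C * (r' - r) =
    D * F + k * D ^+ 2 * (r' - r) + `|M| * (r' - r) by rewrite /C; ring.
  apply: lerD; last first.
    by rewrite normrM [leLHS]mulrC; apply: ler_wpM2l.
  apply: le_trans (ler_normD _ _) _; apply: lerD.
    rewrite normrM (gtr0_norm e3) normrM [`|2^-1|]ger0_norm//.
    have F0 : 0 <= F by apply: le_trans dIf; exact: mdist_ge0.
    have a'1 : a' <= 1 by exact: le_trans e2.
    apply: (@le_trans _ _ (1 * (2^-1 * (2 * D * F)))); last by lra.
    by apply: ler_pM; [exact: ltW|apply: mulr_ge0|exact: a'1|apply: ler_wpM2l].
  rewrite normrM [`|2^-1 * _|]ger0_norm; last by rewrite mulr_ge0// sqr_ge0.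
  have xD : x ^+ 2 <= D ^+ 2 by rewrite ler_pXn2r.
  apply: (@le_trans _ _ ((k * (r' - r)) * D ^+ 2)); last by lra.
  apply: ler_pM => //; first by rewrite mulr_ge0// sqr_ge0.
  by have := sqr_ge0 x; lra.
move: evi; apply: filterS; first exact: (ae_filter_ringOfSetsType mu).
move=> r H /andP[sr rt]; have [db ineq] := H (lt_trans s0 sr).
have db' : is_derive r 1 b (derive1 b r) by apply: DeriveDef => //; rewrite derive1E.
have h1 := is_derive_expR_shift k s r.
have h2 := is_derive_expint k0 s r.
have -> : 'D_1 U r = expR (- k * (r - s)) * (2^-1 * derive1 b r - k / 2 * b r - M).
  have dU : is_derive r 1 U (expR (- k * (r - s)) *
    (2^-1 * derive1 b r - k / 2 * b r - M)).
    rewrite /U; apply: is_derive_eq.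
    by rewrite /GRing.scale/=; field.
  exact: derive_val.
apply: mulr_ge0_le0; first exact: expR_ge0.
have Er : E (g r) \is a fin_num.
  have cE' := cE _ sr rt; rewrite fin_numElt (lt_le_trans _ cE') ?ltNyr//=.
  have : ((2^-1 * derive1 b r + lam / 2 * b r)%:E + E (g r) < +oo)%E.
    by apply: le_lt_trans ineq _; rewrite zE ltry.
  by case: (E (g r)) => [x _| |_] //; rewrite ?ltry// addey// ltxx.
have := cE _ sr rt; move: ineq; rewrite zE -(fineK Er) -EFinD !lee_fin /M -/(b r).
have : - lam <= k by rewrite /k; have := ler_norm (- lam); rewrite normrN; lra.
have b0 : 0 <= b r by exact: sqr_ge0.
by move=> *; nra.
Qed.

End evi_integrated.

Section evi_curves.
Context {R : realType} {X : metricType R}.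
Variables (E : X -> \bar R) (k : R).

(** What the estimates below use of a flow: the integrated inequality with the
    constant [- k], and energies that are finite and nonincreasing. *)
Definition evi_curve (g : R -> X) : Prop :=
  [/\ forall t, 0 < t -> (E (g t) < +oo)%E,
      forall s t, 0 < s -> s <= t -> fine (E (g t)) <= fine (E (g s)) &
      forall s t z, 0 < s -> s <= t -> (E z < +oo)%E ->
        expR (- k * (t - s)) / 2 * mdist (g t) z ^+ 2 - mdist (g s) z ^+ 2 / 2 <=
          expint k (t - s) * (fine (E z) - fine (E (g t)))].

End evi_curves.

Section evi_flow.
Context {R : realType} {X : metricType R}.
Variables (E : X -> \bar R) (lam : R).
Hypothesis E_gtNy : forall p, (-oo < E p)%E.
Hypothesis E_lsc : lower_semicontinuous E.
Let k := `|lam| + 1.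
Let k0 : 0 < k. Proof. by rewrite /k ltr_wpDl. Qed.

Lemma AC_loc_pos_continuous (g : R -> X) (t : R) : AC_loc_pos g -> 0 < t ->
  forall e, 0 < e -> exists2 d, 0 < d & forall r, `|r - t| < d ->
    mdist (g t) (g r) < e.
Proof.
move=> gAC t0 e e0.
have t2 : 0 < t / 2 by rewrite divr_gt0.
have [d d0 dP] := AC_on_unif (gAC (t / 2) (2 * t) t2 ltac:(lra)) e0.
exists (Num.min d (t / 2)); first by rewrite lt_min d0.
move=> r; rewrite lt_min => /andP[rd]; rewrite ltr_norml => /andP[h1 h2].
by apply: dP; rewrite 1?distrC//; lra.
Qed.

Lemma lsc_along (g : R -> X) (t c : R) : AC_loc_pos g -> 0 < t ->
  (c%:E < E (g t))%E -> exists2 d, 0 < d & forall r, `|r - t| < d ->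
    (c%:E < E (g r))%E.
Proof.
move=> gAC t0 ct; have [V Vt VP] := E_lsc ct.
have /nbhs_ballP[e /= e0 eV] := Vt.
have [d d0 dP] := AC_loc_pos_continuous gAC t0 e0.
exists d => // r rd; apply: VP; apply: eV; rewrite ballEmdist /=; exact: dP.
Qed.

(** Suppose that [E (g t)] exceeds [c = E (g s)] and let [u] be the last time
    before [t] at which the energy is at most [c], which exists by lower
    semicontinuity. The integrated inequality on [u,t] with [g u] as test point
    and [c] as lower bound gives d(g(t), g(u)) = 0, a contradiction. *)
Lemma evi_flow_nonincreasing p (g : R -> X) (s t : R) : EVI_gradient_flow E lam p g ->
  0 < s -> s <= t -> (E (g t) <= E (g s))%E.
Proof.
move=> [gAC _ evi] s0 st; rewrite leNgt; apply/negP => Est.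
have Es : E (g s) = (fine (E (g s)))%:E.
  by rewrite fineK// fin_numElt E_gtNy (lt_le_trans Est (leey _)).
set c := fine _ in Es.
pose A := [set v | s <= v <= t /\ forall r, v < r -> r <= t -> (c%:E < E (g r))%E].
have At : A t by split; [rewrite st lexx|move=> r tr rt;
  have := lt_le_trans tr rt; rewrite ltxx].
have Ainf : has_inf A by split; [exists t|exists s => v [/andP[]]].
pose u := inf A.
have ut : u <= t by apply: ge_inf => //; case: Ainf.
have su : s <= u by apply: lb_le_inf; [exists t|move=> v [/andP[]]].
have u0 : 0 < u by exact: lt_le_trans su.
have above r : u < r -> r <= t -> (c%:E < E (g r))%E.
  move=> ur rt; have [v Av vr] := inf_lt Ainf.1 ur.
  by apply: Av.2.
have Eu : (E (g u) <= c%:E)%E.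
  rewrite leNgt; apply/negP => cu.
  have [d d0 dP] := lsc_along gAC u0 cu.
  have [us|us] := leP u s.
    by move: cu; rewrite (le_anti (introT andP (conj us su))) Es ltxx.
  pose v := Num.max s (u - d / 2).
  have [sv vu vd] : [/\ s <= v, v < u & u - d / 2 <= v].
    by rewrite /v le_max lexx gt_max us ltrBlDr ltrDl divr_gt0// le_max lexx orbT.
  have Av : A v.
    split; first by rewrite sv (le_trans (ltW vu)).
    move=> r vr rt; have [ru|] := leP r u; last by move/above; apply.
    by apply: dP; rewrite ltr_norml; apply/andP; split; lra.
  by have := ge_inf Ainf.2 Av; rewrite -/u; lra.
have Eufin : (E (g u) < +oo)%E by apply: le_lt_trans Eu (ltry _).
have H := @evi_time_integrated R X E lam g (g u) u t c Eufin (E_gtNy _)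
  (gAC u t u0 ut) ut u0 (evi (g u)).
have {H} := H (fun r ur rt => ltW (above r ur (ltW rt))).
rewrite mdistxx expr0n mul0r subr0 -/k => H.
have J0 : 0 <= expint k (t - u) by apply: expint_ge0; rewrite ?subr_ge0.
have Ec : fine (E (g u)) - c <= 0.
  by rewrite subr_le0 -lee_fin fineK// fin_numElt E_gtNy.
have d0 : mdist (g t) (g u) ^+ 2 <= 0.
  have := expR_gt0 (- k * (t - u)).
  have : expint k (t - u) * (fine (E (g u)) - c) <= 0 by rewrite mulr_ge0_le0.
  by have := sqr_ge0 (mdist (g t) (g u)); nra.
have : mdist (g t) (g u) = 0.
  by apply/eqP; rewrite -sqrf_eq0 eq_le d0 sqr_ge0.
move=> /mdist_positivity gtu; move: Est; rewrite gtu Es.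
by rewrite ltNge Eu.
Qed.

Hypothesis E_dom : exists z, edomain E z.

(** If the energy were infinite at some time, it would be infinite at all
    earlier times, and the lower bound in the integrated inequality could be
    taken arbitrarily large. *)
Lemma evi_flow_curve p (g : R -> X) : EVI_gradient_flow E lam p g -> evi_curve E k g.
Proof.
move=> gflow; have [gAC _ evi] := gflow.
have Efin t : 0 < t -> (E (g t) < +oo)%E.
  move=> t0; rewrite ltNge; apply/negP => Ey.
  have {}Ey r : 0 < r -> r <= t -> E (g r) = +oo%E.
    move=> r0 rt; apply/eqP; rewrite -leye_eq; apply: le_trans Ey _.
    exact: evi_flow_nonincreasing gflow r0 rt.
  have [z zE] := E_dom; have t2 : 0 < t / 2 by rewrite divr_gt0.
  have t2t : t / 2 <= t by lra.
  have J0 : 0 < expint k (t - t / 2) by apply: expint_gt0 => //; lra.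
  pose a := expR (- k * (t - t / 2)) / 2 * mdist (g t) z ^+ 2 -
    mdist (g (t / 2)) z ^+ 2 / 2.
  (* With this lower bound the inequality reads [a <= a - 1]. *)
  pose c := fine (E z) - (a - 1) / expint k (t - t / 2).
  have := @evi_time_integrated R X E lam g z (t / 2) t c zE (E_gtNy _)
    (gAC _ _ t2 t2t) t2t t2 (evi z).
  rewrite -/k -/a => /(_ _)/wrap[|].
    by move=> r h1 h2; rewrite Ey ?leey//; lra.
  have -> : fine (E z) - c = (a - 1) / expint k (t - t / 2) by rewrite /c; ring.
  by rewrite mulrC divfK ?gt_eqF//; lra.
have mon s t : 0 < s -> s <= t -> fine (E (g t)) <= fine (E (g s)).
  move=> s0 st; rewrite fine_le ?fin_numElt ?E_gtNy ?Efin ?(lt_le_trans s0)//.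
  exact: evi_flow_nonincreasing gflow s0 st.
split=> // s t z s0 st zE.
apply: (@evi_time_integrated R X E lam g z s t _ zE (E_gtNy _) (gAC _ _ s0 st)
  st s0 (evi z)).
move=> r sr rt; have r0 := lt_trans s0 sr.
rewrite -[leRHS]fineK ?fin_numElt ?E_gtNy ?Efin// lee_fin.
by apply: mon => //; exact: ltW.
Qed.

End evi_flow.

(** * Contraction and regularization along the flow *)

Lemma archi_le0 (R : realType) (x C : R) :
  (forall N, N.+1%:R * x <= C) -> x <= 0.
Proof.
move=> H; rewrite leNgt; apply/negP => x0.
have C0 : 0 <= C by apply: le_trans (H 0%N); rewrite mul1r ltW.
have [N NP] := ltr_add_invr (divr_gt0 x0 (ltr_wpDl C0 ltr01)).
have := H N; apply/negP; rewrite -ltNge.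
move: NP; rewrite add0r ltr_pdivlMr ?ltr_wpDl// -ltr_pdivlMl ?invr_gt0 ?ltr0n//.
rewrite invrK; lra.
Qed.

Section evi_regularization.
Context {R : realType} {X : metricType R}.
Variables (E : X -> \bar R) (k : R).
Hypothesis k0 : 0 < k.
Let e p := fine (E p).

(** On a step of length tau, [g] is tested against the later position of [h],
    and then [h] against the earlier position of [g]. The energies nearly
    cancel: what remains is tau times the energy lost by [g], which telescopes
    to O(tau), and an error O(tau^2) for each step. *)
Lemma evi_contraction (g h : R -> X) (s t : R) : evi_curve E k g -> evi_curve E k h ->
  0 < s -> s <= t -> mdist (g t) (h t) <= expR (k * (t - s)) * mdist (g s) (h s).
Proof.
move=> [gf gm gi] [hf hm hi] s0; rewrite le_eqVlt => /predU1P[<-|st].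
  by rewrite subrr mulr0 expR0 mul1r.
pose T := t - s; have T0 : 0 < T by rewrite subr_gt0.
pose B := Num.max 0 (e (g s) - e (h t)).
pose a r := 2^-1 * mdist (g r) (h r) ^+ 2.
pose C := T * (e (g s) - e (g t) + k * T * B).
(* The total error over N + 1 steps is C / (N + 1). *)
suff key : forall N, N.+1%:R * (expR (- k * T) ^+ 2 * a t - a s) <= C.
  have := archi_le0 key; rewrite /a.
  set D := mdist (g t) _; set D' := mdist (g s) _ => le0.
  have -> : k * (t - s) = - (- k * T) by rewrite /T; ring.
  rewrite expRN -ler_pdivrMl ?invr_gt0 ?expR_gt0// invrK.
  rewrite -(@ler_pXn2r _ 2)// ?nnegrE ?mulr_ge0 ?mdist_ge0 ?expR_ge0//.
  by rewrite exprMn; lra.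
move=> N; pose tau := T / N.+1%:R.
have N0 : 0 < N.+1%:R :> R by rewrite ltr0n.
have tau0 : 0 < tau by rewrite divr_gt0.
pose q := expR (- k * tau).
have q0 : 0 <= q by exact: expR_ge0.
have q1 : q <= 1 by rewrite -expR0 ler_expR mulNr oppr_le0 mulr_ge0// ltW.
have q2 : 1 - q <= k * tau by have := expR_ge1Dx (- k * tau); rewrite -/q; lra.
pose ti i := s + i%:R * tau.
have tiS i : ti i.+1 = ti i + tau by rewrite /ti -natr1; ring.
have ti0 i : s <= ti i by rewrite /ti lerDl mulr_ge0// ltW.
have tiN : ti N.+1 = t by rewrite /ti /tau mulrC divfK ?gt_eqF// /T; ring.
have tit i : (i <= N.+1)%N -> ti i <= t.
  by move=> iN; rewrite -tiN /ti lerD2l ler_pM2r// ler_nat.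
have B0 : 0 <= B by rewrite le_max lexx.
have ind i : (i <= N.+1)%N -> q ^+ 2 ^+ i * a (ti i) - a s <=
    tau * (e (g s) - e (g (ti i))) + i%:R * (k * tau ^+ 2 * B).
  elim: i => [_|i IH iN].
    by rewrite /ti !mul0r addr0 expr0 mul1r !subrr mulr0 addr0.
  have {}IH := IH (ltnW iN).
  have ti_0 : 0 < ti i by exact: lt_le_trans s0 (ti0 i).
  have tile : ti i <= ti i.+1 by rewrite tiS lerDl ltW.
  have ti_1 : 0 < ti i.+1 by exact: lt_le_trans tile.
  have H1 := gi (ti i) (ti i.+1) (h (ti i.+1)) ti_0 tile (hf _ ti_1).
  have H2 := hi (ti i) (ti i.+1) (g (ti i)) ti_0 tile (gf _ ti_0).
  have tau_e : ti i.+1 - ti i = tau by rewrite tiS; ring.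
  rewrite tau_e -/q in H1 H2.
  have J1 := expint_ge0 k0 (ltW tau0); have J2 := expint_le k0 (ltW tau0).
  have eB : e (g (ti i.+1)) - e (h (ti i.+1)) <= B.
    rewrite le_max; apply/orP; right; apply: lerB; first exact: gm.
    by apply: hm => //; exact: tit.
  have ed : 0 <= e (g (ti i)) - e (g (ti i.+1)) by rewrite subr_ge0; exact: gm.
  rewrite !(metric_sym (h _)) in H2.
  have step : q ^+ 2 * a (ti i.+1) - a (ti i) <=
      tau * (e (g (ti i)) - e (g (ti i.+1))) + k * tau ^+ 2 * B.
    rewrite /a; set x := mdist (g (ti i.+1)) (h (ti i.+1)) in H1 *.
    set y := mdist (g (ti i)) (h (ti i.+1)) in H1 H2.
    set z := mdist (g (ti i)) (h (ti i)) in H2 *.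
    rewrite -/(e _) -/(e _) in H1; rewrite -/(e _) -/(e _) in H2.
    move: J1 J2 H1 H2 eB ed; set J := expint k tau.
    move: (e (g (ti i))) (e (g (ti i.+1))) (e (h (ti i.+1))) => e1 e2 e3.
    move=> J1 J2 H1 H2 eB ed.
    have H1' := ler_wpM2l q0 H1.
    have F1 : J * (e1 - e2) <= tau * (e1 - e2) by exact: ler_wpM2r.
    have F2 : J * ((1 - q) * (e2 - e3)) <= tau * (k * tau * B).
      apply: (@le_trans _ _ (J * ((1 - q) * B))).
        by apply: ler_wpM2l => //; apply: ler_wpM2l => //; lra.
      apply: ler_pM => //; first by rewrite mulr_ge0//; lra.
      by apply: ler_wpM2r.
    have -> : q ^+ 2 * (2^-1 * x ^+ 2) - 2^-1 * z ^+ 2 =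
      q * (q / 2 * x ^+ 2 - y ^+ 2 / 2) + (q / 2 * y ^+ 2 - z ^+ 2 / 2) by field.
    have -> : tau * (e1 - e2) + k * tau ^+ 2 * B = tau * (e1 - e2) + tau *
      (k * tau * B) by ring.
    by lra.
  have Q0 : 0 <= q ^+ 2 ^+ i by rewrite !exprn_ge0.
  have Q1 : q ^+ 2 ^+ i <= 1 by rewrite -exprM exprn_ile1.
  have R0 : 0 <= tau * (e (g (ti i)) - e (g (ti i.+1))) + k * tau ^+ 2 * B.
    by rewrite addr_ge0// ?mulr_ge0 ?sqr_ge0// ltW.
  have := ler_wpM2l Q0 step; have := ler_piMl R0 Q1.
  by rewrite [q ^+ 2 ^+ i.+1]exprSr -[i.+1%:R]natr1; nra.
have := ind N.+1 (leqnn _); rewrite tiN.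
have -> : q ^+ 2 ^+ N.+1 = expR (- k * T) ^+ 2.
  rewrite -!exprM mulnC exprM; congr (_ ^+ _).
  rewrite /q -expRM_natl; congr expR; rewrite /tau; field.
  by rewrite gt_eqF.
move=> H; have := ler_wpM2l (ltW N0) H; move=> /le_trans; apply.
rewrite /C le_eqVlt; apply/orP; left; apply/eqP; rewrite /tau; field.
by rewrite gt_eqF.
Qed.

End evi_regularization.

Section evi_slope.
Context {R : realType} {X : metricType R}.
Variables (E : X -> \bar R) (k : R).
Hypothesis k0 : 0 < k.
Let e p := fine (E p).

(** The bound of the slope by [l] in the global form that it takes for
    functionals convex with constant [- k]. In contrast to the slope it is a
    family of inequalities in [E p], and so passes to limits. *)
Definition slope_bound (p : X) (l : R) : Prop := 0 <= l /\
  forall z, (E z < +oo)%E ->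
    fine (E p) - fine (E z) <= l * mdist p z + k / 2 * mdist p z ^+ 2.

Lemma evi_shift g a : 0 <= a -> evi_curve E k g -> evi_curve E k (fun t => g (t + a)).
Proof.
move=> a0 [gf gm gi]; split.
- by move=> t t0; apply: gf; rewrite ltr_pwDl.
- by move=> s t s0 st; apply: gm; [rewrite ltr_pwDl|rewrite lerD2r].
move=> s t z s0 st zE; have -> : t - s = (t + a) - (s + a) by ring.
by apply: gi => //; [rewrite ltr_pwDl|rewrite lerD2r].
Qed.

(** Divide [r,t] into N + 1 steps. Tested against its own starting point, each
    step of length theta dissipates at least, up to a constant factor, its
    squared displacement over 2 theta, and by contraction the last displacement
      [rho] is, up to a
    constant factor, the shortest; hence [rho] is at most [M] theta. The
    inequality on the last step then bounds E(g(t)) - E(z) as claimed up to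
    [M rho / 2], which vanishes as N grows. *)
Lemma evi_slope_bound g (r t : R) : evi_curve E k g -> 0 < r -> r < t ->
  exists l, slope_bound (g t) l /\
    (t - r) * l ^+ 2 <= 2 * expR (4 * k * (t - r)) * (e (g r) - e (g t)).
Proof.
move=> gE r0 rt; have [gf gm gi] := gE.
pose T := t - r; have T0 : 0 < T by rewrite subr_gt0.
have t0 : 0 < t by exact: lt_trans rt.
pose De := e (g r) - e (g t).
have De0 : 0 <= De by rewrite subr_ge0; apply: gm => //; exact: ltW.
pose m2 := 2 * expR (4 * k * T) * De / T.
have m20 : 0 <= m2 by apply: divr_ge0; [rewrite !mulr_ge0 ?expR_ge0|exact: ltW].
pose M := Num.sqrt m2; have M0 : 0 <= M := sqrtr_ge0 _.
have M2 : M ^+ 2 = m2 by rewrite sqr_sqrtr.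
exists M; split; last by rewrite M2 /m2 mulrC divfK ?gt_eqF.
split=> // z zE; rewrite -subr_le0; apply: (archi_le0 (C := M ^+ 2 * T / 2)) => N.
pose th := T / N.+1%:R.
have N0 : 0 < N.+1%:R :> R by rewrite ltr0n.
have N1 : 1 <= N.+1%:R :> R by rewrite ler1n.
have th0 : 0 < th by rewrite divr_gt0.
have thN : N.+1%:R * th = T by rewrite /th mulrC divfK ?gt_eqF.
have thT : th <= T by rewrite -thN ler_peMl// ltW.
pose J := expint k th; have J0 : 0 < J by exact: expint_gt0.
have J1 : J <= th by apply: expint_le => //; exact: ltW.
have J2 : th * expR (- k * th) <= J by apply: expint_ge => //; exact: ltW.
pose rho := mdist (g (t - th)) (g t); have rho0 : 0 <= rho := mdist_ge0 _ _.
pose ti i := r + i%:R * th.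
have tiS i : ti i.+1 = ti i + th by rewrite /ti -natr1; ring.
have ti0 i : r <= ti i by rewrite /ti lerDl mulr_ge0// ltW.
have tiN : ti N.+1 = t by rewrite /ti thN /T; ring.
have tit i : (i <= N)%N -> ti i <= t - th.
  by move=> iN; rewrite -tiN tiS addrK /ti lerD2l ler_pM2r// ler_nat.
(* The loss by contraction over the whole interval. *)
pose Q := expR (- k * T); have Q0 : 0 < Q := expR_gt0 _.
have rhoi i : (i <= N)%N -> Q * rho <= mdist (g (ti i)) (g (ti i.+1)).
  move=> iN; have := @evi_contraction R X E k k0 g (fun x => g (x + th)) (ti i)
    (t - th) gE
    (evi_shift (ltW th0) gE) (lt_le_trans r0 (ti0 i)) (tit i iN).
  rewrite subrK -tiS -/rho => H.
  have le1 : k * (t - th - ti i) <= - (- k * T).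
    by rewrite mulNr opprK ler_pM2l// /T; have := ti0 i; lra.
  rewrite -ler_pdivlMl// -[Q^-1]expRN; apply: le_trans H _.
  by rewrite ler_wpM2r ?mdist_ge0// ler_expR.
have drop i : (i <= N.+1)%N ->
    i%:R * (expR (- k * th) / 2 * (Q * rho) ^+ 2) <= J * (e (g r) - e (g (ti i))).
  elim: i => [_|i IH iN]; first by rewrite /ti !mul0r addr0 subrr mulr0.
  have ti_0 : 0 < ti i by exact: lt_le_trans r0 (ti0 i).
  have tile : ti i <= ti i.+1 by rewrite tiS lerDl ltW.
  have := gi (ti i) (ti i.+1) (g (ti i)) ti_0 tile (gf _ ti_0).
  rewrite mdistxx expr0n mul0r subr0 (_ : ti i.+1 - ti i = th);
    last by rewrite tiS; ring.
  rewrite (metric_sym (g (ti i.+1))) -/J -/(e _) -/(e _) => H.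
  have h2 : (Q * rho) ^+ 2 <= mdist (g (ti i)) (g (ti i.+1)) ^+ 2.
    rewrite ler_pXn2r// ?nnegrE ?mdist_ge0 ?mulr_ge0//; first exact: rhoi.
    exact: ltW.
  have h3 : 0 <= expR (- k * th) / 2 by rewrite divr_ge0 ?expR_ge0.
  have := ler_wpM2l h3 h2; have := IH (ltnW iN); rewrite -[i.+1%:R]natr1; lra.
have rhoM : rho <= M * J.
  have H := drop N.+1 (leqnn _); rewrite tiN -/De in H.
  have MJ0 : 0 <= M * J by apply: mulr_ge0 => //; exact: ltW.
  rewrite -(@ler_pXn2r _ 2)// ?nnegrE//.
  rewrite exprMn M2 /m2.
  have Qth : Q <= expR (- k * th) by rewrite ler_expR !mulNr lerN2 ler_pM2l.
  have e4 : expR (4 * k * T) * Q ^+ 4 = 1.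
    rewrite /Q -expRM_natl -expRD -expR0; congr expR; ring.
  have H1 : N.+1%:R * (Q ^+ 3 / 2 * rho ^+ 2) <= J * De.
    apply: le_trans H; apply: ler_wpM2l; first exact: ltW.
    have -> : Q ^+ 3 / 2 * rho ^+ 2 = Q * (2^-1 * (Q * rho) ^+ 2) by field.
    rewrite -mulrA; apply: ler_wpM2r => //; apply: mulr_ge0 => //; exact: sqr_ge0.
  have thQ : th * Q <= J by apply: le_trans J2; apply: ler_wpM2l => //; exact: ltW.
  have H2 : T * Q * (Q ^+ 3 / 2 * rho ^+ 2) <= J ^+ 2 * De.
    have w0 : 0 <= Q ^+ 3 / 2 * rho ^+ 2.
      by rewrite mulr_ge0 ?sqr_ge0// divr_ge0// exprn_ge0// ltW.
    have -> : T * Q * (Q ^+ 3 / 2 * rho ^+ 2) =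
      (th * Q) * (N.+1%:R * (Q ^+ 3 / 2 * rho ^+ 2)) by rewrite -thN; ring.
    have -> : J ^+ 2 * De = J * (J * De) by ring.
    by apply: ler_pM => //; [rewrite mulr_ge0// ltW|rewrite mulr_ge0].
  set F := expR (4 * k * T) in e4 *.
  have F0 : 0 < F := expR_gt0 _.
  have -> : 2 * F * De / T * J ^+ 2 = 2 * F / T * (J ^+ 2 * De) by field;
    rewrite gt_eqF.
  have c0 : 0 <= 2 * F / T by rewrite divr_ge0 ?mulr_ge0// ltW.
  apply: le_trans (ler_wpM2l c0 H2).
  have -> : 2 * F / T * (T * Q * (Q ^+ 3 / 2 * rho ^+ 2)) = (F * Q ^+ 4) * rho ^+ 2.
    by field; rewrite gt_eqF.
  by rewrite e4 mul1r.
have tth0 : 0 < t - th by apply: lt_le_trans r0 _; move: thT; rewrite /T; lra.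
have tth1 : t - th <= t by rewrite lerBlDr lerDl ltW.
have := gi (t - th) t z tth0 tth1 zE.
rewrite (_ : t - (t - th) = th); last by ring.
rewrite -/J -/(e _) -/(e _); set D := mdist (g t) z.
have D0 : 0 <= D by exact: mdist_ge0.
have tri : mdist (g (t - th)) z <= D + rho.
  by have := metric_triangle (g (t - th)) (g t) z; rewrite -/rho -/D; lra.
have tri2 : mdist (g (t - th)) z ^+ 2 <= (D + rho) ^+ 2.
  by rewrite ler_pXn2r// ?nnegrE ?mdist_ge0 ?addr_ge0.
have qJ : expR (- k * th) = 1 - k * J.
  by rewrite /J /expint; field; rewrite gt_eqF.
rewrite qJ => H.
have H1 : J * (e (g t) - e z) <= J * (M * D + k / 2 * D ^+ 2 + M * rho / 2).
  have rr : rho * rho <= M * J * rho by apply: ler_wpM2r.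
  have rD : rho * D <= M * J * D by apply: ler_wpM2r.
  nra.
have {}H1 : e (g t) - e z <= M * D + k / 2 * D ^+ 2 + M * rho / 2.
  by rewrite -(ler_pM2l J0).
have H2 : M * rho <= M ^+ 2 * th.
  by rewrite expr2 -mulrA; apply: ler_wpM2l => //; apply: le_trans rhoM _;
    apply: ler_wpM2l.
have H3 : e (g t) - e z - (M * D + k / 2 * D ^+ 2) <= M ^+ 2 * th / 2 by lra.
have := ler_wpM2l (ltW N0) H3; rewrite -/(e _) -/(e _) -/D; move=> /le_trans; apply.
by rewrite le_eqVlt; apply/orP; left; apply/eqP; rewrite -thN; field.
Qed.

(** Two applications of the integrated inequality, on the two halves of the
    step. The first half only yields the energy at the midpoint; the surplus
    expint (d/2) (E(g(a+d/2)) - E(g(a+d))) is at least about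
    (d/2)^2 l^2 / 2 by [evi_slope_bound] on the second half. *)
Lemma evi_step g (a d : R) z : evi_curve E k g -> 0 < a -> 0 < d -> (E z < +oo)%E ->
  exists l, slope_bound (g (a + d)) l /\
    expR (- k * d) / 2 * mdist (g (a + d)) z ^+ 2 +
      expR (- (3 * k) * d) / 8 * d ^+ 2 * l ^+ 2 <=
    mdist (g a) z ^+ 2 / 2 + expint k d * (e z - e (g (a + d))).
Proof.
move=> gE a0 d0 zE; have [gf gm gi] := gE.
pose h := d / 2; have h0 : 0 < h by rewrite divr_gt0.
pose c := a + h; have c0 : 0 < c by rewrite addr_gt0.
have b_ : a + d = c + h by rewrite /c /h; field.
have cb : c < a + d by rewrite b_ ltrDl.
have ac : a <= c by rewrite lerDl ltW.
have [l [lb l2]] := evi_slope_bound gE c0 cb.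
exists l; split=> //.
have H1 := gi c (a + d) z c0 (ltW cb) zE.
have H2 := gi a c z a0 ac zE.
have bc : a + d - c = h by rewrite b_; ring.
have ca : c - a = h by rewrite /c; ring.
rewrite bc in H1 l2; rewrite ca in H2.
have -> : d = h + h by rewrite /h; field.
rewrite expintD//.
have J1 : h * expR (- k * h) <= expint k h by apply: expint_ge => //; exact: ltW.
have E0 : 0 < expR (- k * h) := expR_gt0 _.
set q := expR (- k * h) in H1 H2 J1 E0 *.
have -> : expR (- k * (h + h)) = q ^+ 2 by rewrite mulrDr expRD expr2.
have -> : expR (- (3 * k) * (h + h)) = q ^+ 6.
  by rewrite /q -expRM_natl; congr expR; ring.
have q1 : q <= 1 by rewrite -expR0 ler_expR mulNr oppr_le0 mulr_ge0// ltW.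
have q4 : expR (4 * k * h) * q ^+ 4 = 1.
  by rewrite /q -expRM_natl -expRD -expR0; congr expR; ring.
set F := expR (4 * k * h) in q4 l2.
have hb : a + (h + h) = a + d by rewrite /h; field.
rewrite hb.
set J := expint k h in H1 H2 J1 *.
move: H1 H2 l2; rewrite -/(e _) -/(e _) -/(e _).
set A := mdist (g (a + d)) z; set B := mdist (g c) z; set C := mdist (g a) z.
move: (e z) (e (g (a + d))) (e (g c)) => ez eb ec H1 H2 l2.
have H3 : q ^+ 4 * (h * l ^+ 2) <= 2 * (ec - eb).
  have := ler_wpM2l (exprn_ge0 4 (ltW E0)) l2.
  have -> : q ^+ 4 * (2 * F * (ec - eb)) = (F * q ^+ 4) * (2 * (ec - eb)) by ring.
  by rewrite q4 mul1r.
have h2 : 0 <= q ^+ 4 * (h * l ^+ 2).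
  apply: mulr_ge0; [exact/exprn_ge0/ltW|apply: mulr_ge0; [exact: ltW|exact: sqr_ge0]].
have eceb : 0 <= 2 * (ec - eb) by exact: le_trans H3.
have hq : 0 <= h * q by apply: mulr_ge0; exact: ltW.
have H4 : h * q * (q ^+ 4 * (h * l ^+ 2)) <= J * (2 * (ec - eb)) by exact: ler_pM.
have H5 := ler_wpM2l (ltW E0) H1.
have H6 : q ^+ 6 * (h ^+ 2 * l ^+ 2) <= h * q * (q ^+ 4 * (h * l ^+ 2)).
  have -> : h * q * (q ^+ 4 * (h * l ^+ 2)) = q ^+ 5 * (h ^+ 2 * l ^+ 2) by ring.
  apply: ler_wpM2r; first by rewrite mulr_ge0// sqr_ge0.
  by rewrite [leLHS]exprS ler_piMl// exprn_ge0// ltW.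
lra.
Qed.

End evi_slope.

(** * Descending slope and its bounds *)

Section slope_bounds.
Context {R : realType} {X : metricType R}.
Variables (E : X -> \bar R) (k : R).
Hypothesis k0 : 0 < k.
Hypothesis E_gtNy : forall p, (-oo < E p)%E.

(** The quadratic term of [slope_bound] disappears in the limit of difference
    quotients. *)
Lemma slope_le_bound p l : (E p < +oo)%E -> slope_bound E k p l ->
  (slope E p <= l%:E)%E.
Proof.
move=> Ep [l0 lb]; rewrite /slope asboolF; last by apply; exact: Ep.
case: asboolP => _; first by rewrite lee_fin.
apply/lee_addgt0Pr => e e0; rewrite limf_esupE.
pose d := 2 * e / k; have d0 : 0 < d by rewrite divr_gt0// mulr_gt0.
pose A := [set z | z != p /\ mdist p z < d].
have FA : p^' A.
  have : \forall z \near p, z != p -> A z; last by [].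
  have := nbhsx_ballx p d d0; apply: filterS => z.
  by rewrite ballEmdist.
apply: (@le_trans _ _ (ereal_sup
  [set (maxe (E p - E z) 0 / (mdist p z)%:E)%E | z in A])).
  by apply: ereal_inf_lbound; exists A.
apply: ge_ereal_sup => _ [z [zp zd] <-].
have D0 : 0 < mdist p z by rewrite mdist_gt0 eq_sym.
rewrite inver gt_eqF//.
have [Ez|Ez] := ltP (E z) +oo%E; last first.
  have -> : E z = +oo%E by apply/eqP; rewrite -leye_eq.
  have -> : (maxe (E p - +oo) 0 = 0)%E.
    by rewrite addeNy; apply/max_idPr; rewrite leNye.
  by rewrite mul0e -EFinD lee_fin addr_ge0// ltW.
have Epf : E p \is a fin_num by rewrite fin_numElt E_gtNy.
have Ezf : E z \is a fin_num by rewrite fin_numElt E_gtNy.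
have := lb z Ez; rewrite -(fineK Epf) -(fineK Ezf) /= -EFinB -EFin_max -EFinM -EFinD.
set ep := fine (E p); set ez := fine (E z) => H; rewrite lee_fin.
rewrite ler_pdivrMr// ge_max; apply/andP; split; last first.
  by rewrite mulr_ge0 ?mdist_ge0// addr_ge0// ltW.
apply: le_trans H _; rewrite mulrDl lerD2l expr2 mulrA ler_pM2r//.
by have := ltW zd; rewrite /d ler_pdivlMr//; lra.
Qed.

Hypothesis E_lsc : lower_semicontinuous E.

(** The only term at [p'] that is not continuous is [E p'], and it is on the
    side where lower semicontinuity suffices. *)
Lemma slope_bound_closed p c : (E p < +oo)%E ->
  (forall d, 0 < d -> exists2 p', mdist p p' < d & (E p' < +oo)%E /\ slope_bound
    E k p' c) ->
  slope_bound E k p c.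
Proof.
move=> Ep H; have [p1 _ [_ [c0 _]]] := H 1 ltr01.
split=> // z Ez; rewrite leNgt; apply/negP.
set D := mdist p z; have D0 : 0 <= D by exact: mdist_ge0.
have Epf : E p \is a fin_num by rewrite fin_numElt E_gtNy.
set ep := fine (E p); set ez := fine (E z) => gap.
pose G := ep - ez - (c * D + k / 2 * D ^+ 2); have G0 : 0 < G by rewrite subr_gt0.
(* Moving [p] by [d <= 1] increases the right-hand side of [slope_bound] by
   less than [d * W]. *)
pose W := c + k / 2 * (2 * D + 1) + 1.
have W0 : 0 < W by rewrite ltr_pwDr// addr_ge0// mulr_ge0 ?addr_ge0 ?mulr_ge0//
  ltW// divr_gt0.
have lscp : ((ep - G / 2)%:E < E p)%E.
  by rewrite -[E p]fineK// lte_fin -/ep ltrBlDr ltrDl divr_gt0.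
have [V Vp VE] := E_lsc lscp.
have /nbhs_ballP[r /= r0 rV] := Vp.
pose d := Num.min (Num.min r 1) (G / 4 / W).
have d0 : 0 < d by rewrite !lt_min r0 ltr01 !divr_gt0.
have [p' p'd [Ep' [_ lb]]] := H d d0.
have := lb z Ez; rewrite -/ez; set D' := mdist p' z.
have D'D : D' <= D + d.
  by have := metric_triangle p' p z; rewrite (metric_sym p' p) -/D -/D'; lra.
have D'0 : 0 <= D' by exact: mdist_ge0.
have d1 : d <= 1 by rewrite !ge_min lexx orbT.
have dG : d * W <= G / 4 by rewrite -ler_pdivlMr// !ge_min lexx !orbT.
have Vp' : V p'.
  by apply: rV; rewrite ballEmdist /=; apply: lt_le_trans p'd _; rewrite !ge_min lexx.
have e1 : ep - G / 2 < fine (E p').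
  by rewrite -lte_fin fineK ?fin_numElt ?E_gtNy//; exact: VE.
move=> e2.
have h1 : c * D' <= c * (D + d) by exact: ler_wpM2l.
have h2 : D' ^+ 2 <= (D + d) ^+ 2 by rewrite ler_pXn2r// ?nnegrE// addr_ge0// ltW.
have k2 : 0 <= k / 2 by rewrite divr_ge0// ltW.
have h3 := ler_wpM2l k2 h2.
have h4 : (D + d) ^+ 2 <= D ^+ 2 + d * (2 * D + 1).
  have : d * d <= d * 1 by apply: ler_wpM2l => //; exact: ltW.
  by nra.
have h5 := ler_wpM2l k2 h4.
have h6 : d * W = c * d + k / 2 * (d * (2 * D + 1)) + d by rewrite /W; ring.
have h7 : G = ep - ez - (c * D + k / 2 * D ^+ 2) by [].
have : G < G by rewrite mulrDr in h5; rewrite mulrDr in h1; lra.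
by rewrite ltxx.
Qed.

End slope_bounds.

Section flow.
Context {R : realType} {X : metricType R}.
Variables (E : X -> \bar R) (k : R).
Hypothesis k0 : 0 < k.

Lemma cvg0_mdist (g : R -> X) p : g t @[t --> 0^'+] --> p -> forall e, 0 < e ->
  exists2 d, 0 < d & forall t, 0 < t -> t < d -> mdist p (g t) < e.
Proof.
move=> gp e e0; have := gp _ (nbhsx_ballx p e e0).
move=> [d /= d0 dP]; exists d => // t t0 td.
have := dP t; rewrite /= sub0r normrN gtr0_norm// => /(_ td t0).
by rewrite ballEmdist.
Qed.

(** The contraction estimate from time 0, where only convergence is known. *)
Lemma flow_contraction (g h : R -> X) p q t : evi_curve E k g -> evi_curve E k h ->
  g t @[t --> 0^'+] --> p -> h t @[t --> 0^'+] --> q -> 0 < t ->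
  mdist (g t) (h t) <= expR (k * t) * mdist p q.
Proof.
move=> gE hE gp hq t0; apply/ler_addgt0Pl => e e0.
set Q := expR (k * t); have Q0 : 0 < Q := expR_gt0 _.
have e1 : 0 < e / (2 * Q) by rewrite divr_gt0// mulr_gt0.
have [d1 d10 D1] := cvg0_mdist gp e1; have [d2 d20 D2] := cvg0_mdist hq e1.
pose s := Num.min (Num.min (d1 / 2) (d2 / 2)) t.
have s0 : 0 < s by rewrite !lt_min !divr_gt0.
have [sd1 sd2 st] : [/\ s < d1, s < d2 & s <= t].
  have : s <= d1 / 2 by rewrite !ge_min lexx.
  have : s <= d2 / 2 by rewrite !ge_min lexx orbT.
  have : s <= t by rewrite !ge_min lexx orbT.
  by move=> *; split; lra.
have := evi_contraction k0 gE hE s0 st.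
have : expR (k * (t - s)) <= Q by rewrite ler_expR ler_pM2l// lerBlDr lerDl ltW.
have x1 := D1 s s0 sd1; have x2 := D2 s s0 sd2.
have y0 : 0 <= mdist (g s) (h s) by exact: mdist_ge0.
have y1 : mdist (g s) (h s) <= mdist p q + e / Q.
  have := metric_triangle (g s) p (h s); have := metric_triangle p q (h s).
  rewrite (metric_sym (g s) p); have -> : e / Q = e / (2 * Q) + e / (2 * Q);
    last by lra.
  by field; rewrite gt_eqF.
move=> h1 h2; apply: le_trans h2 _; apply: (@le_trans _ _ (Q * (mdist p q + e / Q))).
  by apply: ler_pM => //; exact: expR_ge0.
by rewrite mulrDr mulrCA divff ?gt_eqF// mulr1 addrC.
Qed.

End flow.

(** * The recovery curve *)

Section recovery.
Context {R : realType} {X : metricType R}.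
Variables (E : X -> \bar R) (k : R).
Hypothesis k0 : 0 < k.
Variable S : R -> X -> X.
Hypothesis S_evi : forall p, evi_curve E k (S ^~ p).
Hypothesis S_cvg : forall p, S t p @[t --> 0^'+] --> p.
Let e p := fine (E p).
Variables (eta K : R) (eta0 : 0 < eta) (K0 : 0 < K).

Let c1 := expR (- k * K).
Let c2 := expR (- (3 * k) * K).
Let c3 := expR (k * K) * expR (k * (eta + K)) ^+ 2.

(** The step inequality for the flow of [q], tested against [S a p], followed
    by contraction for d(S_a q, S_a p), and multiplied by K / expint (K/N). The
    last factor lies between N and N exp(k K), which gives the constants. *)
Lemma recovery_cell (N : nat) (a : R) (p q : X) : (0 < N)%N ->
  0 < a -> a <= eta + K -> exists l, slope_bound E k (S (a + K / N%:R) q) l /\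
    c1 / 2 * (N%:R * mdist (S (a + K / N%:R) q) (S a p) ^+ 2) +
      c2 * K ^+ 2 / 8 * (N%:R^-1 * l ^+ 2) <=
    c3 / 2 * (N%:R * mdist q p ^+ 2) +
      K * (e (S a p) - e (S (a + K / N%:R) q)).
Proof.
move=> N0 a0 aK; set d := K / N%:R.
have Nr : 0 < N%:R :> R by rewrite ltr0n.
have N1 : 1 <= N%:R :> R by rewrite ler1n.
have d0 : 0 < d by rewrite divr_gt0.
have dN : d * N%:R = K by rewrite divfK ?gt_eqF.
have dK : d <= K by rewrite -dN ler_peMr// ltW.
have [pE _ _] := S_evi p.
have [l [lb H]] := evi_step k0 (S_evi q) a0 d0 (pE a a0).
exists l; split=> //; have C := flow_contraction k0 (S_evi q) (S_evi p)
  (@S_cvg q) (@S_cvg p) a0.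
move: H C; rewrite /e.
set x := mdist (S (a + d) q) _; set y := mdist (S a q) _; set z := mdist q p.
set ee := fine _ - fine _ => H C.
have y0 : 0 <= y by exact: mdist_ge0.
have z0 : 0 <= z by exact: mdist_ge0.
pose J := expint k d; have J0 : 0 < J by exact: expint_gt0.
have J1 : J <= d by apply: expint_le => //; exact: ltW.
have J2 : d * expR (- k * d) <= J by apply: expint_ge => //; exact: ltW.
(* With this factor the difference of energies has the same coefficient [K]
   in all cells and for all partitions. *)
pose w := K / J; have w0 : 0 < w by rewrite divr_gt0.
have wJ : w * J = K by rewrite divfK ?gt_eqF.
have Nw : N%:R <= w by rewrite ler_pdivlMr// -dN mulrC ler_pM2r.
have wN : w <= N%:R * expR (k * K).
  apply: (@le_trans _ _ (N%:R * expR (k * d))); last first.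
    by rewrite ler_pM2l// ler_expR ler_pM2l.
  have ed : expR (k * d) * expR (- k * d) = 1 by rewrite -expRD mulNr subrr expR0.
  have := ler_wpM2l (expR_ge0 (k * d)) J2; rewrite mulrCA ed mulr1 => dJ.
  rewrite ler_pdivrMr//; have := ler_wpM2l (ltW Nr) dJ; rewrite -/J; lra.
have H1 : w * (expR (- k * d) / 2 * x ^+ 2) +
    w * (expR (- (3 * k) * d) / 8 * d ^+ 2 * l ^+ 2) <=
    w * (y ^+ 2 / 2) + w * (expint k d * ee).
  by rewrite -!mulrDr; apply: ler_wpM2l => //; exact: ltW.
have E1 : c1 <= expR (- k * d) by rewrite ler_expR !mulNr lerN2 ler_pM2l.
have E2 : c2 <= expR (- (3 * k) * d).
  by rewrite ler_expR !mulNr lerN2 ler_pM2l// mulr_gt0.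
have c10 : 0 < c1 := expR_gt0 _. have c20 : 0 < c2 := expR_gt0 _.
have A1 : c1 / 2 * (N%:R * x ^+ 2) <= w * (expR (- k * d) / 2 * x ^+ 2).
  have -> : c1 / 2 * (N%:R * x ^+ 2) = (N%:R * c1) * (x ^+ 2 / 2) by field.
  have -> : w * (expR (- k * d) / 2 * x ^+ 2) = (w * expR (- k * d)) *
    (x ^+ 2 / 2) by field.
  apply: ler_wpM2r; first by rewrite divr_ge0 ?sqr_ge0.
  by apply: ler_pM => //; exact: ltW.
have A2 : c2 * K ^+ 2 / 8 * (N%:R^-1 * l ^+ 2) <=
    w * (expR (- (3 * k) * d) / 8 * d ^+ 2 * l ^+ 2).
  have -> : c2 * K ^+ 2 / 8 * (N%:R^-1 * l ^+ 2) = (N%:R * c2) *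
    (d ^+ 2 * l ^+ 2 / 8).
    by rewrite -dN; field; rewrite gt_eqF.
  have -> : w * (expR (- (3 * k) * d) / 8 * d ^+ 2 * l ^+ 2) =
    (w * expR (- (3 * k) * d)) * (d ^+ 2 * l ^+ 2 / 8) by field.
  apply: ler_wpM2r; first by rewrite divr_ge0// mulr_ge0 ?sqr_ge0.
  by apply: ler_pM => //; exact: ltW.
have A3 : w * (y ^+ 2 / 2) <= c3 / 2 * (N%:R * z ^+ 2).
  have G1 : expR (k * a) <= expR (k * (eta + K)) by rewrite ler_expR ler_pM2l.
  have yz : y <= expR (k * (eta + K)) * z.
    by apply: le_trans C _; exact: ler_wpM2r.
  have y2 : y ^+ 2 <= (expR (k * (eta + K)) * z) ^+ 2.
    by rewrite ler_pXn2r// ?nnegrE// mulr_ge0// expR_ge0.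
  have -> : c3 / 2 * (N%:R * z ^+ 2) =
    (N%:R * expR (k * K)) * ((expR (k * (eta + K)) * z) ^+ 2 / 2)
      by rewrite /c3; field.
  apply: ler_pM => //; [exact: ltW|by rewrite divr_ge0 ?sqr_ge0|].
  by rewrite ler_pM2r.
have A4 : w * (expint k d * ee) = K * ee by rewrite mulrA wJ.
by rewrite A4 in H1; lra.
Qed.

(** Waiting time along the flow: at least [eta], so that the energy is finite
    everywhere, and changing at the constant rate [K], so that each cell of a
      partition
    provides a time step to regularize. *)
Definition height (t : R) := eta + K * Num.min t (1 - t).
Definition flow_curve (v : R -> X) (t : R) := S (height t) (v t).

Lemma height_gt0 t : 0 <= t -> t <= 1 -> 0 < height t.
Proof.
by move=> t0 t1; rewrite ltr_pwDl//; apply: mulr_ge0;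
  [exact: ltW|rewrite le_min t0 subr_ge0].
Qed.

Lemma height_le t : 0 <= t -> t <= 1 -> height t <= eta + K.
Proof.
by move=> t0 t1; rewrite lerD2l ger_pMr// ge_min t1.
Qed.

Lemma knot_half (M : nat) : (0 < M)%N -> knot (M * 2) M = 2^-1 :> R.
Proof.
move=> M0; rewrite /knot natrM invfM mulrA divff ?mul1r//.
by rewrite pnatr_eq0 -lt0n.
Qed.

Lemma height_up (M i : nat) : (i < M)%N ->
  height (knot (M * 2) i.+1) = height (knot (M * 2) i) + K / (M * 2)%:R.
Proof.
move=> iM; have M0 : (0 < M)%N by exact: leq_ltn_trans iM.
have kB := knotB (R := R) (M * 2) i.
have h1 : knot (M * 2) i.+1 <= 2^-1 :> R by rewrite -(knot_half M0) knot_le.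
have h2 : knot (M * 2) i <= 2^-1 :> R by rewrite -(knot_half M0) knot_le// ltnW.
rewrite /height !(min_idPl _); [|lra|lra].
by rewrite (_ : knot _ i.+1 = knot (M * 2) i + (M * 2)%:R^-1); [ring|lra].
Qed.

Lemma height_down (M i : nat) : (0 < M)%N -> (M <= i)%N ->
  height (knot (M * 2) i) = height (knot (M * 2) i.+1) + K / (M * 2)%:R.
Proof.
move=> M0 Mi; have kB := knotB (R := R) (M * 2) i.
have h1 : 2^-1 <= knot (M * 2) i.+1 :> R.
  by rewrite -(knot_half M0) knot_le// leqW.
have h2 : 2^-1 <= knot (M * 2) i :> R by rewrite -(knot_half M0) knot_le.
rewrite /height !(min_idPr _); [|lra|lra].
by rewrite (_ : knot _ i.+1 = knot (M * 2) i + (M * 2)%:R^-1); [ring|lra].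
Qed.

(** In the first half the height increases with time, and the cell inequality
    is applied from the left knot to the right one; in the second half from
    right to left. The slope is controlled at
    the end of the cell where the height is larger. *)
Lemma recovery_sum (v : R -> X) (M : nat) : (0 < M)%N ->
  let u := flow_curve v in let N := (M * 2)%N in
  exists w : nat -> R,
    (forall i, (i < N)%N -> slope_bound E k (u (knot N i)) (w i) \/
                            slope_bound E k (u (knot N i.+1)) (w i)) /\
    c1 / 2 * energy u N + c2 * K ^+ 2 / 8 * (\sum_(i < N) N%:R^-1 * w i ^+ 2) <=
    c3 / 2 * energy v N + K * (e (u 0) + e (u 1) - 2 * e (u 2^-1)).
Proof.
move=> M0 u N; have N0 : (0 < N)%N by rewrite muln_gt0 M0.
pose f i := e (u (knot N i)).
pose df i := if (i < M)%N then f i - f i.+1 else f i.+1 - f i.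
pose V i := N%:R * mdist (v (knot N i)) (v (knot N i.+1)) ^+ 2.
pose U i := N%:R * mdist (u (knot N i)) (u (knot N i.+1)) ^+ 2.
have hk i : (i <= N)%N -> 0 < height (knot N i) /\ height (knot N i) <= eta + K.
  by move=> iN; split; [apply: height_gt0|apply: height_le];
    rewrite ?knot_ge0 ?knot_le1.
have cell i : exists l, (i < N)%N ->
    (slope_bound E k (u (knot N i)) l \/ slope_bound E k (u (knot N i.+1)) l) /\
    c1 / 2 * U i + c2 * K ^+ 2 / 8 * (N%:R^-1 * l ^+ 2) <= c3 / 2 * V i + K * df i.
  have [iN|] := ltnP i N; last by exists 0.
  rewrite /df /f; case: ltnP => iM.
    have [h1 h2] := hk i (ltnW iN).
    have := @recovery_cell N (height (knot N i)) (v (knot N i))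
      (v (knot N i.+1)) N0 h1 h2.
    rewrite -(height_up iM) => -[l [lb H]]; exists l => _; split; first by right.
    by move: H; rewrite /U /V /u /flow_curve (metric_sym (v (knot N i)))
      [mdist (S _ _) _]metric_sym.
  have [h1 h2] := hk i.+1 iN.
  have := @recovery_cell N (height (knot N i.+1)) (v (knot N i.+1))
    (v (knot N i)) N0 h1 h2.
  by rewrite -(height_down M0 iM) => -[l [lb H]]; exists l => _; split; [left|].
have [w wP] := choice cell.
exists w; split; first by move=> i iN; have [] := wP i iN.
have -> : e (u 0) + e (u 1) - 2 * e (u 2^-1) = \sum_(i < N) df i.
  have -> : u 0 = u (knot N 0) by rewrite knot0.
  have -> : u 1 = u (knot N N) by rewrite knotN.
  have -> : u 2^-1 = u (knot N M) by rewrite knot_half.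
  rewrite -(big_mkord xpredT df) (@big_cat_nat _ _ _ M)//=; last by rewrite leq_pmulr.
  rewrite (@eq_big_nat _ _ _ 0 M df (fun i => - (f i.+1 - f i))); last first.
    by move=> i /andP[_ iM]; rewrite /df iM opprB.
  rewrite (@eq_big_nat _ _ _ M N df (fun i => f i.+1 - f i)); last first.
    by move=> i /andP[Mi _]; rewrite /df ltnNge Mi.
  rewrite sumrN !telescope_sumr//; last by rewrite leq_pmulr.
  by rewrite /f; ring.
rewrite /energy !mulr_sumr -!big_split/=; apply: ler_sum => i _.
by have [_] := wP i (ltn_ord i).
Qed.

End recovery.

Lemma limn_einf_scale (R : realType) (r : nat -> R) (a : R) (y : \bar R) :
  0 < a -> (y <= limn_einf (fun n => (r n)%:E))%E ->
  (a%:E * y <= limn_einf (fun n => (a * r n)%:E))%E.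
Proof.
move=> a0 yr; apply: limn_einf_ge => c cay.
have : ((a^-1 * c)%:E < limn_einf (fun n => (r n)%:E))%E.
  apply: lt_le_trans yr; rewrite -(@lte_pmul2l _ a%:E)// -EFinM.
  by rewrite mulrA divff ?mul1r// gt_eqF.
move=> /limn_einf_near; apply: filterS => n; rewrite lte_fin lee_fin => /ltW.
by rewrite ler_pdivrMl.
Qed.

Lemma limn_einf_shiftS (R : realType) (u : nat -> \bar R) :
  (limn_einf u <= limn_einf (fun n => u n.+1))%E.
Proof.
apply: limn_einf_ge => c /limn_einf_near[N _ NP]; exists N => // n /= Nn.
by apply/ltW/NP => /=; exact: leqW.
Qed.

Section recovery_bound.
Context {R : realType} {X : metricType R}.
Notation mu := (@lebesgue_measure R).
Variables (E : X -> \bar R) (k : R).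
Hypothesis k0 : 0 < k.
Hypothesis E_gtNy : forall p, (-oo < E p)%E.
Hypothesis E_lsc : lower_semicontinuous E.
Variable S : R -> X -> X.
Hypothesis S_evi : forall p, evi_curve E k (S ^~ p).
Hypothesis S_AC : forall p, AC_loc_pos (S ^~ p).
Hypothesis S_cvg : forall p, S t p @[t --> 0^'+] --> p.
Let e p := fine (E p).
Variables (eta K : R) (eta0 : 0 < eta) (K0 : 0 < K).
Variable v : R -> X.
Hypothesis vC : C01 v.
Let u := flow_curve S eta K v.

(** Continuity in the waiting time for a fixed starting point, combined with
    contraction between starting points. *)
Lemma flow_curve_near t : 0 <= t -> t <= 1 -> forall d, 0 < d ->
  exists2 r, 0 < r & forall x, 0 <= x -> x <= 1 -> `|x - t| < r ->
    mdist (u t) (u x) < d.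
Proof.
move=> t0 t1 d d0; pose Q := expR (k * (eta + K)).
have Q0 : 0 < Q := expR_gt0 _.
have d2 : 0 < d / 2 by rewrite divr_gt0.
have dQ : 0 < d / 2 / Q by rewrite divr_gt0.
have h0 := height_gt0 eta0 K0 t0 t1.
have [r1 r10 R1] := AC_loc_pos_continuous (@S_AC (v t)) h0 d2.
have [r2 r20 R2] := C01_near vC t0 t1 dQ.
exists (Num.min (r1 / K) r2); first by rewrite lt_min divr_gt0.
move=> x x0 x1; rewrite lt_min => /andP[]; rewrite ltr_pdivlMr// => xr1 xr2.
have hx0 := height_gt0 eta0 K0 x0 x1; have hxK := height_le eta K0 x0 x1.
have hxt : `|height eta K x - height eta K t| <= `|x - t| * K.
  rewrite /height opprD addrACA subrr add0r -mulrBr normrM gtr0_norm//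
    mulrC ler_pM2r//.
  by rewrite !minEle; case: ifP => h1; case: ifP => h2 //;
    rewrite ler_norml; move: h1 h2; have := ler_norm (x - t);
    have := ler_norm (t - x); rewrite (distrC t x); lra.
have A1 := R1 _ (le_lt_trans hxt xr1).
have A2 := flow_contraction k0 (S_evi (v t)) (S_evi (v x)) (@S_cvg (v t))
  (@S_cvg (v x)) hx0.
have A3 := R2 x x0 x1 xr2.
have A4 : expR (k * height eta K x) * mdist (v t) (v x) < d / 2.
  apply: (@le_lt_trans _ _ (Q * mdist (v t) (v x))).
    by apply: ler_wpM2r; [exact: mdist_ge0|rewrite ler_expR ler_pM2l].
  by rewrite mulrC -ltr_pdivlMr.
have := metric_triangle (u t) (S (height eta K x) (v t)) (u x).
by rewrite /u /flow_curve; lra.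
Qed.

Lemma flow_curve_C01 : C01 u.
Proof.
apply/subspace_continuousP => t; rewrite /= in_itv/= => /andP[t0 t1].
move=> V /nbhs_ballP[d /= d0 dV].
have [r r0 rP] := flow_curve_near t0 t1 d0.
exists r => //= x; rewrite /= distrC => xr; rewrite in_itv/= => /andP[x0 x1].
by apply: dV; rewrite ballEmdist; exact: rP.
Qed.

Lemma slope_bound_le p l l' : l <= l' -> slope_bound E k p l -> slope_bound E k p l'.
Proof.
move=> ll' [l0 lb]; split; first exact: le_trans ll'.
by move=> z /lb /le_trans; apply; rewrite lerD2r; apply: ler_wpM2r => //;
  exact: mdist_ge0.
Qed.

Lemma flow_curve_fin t : 0 <= t -> t <= 1 -> (E (u t) < +oo)%E.
Proof. by move=> t0 t1; have [H _ _] := S_evi (v t); exact/H/height_gt0. Qed.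

(** If the step functions stay below [c] infinitely often at [t], then
    [slope_bound] holds with the square root of [c] at knots tending to [t],
    hence at [u t]. *)
Lemma sq_slope_le_liminf (W : nat -> nat -> R) (t : R) : 0 < t -> t < 1 ->
  (forall n i, (i < 2 ^ n * 2)%N -> slope_bound E k (u (knot (2 ^ n * 2) i))
    (W n i) \/
     slope_bound E k (u (knot (2 ^ n * 2) i.+1)) (W n i)) ->
  (slope E (u t) ^+ 2 <=
     limn_einf (fun n => (step (2 ^ n * 2) (fun i => W n i ^+ 2) t)%:E))%E.
Proof.
move=> t0 t1 WP; rewrite leNgt; apply/negP => /lte_real_between[c c1 c2].
have c0 : 0 <= c.
  rewrite -lee_fin; apply/ltW; apply: le_lt_trans c1.
  apply: limn_einf_ge => x; rewrite lte_fin => x0; exists 0%N => // n _ /=.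
  by rewrite lee_fin; apply: le_trans (ltW x0) _; apply: step_ge0 => i;
    exact: sqr_ge0.
pose l := Num.sqrt c; have l0 : 0 <= l := sqrtr_ge0 _.
have l2 : l ^+ 2 = c by rewrite sqr_sqrtr.
have ufin := flow_curve_fin (ltW t0) (ltW t1).
have lb : slope_bound E k (u t) l.
  apply: slope_bound_closed => // d d0.
  have [r r0 rP] := flow_curve_near (ltW t0) (ltW t1) d0.
  have [n0 _ n0P] := dyadic_small r0.
  have [n n0n nc] := limn_einf_lt_frequently c1 n0.
  set N := (2 ^ n * 2)%N in nc.
  have NE : N = (2 ^ n.+1)%N by rewrite expnSr.
  have N0 : (0 < N)%N by rewrite NE expn_gt0.
  have Nr := n0P n.+1 (leqW n0n); rewrite /= -NE in Nr.
  have [i [it ti]] := knot_index N0 t0 (ltW t1).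
  move: nc; rewrite lte_fin (stepE _ it ti) => Wc.
  have kB := knotB (R := R) N i.
  have wl x : slope_bound E k x (W n i) -> slope_bound E k x l.
    move=> xb; have [w0 _] := xb; apply: slope_bound_le xb.
    by rewrite -(@ler_pXn2r _ 2)// ?nnegrE// l2 ltW.
  have iN : (i < N)%N by [].
  have [b|b] := WP n i iN; [exists (u (knot N i))|exists (u (knot N i.+1))].
  - by apply: rP; rewrite ?knot_ge0 ?knot_le1 ?(ltnW iN)// distrC ger0_norm; lra.
  - by split; [apply: flow_curve_fin;
      rewrite ?knot_ge0 ?knot_le1 ?(ltnW iN)|exact: wl].
  - by apply: rP; rewrite ?knot_ge0 ?knot_le1// ger0_norm; lra.
  - by split; [apply: flow_curve_fin; rewrite ?knot_ge0 ?knot_le1|exact: wl].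
have := slope_le_bound k0 E_gtNy ufin lb => sl.
move: c2; apply/negP; rewrite -leNgt -l2 expr2 expe2 EFinM.
by apply: lee_pmul => //; exact: slope_ge0.
Qed.

Variable A : R.
Hypothesis vA : action v = A%:E.

Let c1 := expR (- k * K).
Let c2 := expR (- (3 * k) * K).
Let c3 := expR (k * K) * expR (k * (eta + K)) ^+ 2.
Let C := c3 * A + K * (e (u 0) + e (u 1) - 2 * e (u 2^-1)).

(** The limit of [recovery_sum] over the dyadic partitions. The bound first
    shows that the energies of [u] are bounded, so that [u] is absolutely
    continuous. *)
Lemma recovery_bound :
  (c1%:E * action u + (c2 * K ^+ 2 / 4)%:E * slope_action E u <= C%:E)%E.
Proof.
have c10 : 0 < c1 := expR_gt0 _.
have c20 : 0 < c2 := expR_gt0 _.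
have [W WP] := choice (fun n => recovery_sum k0 S_evi S_cvg eta0 K0 v
  (M := 2 ^ n) (ltac:(by rewrite expn_gt0) : (0 < 2 ^ n)%N)).
have W1 n i := (WP n).1 i.
pose Sg n := \sum_(i < 2 ^ n * 2) (2 ^ n * 2)%N%:R^-1 * W n i ^+ 2.
have vE N : (0 < N)%N -> energy v N <= 2 * A.
  by move=> N0; have := energy_le_action v N0; rewrite vA -EFinM lee_fin.
have c3_0 : 0 <= c3 by rewrite mulr_ge0 ?exprn_ge0 ?expR_ge0.
have W2 n : c1 / 2 * energy u (2 ^ n.+1) + c2 * K ^+ 2 / 8 * Sg n <= C.
  have := (WP n).2; rewrite -/c1 -/c2 -/c3 -/(Sg n) -expnSr => H; apply: le_trans H _.
  rewrite lerD2r; have := ler_wpM2l c3_0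
    (vE (2 ^ n.+1)%N ltac:(by rewrite expn_gt0)); lra.
have Sg0 n : 0 <= Sg n.
  by apply: sumr_ge0 => i _; rewrite mulr_ge0 ?invr_ge0// sqr_ge0.
have cK : 0 < c2 * K ^+ 2 / 8 by rewrite divr_gt0// mulr_gt0// exprn_gt0.
have uK n : energy u (2 ^ n) <= 2 * C / c1.
  have : energy u (2 ^ n) <= energy u (2 ^ n.+1).
    by rewrite expnSr; apply: energy_le_mul; rewrite ?expn_gt0.
  move=> /le_trans; apply; rewrite ler_pdivlMr//.
  have := W2 n; have : 0 <= c2 * K ^+ 2 / 8 * Sg n by rewrite mulr_ge0// ltW.
  lra.
have uAC := AC_of_energy flow_curve_C01 uK.
apply: (@ge0_limn_einf_add_le _ (fun n => (c1 / 2 * energy u (2 ^ n.+1))%:E)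
    (fun n => (c2 * K ^+ 2 / 8 * Sg n)%:E)).
- by rewrite mule_ge0 ?action_ge0// lee_fin ltW.
- by rewrite mule_ge0 ?slope_action_ge0// lee_fin; lra.
- have -> : (c1%:E * action u = (c1 / 2)%:E * (2%:E * action u))%E.
    by rewrite muleA -EFinM divfK.
  apply: limn_einf_scale; first by rewrite divr_gt0.
  apply: le_trans (action_le_energy uAC) _.
  exact: (limn_einf_shiftS (fun n => (energy u (2 ^ n))%:E)).
- have -> : ((c2 * K ^+ 2 / 4)%:E * slope_action E u = (c2 * K ^+ 2 / 8)%:E *
      \int[mu]_(t in `]0%R, 1%R[) (slope E (u t)) ^+ 2)%E.
    by rewrite /slope_action muleA -EFinM; congr (_%:E * _)%E; field.
  apply: limn_einf_scale => //.
  pose st n t := (step (2 ^ n * 2) (fun i => W n i ^+ 2) t)%:E.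
  have st0 n t : (0 <= st n t)%E.
    by rewrite lee_fin; apply: step_ge0 => i; exact: sqr_ge0.
  have mst n : measurable_fun (`]0%R, 1%R] : set R) (st n).
    by apply/measurable_EFinP; apply: measurable_funTS; exact: measurable_step.
  have -> : (fun n => (Sg n)%:E) = (fun n => \int[mu]_(t in `]0%R, 1%R]) st n t)%E.
    apply/funext => n; rewrite integral_step ?muln_gt0 ?expn_gt0//.
    by move=> i; exact: sqr_ge0.
  have := fatou mu (measurable_itv `]0, 1]) mst (fun n t _ => st0 n t).
  apply: le_trans.
  have mli : measurable_fun (`]0%R, 1%R] : set R)
    (fun t => limn_einf (fun n => st n t)).
    exact: measurable_fun_limn_einf.
  have mli' : measurable_fun (`]0%R, 1%R[ : set R)
    (fun t => limn_einf (fun n => st n t)).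
    by apply: measurable_funS mli => //; apply: subset_itv; rewrite bnd_simp.
  rewrite -(@integral_itv_bndo_bndc R (BRight 0) 1
    (fun t => limn_einf (fun n => st n t)))//.
  apply: ge0_le_integralW; first by move=> t _; exact: sq_slope_ge0.
  by move=> t; rewrite /= in_itv/= => /andP[t0 t1]; exact: sq_slope_le_liminf.
- by move=> n; rewrite lee_fin; apply: mulr_ge0;
    [rewrite divr_ge0// ltW|exact: energy_ge0].
- by move=> n; rewrite lee_fin; apply: mulr_ge0 => //; exact: ltW.
- by apply: nearW => n; rewrite -EFinD lee_fin.
Qed.

End recovery_bound.

(** * Convergence of points and curves *)

Section convergences.
Context {R : realType} {X : metricType R}.

Lemma cvg_mdistP (a : nat -> X) (p : X) : a @ \oo --> p <->
  (forall e, 0 < e -> \forall n \near \oo, mdist p (a n) < e).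
Proof.
split=> [ap e e0|H V /nbhs_ballP[e /= e0 eV]].
  have := ap _ (nbhsx_ballx p e e0); rewrite /= => -[N _ NP]; exists N => // n Nn.
  by have := NP n Nn; rewrite /= ballEmdist.
have := H e e0; rewrite /= => -[N _ NP]; exists N => // n Nn.
by apply: eV; rewrite ballEmdist; exact: NP.
Qed.

Lemma uniform_cvg01P (u : nat -> R -> X) (v : R -> X) : uniform_cvg01 u v <->
  (forall e, 0 < e -> \forall n \near \oo, forall t, 0 <= t <= 1 ->
     mdist (v t) (u n t) < e).
Proof.
split=> [uv e e0|H P /uniform_nbhs[F [+ FP]]].
  have : nbhs (v : {uniform` `[0, 1] -> X})
      [set h | forall t, `[0, 1]%classic t -> ball (v t) e (h t)].
    apply/uniform_nbhs; exists [set xy | ball xy.1 e xy.2]; split=> //.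
    exact: entourage_ball (PosNum e0).
  move=> /uv[N _ NP]; exists N => // n Nn t t01.
  by have := NP n Nn t; rewrite /= in_itv/= ballEmdist; apply.
rewrite -entourage_from_ballE => -[e /= e0 eF].
have := H e e0; rewrite /= => -[N _ NP]; exists N => // n Nn.
apply: FP => t; rewrite /= in_itv/= => t01; apply: eF => /=.
by rewrite ballEmdist; exact: NP.
Qed.

Lemma mdist_lsc (a b : nat -> X) (p q : X) : a @ \oo --> p -> b @ \oo --> q ->
  ((mdist p q)%:E <= limn_einf (fun n => (mdist (a n) (b n))%:E))%E.
Proof.
move=> /cvg_mdistP ap /cvg_mdistP bq; apply: limn_einf_ge => c;
  rewrite lte_fin => cpq.
have e0 : 0 < (mdist p q - c) / 2 by rewrite divr_gt0// subr_gt0.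
have := bq _ e0; move: (ap _ e0); apply: filterS2 => n h1 h2; rewrite lee_fin.
have := metric_triangle p (a n) q; have := metric_triangle (a n) (b n) q.
by rewrite (metric_sym (b n)); lra.
Qed.

(** A sequence that converges in distance but stays outside a
    sigma-neighbourhood of the limit would have a sigma-convergent subsequence
    by boundedness, and the lower semicontinuity of the distance identifies
    its limit. *)
Lemma sigma_cvg_of_mdist (E : X -> \bar R) (sigma : Topological X) (a : nat -> X) p :
  assumption_S E sigma -> a @ \oo --> p -> sigma_cvg sigma a p.
Proof.
move=> HS /cvg_mdistP ap V Vp; apply: contrapT => nV.
have far N : exists n, [/\ (N <= n)%N, mdist p (a n) < N.+1%:R^-1 & ~ V (a n)].
  have N0 : 0 < N.+1%:R^-1 :> R by rewrite invr_gt0.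
  have [M _ MP] := ap _ N0; apply: contrapT => nex; apply: nV.
  exists (maxn N M) => // n /=; rewrite geq_max => /andP[Nn Mn].
  by apply: contrapT => nVn; apply: nex; exists n; split=> //; exact: MP.
have [psi psiP] := choice far.
pose b := a \o psi.
have bp : b @ \oo --> p.
  apply/cvg_mdistP => e e0; have [k kd] := ltr_add_invr e0.
  exists k => // n /= kn; have [_ h _] := psiP n; apply: lt_trans h _.
  by apply: le_lt_trans kd; rewrite add0r lef_pV2 ?posrE ?ltr0n// ler_nat.
have bB : mdist_bounded (range b).
  exists 2 => _ _ [i _ <-] [j _ <-].
  have [_ h1 _] := psiP i; have [_ h2 _] := psiP j.
  have i1 : i.+1%:R^-1 <= 1 :> R by rewrite invf_le1// ler1n.
  have j1 : j.+1%:R^-1 <= 1 :> R by rewrite invf_le1// ler1n.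
  change (is_true (mdist p (b i) < i.+1%:R^-1)) in h1;
    change (is_true (mdist p (b j) < j.+1%:R^-1)) in h2.
  have g1 := lt_le_trans h1 i1; have g2 := lt_le_trans h2 j1.
  have g3 := metric_triangle (b i) p (b j); rewrite (metric_sym (b i) p) in g3.
  by apply: le_trans g3 _; have := lerD (ltW g1) (ltW g2).
have [phi [l [phiS bl]]] := sigma_compact HS bB.
have cp : sigma_cvg sigma (fun _ => p) p by exact: cvg_cst.
have := sigma_lsc_mdist HS bl cp.
have phile n : (n <= phi n)%N.
  by elim: n => // n IH; apply: leq_ltn_trans IH (phiS _ _ (ltnSn n)).
have -> : limn_einf (fun n => (mdist ((b \o phi) n) p)%:E) = 0%E.
  apply/eqP; rewrite eq_le; apply/andP; split; last first.
    by apply: limn_einf_ge => c c0; exists 0%N => // n _ /=;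
      apply: le_trans (ltW c0) _; rewrite lee_fin mdist_ge0.
  rewrite leNgt; apply/negP => /lte_real_between[c c0 cl].
  have [N1 _ N1P] := limn_einf_near cl.
  rewrite lte_fin in c0; have /cvg_mdistP/(_ c c0)[N2 _ N2P] := bp.
  have := N1P (maxn N1 N2) (leq_maxl _ _).
  have := N2P (phi (maxn N1 N2)) (leq_trans (leq_maxr _ _) (phile _)).
  by rewrite /= lte_fin metric_sym => h1 h2; have := lt_trans h1 h2; rewrite ltxx.
rewrite lee_fin => lp0; have lp : l = p.
  by apply: mdist_positivity; apply/eqP; rewrite eq_le lp0 mdist_ge0.
rewrite lp in bl; have [N _ NP] := bl _ Vp.
by have := NP N (leqnn N); have [_ _] := psiP (phi N).
Qed.

End convergences.

Section flow_uniform.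
Context {R : realType} {X : metricType R}.
Variables (E : X -> \bar R) (k : R).
Hypothesis k0 : 0 < k.
Variable S : R -> X -> X.
Hypothesis S_evi : forall p, evi_curve E k (S ^~ p).
Hypothesis S_cvg : forall p, S t p @[t --> 0^'+] --> p.

(** At finitely many knots the flow is close to the identity for short times;
    every point of the curve is close to one of the knots by Hoelder
    continuity, and stays close under the flow by contraction. *)
Lemma flow_small_time (v : R -> X) A : action v = A%:E -> forall e, 0 < e ->
  exists2 h0, 0 < h0 & forall h t, 0 < h -> h < h0 -> 0 <= t <= 1 ->
    mdist (v t) (S h (v t)) < e.
Proof.
move=> vA e e0; pose Q := expR k; have Q0 : 0 < Q := expR_gt0 _.
pose r := e / (2 * (Q + 1)); have r0 : 0 < r by rewrite divr_gt0// mulr_gt0//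
  ltr_wpDr.
have A0 : 0 <= A by rewrite -lee_fin -vA action_ge0.
have [n _ nP] := dyadic_small (R := R) (d := r ^+ 2 / (2 * A + 1))
  (ltac:(by rewrite divr_gt0 ?exprn_gt0// ltr_wpDl// mulr_ge0)).
set N := (2 ^ n)%N in nP; have N0 : (0 < N)%N by rewrite expn_gt0.
have Nr := nP n (leqnn n); rewrite /= -/N in Nr.
have e2 : 0 < e / 2 by rewrite divr_gt0.
have [h1 h10 h1P] : exists2 h1, 0 < h1 & forall i h, (i <= N)%N -> 0 < h -> h < h1 ->
    mdist (v (knot N i)) (S h (v (knot N i))) < e / 2.
  have : forall m, exists2 h1, 0 < h1 & forall i h, (i < m)%N -> 0 < h -> h < h1 ->
      mdist (v (knot N i)) (S h (v (knot N i))) < e / 2.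
    elim=> [|m [h1 h10 IH]]; first by exists 1.
    have [d d0 dP] := cvg0_mdist (@S_cvg (v (knot N m))) e2.
    exists (Num.min h1 d); first by rewrite lt_min h10.
    move=> i h; rewrite ltnS leq_eqVlt lt_min => /predU1P[->|im] hh /andP[hh1 hd].
      exact: dP.
    exact: IH.
  by move=> /(_ N.+1)[h1 h10 h1P]; exists h1 => // i h iN; apply: h1P.
exists (Num.min h1 1); first by rewrite lt_min h10 ltr01.
move=> h t hh; rewrite lt_min => /andP[hh1 hle1] /andP[t0 t1].
have [i [iN tip]] : exists i, (i <= N)%N /\ mdist (v t) (v (knot N i)) < r.
  move: t0; rewrite le_eqVlt => /predU1P[<-|t0].
    by exists 0%N; rewrite knot0 mdistxx.
  have [i [it ti]] := knot_index N0 t0 t1; exists i.+1; split; first by [].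
  have kB := knotB (R := R) N i.
  have := sq_mdist_le_action v (ltW t0) ti (knot_le1 (ltn_ord i)).
  rewrite vA -!EFinM lee_fin => H.
  rewrite -(@ltr_pXn2r _ 2)// ?nnegrE ?mdist_ge0 ?ltW//.
  apply: le_lt_trans H _; apply: (@le_lt_trans _ _ (N%:R^-1 * (2 * A))).
    by apply: ler_wpM2r; [rewrite mulr_ge0|lra].
  have A1 : 0 < 2 * A + 1 by rewrite ltr_wpDl// mulr_ge0.
  move: Nr; rewrite ltr_pdivlMr// => Nr.
  apply: le_lt_trans Nr; apply: ler_wpM2l; first by rewrite invr_ge0.
  by rewrite lerDl.
set p := v (knot N i) in tip.
have C := flow_contraction k0 (S_evi p) (S_evi (v t)) (@S_cvg p) (@S_cvg (v t)) hh.
have P := h1P i h iN hh hh1; rewrite -/p in P.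
have Ch : expR (k * h) <= Q by rewrite ler_expR ger_pMr// ltW.
have C2 : mdist (S h p) (S h (v t)) <= Q * r.
  apply: le_trans C _; apply: ler_pM; rewrite ?expR_ge0 ?mdist_ge0//.
  by rewrite metric_sym ltW.
have rE : Q * r + r = e / 2.
  by rewrite /r; field; rewrite gt_eqF// ltr_wpDr.
have := metric_triangle (v t) p (S h (v t));
  have := metric_triangle p (S h p) (S h (v t)).
lra.
Qed.

End flow_uniform.

(** * Gamma-convergence *)

Section recovery_sequence.
Context {R : realType} {X : metricType R}.
Variables (E : X -> \bar R) (k : R).
Hypothesis k0 : 0 < k.
Hypothesis E_gtNy : forall p, (-oo < E p)%E.
Hypothesis E_lsc : lower_semicontinuous E.
Hypothesis E_bounded_below : bounded_below_on_bounded E.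
Variable S : R -> X -> X.
Hypothesis S_evi : forall p, evi_curve E k (S ^~ p).
Hypothesis S_AC : forall p, AC_loc_pos (S ^~ p).
Hypothesis S_cvg : forall p, S t p @[t --> 0^'+] --> p.
Variables (x y : X) (eps eta : nat -> R).
Hypothesis eps_gt0 : forall n, 0 < eps n.
Hypothesis eps_cvg0 : eps @ \oo --> (0 : R).
Hypothesis eta_gt0 : forall n, 0 < eta n.
Hypothesis eta_cvg0 : eta @ \oo --> (0 : R).
Hypothesis eta_slow : ((eps n)%:E * (E (S (eta n) x) + E (S (eta n) y)))%E
                  @[n --> \oo] --> (0 : \bar R)%E.

Let F n g := (perturbed_action E (eps n) g
                 + endpoint_indicator (S (eta n) x) (S (eta n) y) g)%E.

Lemma flow_start_cvg p : (S (eta n) p) @[n --> \oo] --> p.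
Proof.
apply/cvg_mdistP => e e0; have [d d0 dP] := cvg0_mdist (@S_cvg p) e0.
have /cvgrPdist_lt/(_ d d0) := eta_cvg0; apply: filterS => n.
by rewrite sub0r normrN gtr0_norm// => h; exact: dP.
Qed.

Section finite_action.
Variables (v : R -> X) (A : R).
Hypothesis vC : C01 v.
Hypothesis vA : action v = A%:E.
Hypothesis v0 : v 0 = x.
Hypothesis v1 : v 1 = y.

(* For [K = 2 * eps n] the coefficient [K^2 / 4] of the slope action in
   [recovery_bound] is [eps n ^ 2]. *)
Let u n := flow_curve S (eta n) (2 * eps n) v.

Let K0 n : 0 < 2 * eps n. Proof. by rewrite mulr_gt0. Qed.

Lemma recovery_uniform e : 0 < e -> \forall n \near \oo, forall t, 0 <= t <= 1 ->
  mdist (v t) (u n t) < e.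
Proof.
move=> e0; have [h0 h00 hP] := flow_small_time k0 S_evi S_cvg vA e0.
have h2 : 0 < h0 / 2 by rewrite divr_gt0.
have h4 : 0 < h0 / 4 by rewrite divr_gt0.
have /cvgrPdist_lt/(_ _ h2) := eta_cvg0; have /cvgrPdist_lt/(_ _ h4) := eps_cvg0.
apply: filterS2 => n; rewrite !sub0r !normrN !gtr0_norm// => e1 e2 t t01.
have /andP[t0 t1] := t01; apply: hP => //; first exact: height_gt0.
by have := height_le (eta n) (K0 n) t0 t1; lra.
Qed.

Lemma recovery_ends n : u n 0 = S (eta n) x /\ u n 1 = S (eta n) y.
Proof.
rewrite /u /flow_curve /height v0 v1 subr0 subrr min_l ?ler01// min_r ?ler01//.
by rewrite mulr0 addr0.
Qed.

(** In [recovery_bound] every exponential factor tends to 1 and the energies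
    enter multiplied by [eps n]. *)
Lemma recovery_limsup : (limn_esup (fun n => F n (u n)) <= A%:E)%E.
Proof.
apply: limn_esup_le => c; rewrite lte_fin => Ac.
pose s n := eps n * (fine (E (S (eta n) x)) + fine (E (S (eta n) y))).
have sE n : ((eps n)%:E * (E (S (eta n) x) + E (S (eta n) y)))%E = (s n)%:E.
  have [fx _ _] := S_evi x; have [fy _ _] := S_evi y.
  rewrite -[E (S _ x)]fineK ?fin_numElt ?E_gtNy ?fx//.
  by rewrite -[E (S _ y)]fineK ?fin_numElt ?E_gtNy ?fy.
have s0 : s @ \oo --> (0 : R).
  have -> : s = fine \o (fun n => (eps n)%:E * (E (S (eta n) x) + E (S (eta n) y)))%E.
    by apply/funext => n /=; rewrite sE.
  exact: fine_cvg eta_slow.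
(* [m] bounds the energy of the midpoint [u n 2^-1] from below. *)
have [m mP] := E_bounded_below (B := [set p | mdist (v 2^-1) p < 1])
  (ltac:(exists 2 => p q /= h1 h2; have := metric_triangle p (v 2^-1) q;
         rewrite (metric_sym p (v _)); lra)).
(* The right-hand side of [recovery_bound], divided by the smaller one of the
   two factors on the left. *)
pose b n := expR (3 * k * (2 * eps n)) * (expR (k * (2 * eps n)) *
  expR (k * (eta n + 2 * eps n)) ^+ 2 * A + 2 * s n - 4 * eps n * m).
have b_cvg : b @ \oo --> A.
  have eA : A = expR (3 * k * (2 * 0)) * (expR (k * (2 * 0)) *
      expR (k * (0 + 2 * 0)) ^+ 2 * A + 2 * 0 - 4 * 0 * m).
    by rewrite !(mulr0, addr0, expR0, expr1n, mul1r, mul0r, subr0).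
  rewrite [X in _ --> X]eA.
  have ce (w : nat -> R) l : w @ \oo --> l -> (fun n => expR (w n)) @ \oo --> expR l.
    by move=> wl; apply: continuous_cvg => //; exact: continuous_expR.
  have c2e : (fun n => 2 * eps n) @ \oo --> (2 * 0 : R) by exact: cvgMr.
  apply: cvgM; first by apply: ce; exact: cvgMr.
  apply: cvgB; last by apply: cvgMl; exact: cvgMr.
  apply: cvgD; last exact: cvgMr.
  apply: cvgMl; apply: cvgM; first by apply: ce; exact: cvgMr.
  under eq_fun do rewrite expr2; rewrite expr2.
  by apply: cvgM; apply: ce; apply: cvgMr; exact: cvgD.
have bc : \forall n \near \oo, b n < c.
  have cA : 0 < c - A by rewrite subr_gt0.
  have /cvgrPdist_lt/(_ _ cA) := b_cvg; apply: filterS => n.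
  by rewrite ltr_norml; lra.
have := recovery_uniform ltr01; move: bc; apply: filterS2 => n bn un.
have half01 : 0 <= (2^-1 : R) <= 1 by apply/andP; split; lra.
have umid := mP _ (un _ half01).
have [u0 u1] := recovery_ends n.
rewrite /F /endpoint_indicator asboolT// adde0.
have H := recovery_bound k0 E_gtNy E_lsc S_evi S_AC S_cvg (eta_gt0 n) (K0 n) vC vA.
rewrite -/(u n) u0 u1 in H.
set c1 := expR (- k * (2 * eps n)) in H.
set c2 := expR (- (3 * k) * (2 * eps n)) in H.
set C := (X in (_ <= X%:E)%E) in H.
have c20 : 0 < c2 := expR_gt0 _.
have c21 : c2 <= c1.
  by rewrite ler_expR; have := mulr_gt0 k0 (K0 n); lra.
have pe : (c2%:E * perturbed_action E (eps n) (u n) <= C%:E)%E.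
  have a0 := action_ge0 (u n); have s_0 := slope_action_ge0 E (u n).
  have es0 : (0 <= (eps n ^+ 2)%:E * slope_action E (u n))%E.
    by apply: mule_ge0 => //; rewrite lee_fin sqr_ge0.
  apply: le_trans H; rewrite /perturbed_action ge0_muleDr//; apply: leeD.
    by apply: lee_wpmul2r => //; rewrite lee_fin.
  rewrite muleA -EFinM; apply: lee_wpmul2r => //; rewrite lee_fin exprMn; lra.
have c2E : expR (3 * k * (2 * eps n)) * c2 = 1.
  by rewrite -expRD mulNr subrr expR0.
have e3 : 0 < expR (3 * k * (2 * eps n)) := expR_gt0 _.
apply: (@le_trans _ _ (expR (3 * k * (2 * eps n)) * C)%:E).
  have -> : (perturbed_action E (eps n) (u n) = (expR (3 * k * (2 * eps n)))%:E *
      (c2%:E * perturbed_action E (eps n) (u n)))%E by rewrite muleA -EFinM c2E mul1e.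
  by rewrite [leRHS]EFinM; apply: lee_wpmul2l => //; rewrite lee_fin ltW.
rewrite lee_fin; apply: le_trans (ltW bn); apply: ler_wpM2l; first exact: ltW.
rewrite /C; set XA := _ * A.
have umid' : m <= fine (E (u n 2^-1)).
  rewrite -lee_fin fineK// fin_numElt E_gtNy/=.
  have /andP[h0 h1] := half01.
  exact: (flow_curve_fin S_evi (eta_gt0 n) (K0 n) v h0 h1).
have := ler_wpM2l (ltW (eps_gt0 n)) umid'; rewrite /s; lra.
Qed.

End finite_action.

Lemma recovery_sequence (v : R -> X) : C01 v -> exists u : nat -> R -> X,
  [/\ forall n, C01 (u n),
      forall e, 0 < e -> \forall n \near \oo, forall t, 0 <= t <= 1 ->
        mdist (v t) (u n t) < e &
      (limn_esup (fun n => F n (u n)) <= action v + endpoint_indicator x y v)%E].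
Proof.
move=> vC.
have trivial : (action v + endpoint_indicator x y v = +oo)%E ->
  exists u : nat -> R -> X,
  [/\ forall n, C01 (u n),
      forall e, 0 < e -> \forall n \near \oo, forall t, 0 <= t <= 1 ->
        mdist (v t) (u n t) < e &
      (limn_esup (fun n => F n (u n)) <= action v + endpoint_indicator x y v)%E].
  move=> ->; exists (fun _ => v); split=> [//|e e0|]; last exact: leey.
  by apply: nearW => n t _; rewrite mdistxx.
have [[v0 v1]|nv] := pselect (v 0 = x /\ v 1 = y); last first.
  apply: trivial; rewrite /endpoint_indicator asboolF// addey// gt_eqF//.
  by apply: lt_le_trans (action_ge0 v); exact: ltNyr.
have iv : endpoint_indicator x y v = 0%E by rewrite /endpoint_indicator asboolT.
have [vy|vy] := eqVneq (action v) +oo%E.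
  by apply: trivial; rewrite vy addye// iv.
have vA : action v = (fine (action v))%:E.
  by rewrite fineK// ge0_fin_numE ?action_ge0// ltey.
exists (fun n => flow_curve S (eta n) (2 * eps n) v); split.
- move=> n; apply: (flow_curve_C01 k0 S_evi S_AC S_cvg (eta_gt0 n)) => //.
  by rewrite mulr_gt0.
- by move=> e e0; have H := recovery_uniform vA e0; exact: H.
- by rewrite iv adde0 vA; exact: recovery_limsup vC vA v0 v1.
Qed.

End recovery_sequence.

Theorem theorem4p6 (R : realType) (X : metricType R) (E : X -> \bar R)
    (E_gtNy : forall p, (-oo < E p)%E)
    (X_complete : metric_complete X)
    (X_separable : metric_separable X)
    (E_lsc : lower_semicontinuous E)
    (E_dense : closure (edomain E) = [set: X])
    (E_bounded_below : bounded_below_on_bounded E)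
    (lam : R)
    (EVI_exists : forall p, exists g : R -> X, EVI_gradient_flow E lam p g)
    (S : R -> X -> X)
    (S0 : forall p, S 0 p = p)
    (S_flow : forall p, EVI_gradient_flow E lam p (fun t => S t p))
    (x y : X)
    (eps : nat -> R)
    (eps_gt0 : forall n, 0 < eps n)
    (eps_decr : {homo eps : m n / (m <= n)%N >-> n <= m})
    (eps_cvg0 : eps @ \oo --> (0 : R))
    (eta : nat -> R)
    (eta_gt0 : forall n, 0 < eta n)
    (eta_cvg0 : eta @ \oo --> (0 : R))
    (eta_slow : ((eps n)%:E * (E (S (eta n) x) + E (S (eta n) y)))%E
                  @[n --> \oo] --> (0 : \bar R)%E) :
  let F n g := (perturbed_action E (eps n) g
                 + endpoint_indicator (S (eta n) x) (S (eta n) y) g)%E in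
  let F0 g := (action g + endpoint_indicator x y g)%E in
  seq_Gamma_lim (@C01 R X) (@uniform_cvg01 R X) F F0 /\
  (forall sigma : Topological X, assumption_S E sigma ->
     seq_Gamma_lim (@C01 R X) (pointwise_sigma_cvg01 sigma) F F0).
Proof.
move=> F F0; pose k := `|lam| + 1.
have k0 : 0 < k by rewrite /k ltr_wpDl.
have E_dom : exists z, edomain E z.
  have : closure (edomain E) x by rewrite E_dense.
  by move=> /(_ setT filterT)[z [zE _]]; exists z.
have S_evi p : evi_curve E k (S ^~ p).
  exact: evi_flow_curve E_gtNy E_lsc E_dom _ _ (S_flow p).
have S_AC p : AC_loc_pos (S ^~ p) by have [] := S_flow p.
have S_cvg p : S t p @[t --> 0^'+] --> p by have [] := S_flow p.
have start p := flow_start_cvg S_cvg eta_gt0 eta_cvg0 (p := p).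
have rec v (vC : C01 v) := recovery_sequence k0 E_gtNy E_lsc E_bounded_below
  S_evi S_AC S_cvg eps_gt0 eps_cvg0 eta_gt0 eta_cvg0 eta_slow vC.
have point (u : nat -> R -> X) (v : R -> X) : (forall e, 0 < e -> \forall n \near \oo,
    forall t, 0 <= t <= 1 -> mdist (v t) (u n t) < e) ->
    forall t, 0 <= t <= 1 -> u ^~ t @ \oo --> v t.
  move=> uv t t01; apply/cvg_mdistP => e e0.
  by have := uv e e0; apply: filterS => n; apply.
split; [split|move=> sigma HS; split].
- move=> u v _ vC /uniform_cvg01P uv.
  exact: (@gamma_liminf R X E eps (fun a p => a @ \oo --> p)
    _ _ _ _ u v mdist_lsc (start x) (start y) vC (point u v uv)).
- move=> v vC; have [u [uC uv us]] := rec v vC.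
  by exists u; split=> //; apply/uniform_cvg01P.
- move=> u v _ vC uv.
  have sx := sigma_cvg_of_mdist HS (start x).
  have sy := sigma_cvg_of_mdist HS (start y).
  exact: (@gamma_liminf R X E eps (sigma_cvg sigma)
    _ _ _ _ u v (sigma_lsc_mdist HS) sx sy vC uv).
- move=> v vC; have [u [uC uv us]] := rec v vC.
  exists u; split=> // t t01; exact: sigma_cvg_of_mdist HS (point u v uv t t01).
Qed.
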